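(* Let $k\in(0,1)$, and let $H^{(p)},H^{(q)},H^{(r)},H^{(s)}$ be the Hankel matrices $H^{(j)}_{m,n}=h^{(j)}_{m+n}$, $m,n\in\mathbb{N}_0$, $j=p,q,r,s$, where $$h_n^{(p)}=\frac{k^n\Gamma(n+1/2)}{(n+1)!}\,{}_2F_1\!\left(n+\tfrac12,\tfrac12;n+2;k^2\right)=\frac{4k^n}{\sqrt\pi}\int_0^1 t^{2n}\sqrt{\frac{1-t^2}{1-k^2t^2}}\,dt,$$ $$h_n^{(q)}=\frac{k^n\Gamma(n+3/2)}{(n+1)!}\,{}_2F_1\!\left(n+\tfrac32,-\tfrac12;n+2;k^2\right)=\frac{2k^n}{\sqrt\pi}\int_0^1 t^{2n+2}\sqrt{\frac{1-k^2t^2}{1-t^2}}\,dt,$$ $$h_n^{(r)}=\frac{k^n\Gamma(n+1/2)}{n!}\,{}_2F_1\!\left(n+\tfrac12,-\tfrac12;n+1;k^2\right)=\frac{2k^n}{\sqrt\pi}\int_0^1 t^{2n}\sqrt{\frac{1-k^2t^2}{1-t^2}}\,dt,$$ $$h_n^{(s)}=\frac{k^n\Gamma(n+3/2)}{(n+2)!}\,{}_2F_1\!\left(n+\tfrac32,\tfrac12;n+3;k^2\right)=\frac{4k^n}{\sqrt\pi}\int_0^1 t^{2n+2}\sqrt{\frac{1-t^2}{1-k^2t^2}}\,dt.$$ Then each $H^{(j)}$, $j=p,q,r,s$, represents a positive trace class operator on $\ell^2(\mathbb{N}_0)$ with simple eigenvalues. The eigenvalues, enumerated in descending order, are respectively $$\nu_m^{(p)}=\frac{4\sqrt\pi}{k}\frac{q^{m+1/2}}{1+q^{2m+1}}\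 (m\ge0),\qquad \nu_m^{(q)}=\frac{2\sqrt\pi}{k}\frac{q^{m+1/2}}{1+q^{2m+1}}\ (m\ge0),$$ $$\nu_m^{(r)}=2\sqrt\pi\,\frac{q^m}{1+q^{2m}}\ (m\ge0),\qquad \nu_m^{(s)}=\frac{4\sqrt\pi}{k^2}\frac{q^m}{1+q^{2m}}\ (m\ge1).$$ An eigenvector $\Psi_m^{(j)}$ corresponding to $\nu_m^{(j)}$ can be chosen with the entries, for $n\in\mathbb{N}_0$, $$(\Psi_m^{(p)})_n=\frac{(-1)^n}{k^n(2n)!}\,p_n\!\left(\frac{\pi^2(2m+1)^2}{4K^2}\right),\qquad (\Psi_m^{(q)})_n=\frac{(-1)^n}{k^n(2n+1)!}\,q_n\!\left(\frac{\pi^2(2m+1)^2}{4K^2}\right),$$ $$(\Psi_m^{(r)})_n=\frac{(-1)^n}{k^n(2n)!}\,r_n\!\left(\frac{\pi^2m^2}{K^2}\right),\qquad (\Psi_m^{(s)})_n=\frac{(-1)^n}{k^n(2n+1)!}\,s_n\!\left(\frac{\pi^2m^2}{K^2}\right).$$ The $\ell^2$-norms of the eigenvectors equal $$\|\Psi_m^{(p)}\|^2=\frac{kK}{2\pi}\frac{1+q^{2m+1}}{q^{m+1/2}},\qquad \|\Psi_m^{(q)}\|^2=\frac{2kK^3}{\pi^3}\frac{1+q^{2m+1}}{(2m+1)^2q^{m+1/2}},$$ $$\|\Psi_m^{(r)}\|^2=\frac{K}{2\pi}\frac{1+q^{2m}}{q^m},\qquad \|\Psi_m^{(s)}\|^2=\frac{k^2K^3}{2\pi^3}\frac{1+q^{2m}}{m^2q^m},$$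 with $m$ in the same range as for the respective eigenvalues.
   Context: $\mathbb{N}_0=\{0,1,2,\dots\}$. ${}_2F_1(a,b;c;z)$ is the Gauss hypergeometric function. For $k\in(0,1)$: $K=K(k)=\int_0^{\pi/2}\frac{d\theta}{\sqrt{1-k^2\sin^2\theta}}$ is the complete elliptic integral of the first kind, $K'(k)=K(\sqrt{1-k^2})$, and $q=q(k)=\exp(-\pi K'(k)/K(k))\in(0,1)$ is the elliptic nome (the number $q$ is not to be confused with the polynomials $q_n$). The monic Stieltjes-Carlitz polynomials $p_n,q_n,r_n,s_n$ (depending on $k$) are defined for $n\ge0$ by the recurrences $$p_{n+1}(x)=\big(x-k^2(2n)^2-(2n+1)^2\big)p_n(x)-k^2(2n)^2(2n-1)^2p_{n-1}(x),$$ $$q_{n+1}(x)=\big(x-(2n+1)^2-k^2(2n+2)^2\big)q_n(x)-k^2(2n+1)^2(2n)^2q_{n-1}(x),$$ $$r_{n+1}(x)=\big(x-(2n)^2-k^2(2n+1)^2\big)r_n(x)-k^2(2n)^2(2n-1)^2r_{n-1}(x),$$ $$s_{n+1}(x)=\big(x-k^2(2n+1)^2-(2n+2)^2\big)s_n(x)-k^2(2n+1)^2(2n)^2s_{n-1}(x),$$ with initial conditions: the polynomial of index $-1$ is $0$ and the polynomial of index $0$ is $1$. The enumerated eigenvalues are all the eigenvalues of the respective operator; ''simple'' means multiplicity one.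
   Formalization: The printed norm of Ψ_0^{(r)} (the case m=0) is false: it gives K/π, which tends to 1/2 as k→0, though the entry n=0 equals 1; the formal statement has the correct value 2K/π for m=0 and the printed formula for m≥1. *)

(* Defs.v *)
(* Stdlib reals with Coquelicot. *)
From Stdlib Require Import Reals Factorial.
From Coquelicot Require Import Coquelicot.
Open Scope R_scope.

(** * Special functions *)

Definition ellK (k : R) : R :=
  RInt (fun theta => / sqrt (1 - k ^ 2 * sin theta ^ 2)) 0 (PI / 2).

Definition nome (k : R) : R :=
  exp (- (PI * ellK (sqrt (1 - k ^ 2)) / ellK k)).

(** Euler's integral; only meaningful for [0 < x]. *)
Definition Gamma (x : R) : R :=
  RInt_gen (fun t => Rpower t (x - 1) * exp (- t))
    (at_right 0) (Rbar_locally p_infty).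

Fixpoint pochhammer (a : R) (n : nat) : R :=
  match n with
  | O => 1
  | S n' => pochhammer a n' * (a + INR n')
  end.

(** Gauss series; only meaningful for [Rabs z < 1] and [c] not in
    {0, -1, -2, ...}. *)
Definition hyp2F1 (a b c z : R) : R :=
  PSeries (fun i => pochhammer a i * pochhammer b i
                      / (pochhammer c i * INR (fact i))) z.

(** * Stieltjes-Carlitz polynomials (as polynomial functions) *)

(** Solution of [y_(n+1) = (x - a n) y_n - b n y_(n-1)] with
    [y_(-1) = 0] and [y_0 = 1]. *)
Fixpoint monic_rec (a b : nat -> R) (x : R) (n : nat) : R :=
  match n with
  | O => 1
  | S n' =>
      (x - a n') * monic_rec a b x n'
      - b n' * match n' with
               | O => 0
               | S n'' => monic_rec a b x n''
               end
  end.

Definition SC_p (k : R) (n : nat) (x : R) : R :=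
  monic_rec
    (fun n => k ^ 2 * (2 * INR n) ^ 2 + (2 * INR n + 1) ^ 2)
    (fun n => k ^ 2 * (2 * INR n) ^ 2 * (2 * INR n - 1) ^ 2) x n.

Definition SC_q (k : R) (n : nat) (x : R) : R :=
  monic_rec
    (fun n => (2 * INR n + 1) ^ 2 + k ^ 2 * (2 * INR n + 2) ^ 2)
    (fun n => k ^ 2 * (2 * INR n + 1) ^ 2 * (2 * INR n) ^ 2) x n.

Definition SC_r (k : R) (n : nat) (x : R) : R :=
  monic_rec
    (fun n => (2 * INR n) ^ 2 + k ^ 2 * (2 * INR n + 1) ^ 2)
    (fun n => k ^ 2 * (2 * INR n) ^ 2 * (2 * INR n - 1) ^ 2) x n.

Definition SC_s (k : R) (n : nat) (x : R) : R :=
  monic_rec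
    (fun n => k ^ 2 * (2 * INR n + 1) ^ 2 + (2 * INR n + 2) ^ 2)
    (fun n => k ^ 2 * (2 * INR n + 1) ^ 2 * (2 * INR n) ^ 2) x n.

(** * Hankel matrices *)

Definition hankel (h : nat -> R) (m n : nat) : R := h (m + n)%nat.

Definition h_p (k : R) (n : nat) : R :=
  k ^ n * Gamma (INR n + 1 / 2) / INR (fact (n + 1))
  * hyp2F1 (INR n + 1 / 2) (1 / 2) (INR n + 2) (k ^ 2).

Definition h_q (k : R) (n : nat) : R :=
  k ^ n * Gamma (INR n + 3 / 2) / INR (fact (n + 1))
  * hyp2F1 (INR n + 3 / 2) (- (1 / 2)) (INR n + 2) (k ^ 2).

Definition h_r (k : R) (n : nat) : R :=
  k ^ n * Gamma (INR n + 1 / 2) / INR (fact n)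
  * hyp2F1 (INR n + 1 / 2) (- (1 / 2)) (INR n + 1) (k ^ 2).

Definition h_s (k : R) (n : nat) : R :=
  k ^ n * Gamma (INR n + 3 / 2) / INR (fact (n + 2))
  * hyp2F1 (INR n + 3 / 2) (1 / 2) (INR n + 3) (k ^ 2).

(** * Operators on the complex Hilbert space l^2 *)

(** Vectors are square-summable functions [nat -> C].  An operator is a
    function on all of [nat -> C] of which only the values on [in_l2] matter;
    equality of vectors is pointwise. *)

Definition in_l2 (u : nat -> C) : Prop :=
  ex_series (fun n => Cmod (u n) ^ 2).

(** Componentwise sum; the summands below are absolutely summable whenever
    the vectors involved are in l^2. *)
Definition Cseries (u : nat -> C) : C :=
  (Series (fun n => Re (u n)), Series (fun n => Im (u n))).

Definition l2_inner (u v : nat -> C) : C :=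
  Cseries (fun n => (u n * Cconj (v n))%C).

Definition l2_norm (u : nat -> C) : R :=
  sqrt (Series (fun n => Cmod (u n) ^ 2)).

Definition bounded_operator (T : (nat -> C) -> (nat -> C)) : Prop :=
  (forall u, in_l2 u -> in_l2 (T u)) /\
  (forall (a b : C) u v, in_l2 u -> in_l2 v ->
     forall n, T (fun i => (a * u i + b * v i)%C) n
               = (a * T u n + b * T v n)%C) /\
  (exists M : R, forall u, in_l2 u -> l2_norm (T u) <= M * l2_norm u).

Definition l2_unit (n : nat) : nat -> C :=
  fun i => if Nat.eqb i n then RtoC 1 else RtoC 0.

Definition represents (H : nat -> nat -> R)
    (T : (nat -> C) -> (nat -> C)) : Prop :=
  bounded_operator T /\
  forall m n, T (l2_unit n) m = RtoC (H m n).

(** On a complex space this includes self-adjointness. *)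
Definition positive_operator (T : (nat -> C) -> (nat -> C)) : Prop :=
  forall u, in_l2 u ->
    Im (l2_inner (T u) u) = 0 /\ 0 <= Re (l2_inner (T u) u).

(** [A = |T|]: the bounded positive square root of [T* T], the identity
    [A A = T* T] being tested against vectors. *)
Definition is_modulus (T A : (nat -> C) -> (nat -> C)) : Prop :=
  bounded_operator A /\ positive_operator A /\
  forall u v, in_l2 u -> in_l2 v ->
    l2_inner (A (A u)) v = l2_inner (T u) (T v).

Definition orthonormal_basis (e : nat -> nat -> C) : Prop :=
  (forall j, in_l2 (e j)) /\
  (forall i j, l2_inner (e i) (e j)
               = if Nat.eqb i j then RtoC 1 else RtoC 0) /\
  (forall u, in_l2 u -> (forall j, l2_inner u (e j) = RtoC 0) ->
     forall n, u n = RtoC 0).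

Definition trace_class (T : (nat -> C) -> (nat -> C)) : Prop :=
  bounded_operator T /\
  exists A, is_modulus T A /\
    forall e, orthonormal_basis e ->
      ex_series (fun j => Re (l2_inner (A (e j)) (e j))).

Definition is_eigenvector (T : (nat -> C) -> (nat -> C)) (lambda : C)
    (u : nat -> C) : Prop :=
  in_l2 u /\ (exists n, u n <> RtoC 0) /\
  forall n, T u n = (lambda * u n)%C.

Definition is_eigenvalue (T : (nat -> C) -> (nat -> C)) (lambda : C) : Prop :=
  exists u, is_eigenvector T lambda u.

Definition simple_eigenvalue (T : (nat -> C) -> (nat -> C)) (lambda : C)
    : Prop :=
  exists u, is_eigenvector T lambda u /\
    forall v, is_eigenvector T lambda v ->
      exists c : C, forall n, v n = (c * u n)%C.

(** [H] represents a positive trace class operator with simple eigenvalues;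
    these are exactly [nu m0 > nu (m0 + 1) > ...], and [Psi m] is an
    eigenvector for [nu m] with squared l^2-norm [N m]. *)
Definition has_spectral_data (H : nat -> nat -> R) (m0 : nat)
    (nu : nat -> R) (Psi : nat -> nat -> R) (N : nat -> R) : Prop :=
  exists T : (nat -> C) -> (nat -> C),
    represents H T /\
    positive_operator T /\
    trace_class T /\
    (forall lambda : C, is_eigenvalue T lambda <->
       exists m, (m0 <= m)%nat /\ lambda = RtoC (nu m)) /\
    (forall lambda : C, is_eigenvalue T lambda -> simple_eigenvalue T lambda) /\
    (forall m, (m0 <= m)%nat -> nu (S m) < nu m) /\
    (forall m, (m0 <= m)%nat ->
       is_eigenvector T (RtoC (nu m)) (fun n => RtoC (Psi m n)) /\
       l2_norm (fun n => RtoC (Psi m n)) ^ 2 = N m).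

(* Main.v *)
(** Put [u = ellF k x] (so that [sin x = sn u], [cos x = cn u],
    [Delta k x = dn u]), [e_n = k^n sin^(2n) g] with [g] one of [dn], [cn],
    [sn dn], [sn cn], and let [f_m] be the corresponding Neumann or Dirichlet
    trigonometric functions [cos (w_m u)] or [sin (w_m u)] on [[0, K]].  The
    Hankel matrix is, up to a constant, the Gram matrix of [e_n] in
    [L^2 (0, K)].  The second [u]-derivative acts tridiagonally on the [e_n],
    so the coefficients [<e_n, f_m>] satisfy the Stieltjes-Carlitz recurrence
    and, by Christoffel-Darboux, are orthogonal in l^2 for different [m];
    completeness of the [f_m] then gives [sum_n <e_n, f_m> e_n = c_m f_m], which
    is the eigenvector equation, and completeness of the eigenvectors.

    The eigenvalues reduce to the Fourier coefficients of [dn] and [cn].  For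
    these, [int Re dn(u + i v) cos(w u) du] solves [G'' = w^2 G] in [v] since
    the integrand is harmonic, hence is a multiple of [cosh (w v)]; as [v]
    tends to [K'] the positive kernel [Re dn(u + i v)] concentrates at the pole
    [i K'] with mass [PI / 2] on [[0, K]] ([PI / (2 k)] for [cn]). *)

(* Completeness gives [sum_n <e_n, f_m> e_n = c_m f_m] only up to the constant [c_m]. Dividing by
   [g] and letting [u] tend to 0 leaves the single term [n = 0], so that [c_m = <e_0, f_m> / L m]
   with [L m] the limit of [f_m / g]. An eigenvalue therefore needs just one Fourier coefficient,
   and pairing the same expansion with [f_m] yields the norm of the eigenvector. All functions of
   [u] are written in the amplitude [x], with [du = dx / Delta k x]: the elliptic integral is never
   inverted, and the Jacobi functions become [sin], [cos] and [Delta]. Complex arguments are avoided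
   as well: the addition formula for [dn(u + i v)] is expanded in powers of [sn(v)^2], the Fourier
   integral becomes a power series whose coefficients are moments of powers of [dn], and harmonicity
   turns into a three-term recurrence for these moments. *)
Require Import Defs.
From Stdlib Require Import Reals Factorial.
From Coquelicot Require Import Coquelicot.
From Stdlib Require Import Lra Lia Psatz Classical.
Open Scope R_scope.

(** * Square-summable sequences *)

(** Coquelicot leaves equations at types convertible to [R] that [ring] and
    [field] do not recognize. *)
Ltac Rring := cbv beta; lazymatch goal with |- @eq _ ?a ?b => change (@eq R a b) end; ring.

Ltac Rfield := cbv beta; lazymatch goal with |- @eq _ ?a ?b => change (@eq R a b) end; field.

Definition sqs (u : nat -> R) : Prop := ex_series (fun n => u n ^ 2).
Definition ip (u v : nat -> R) : R := Series (fun n => u n * v n).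

Lemma sum_n_Sn (a : nat -> R) (n : nat) : sum_n a (S n) = sum_n a n + a (S n).
Proof. rewrite sum_Sn. reflexivity. Qed.

Lemma sum_n_scal (c : R) (a : nat -> R) (n : nat) :
  sum_n (fun i => c * a i) n = c * sum_n a n.
Proof.
  induction n; [now rewrite !sum_O|]. rewrite !sum_n_Sn, IHn. Rring.
Qed.

Lemma ex_series_scal_R (c : R) (a : nat -> R) : ex_series a -> ex_series (fun n => c * a n).
Proof. apply (ex_series_scal (K := R_AbsRing) (V := R_NormedModule)). Qed.

Lemma ex_series_Rle (a b : nat -> R) :
  (forall n, Rabs (a n) <= b n) -> ex_series b -> ex_series a.
Proof.
  intros H Hb. apply (ex_series_le (K := R_AbsRing) (V := R_CompleteNormedModule) a b); auto.
Qed.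

Lemma ex_series_Rext (a b : nat -> R) :
  (forall n, a n = b n) -> ex_series a -> ex_series b.
Proof. apply ex_series_ext. Qed.

Lemma Series_nonneg (a : nat -> R) : (forall n, 0 <= a n) -> ex_series a -> 0 <= Series a.
Proof.
  intros H He. replace 0 with (Series (fun _ : nat => 0)).
  - apply Series_le; auto. intros n; split; [lra | apply H].
  - apply is_series_unique. apply filterlim_ext with (fun _ : nat => 0).
    + intros n. symmetry. induction n.
      * now rewrite sum_O.
      * rewrite sum_Sn, IHn. unfold plus; simpl; ring.
    + apply filterlim_const.
Qed.

Lemma sum_n_le_Series (a : nat -> R) (n : nat) :
  (forall i, 0 <= a i) -> ex_series a -> sum_n a n <= Series a.
Proof.
  intros Ha He.
  rewrite (Series_incr_n a (S n)) by (auto; lia). simpl pred.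
  rewrite sum_n_Reals.
  assert (0 <= Series (fun k => a (S n + k)%nat)); [|lra].
  apply Series_nonneg; auto. now apply (ex_series_incr_n a (S n)).
Qed.

Lemma term_le_Series (a : nat -> R) (n : nat) :
  (forall i, 0 <= a i) -> ex_series a -> a n <= Series a.
Proof.
  intros Ha He. apply Rle_trans with (sum_n a n).
  - destruct n.
    + rewrite sum_O; lra.
    + rewrite sum_Sn. unfold plus; simpl.
      assert (0 <= sum_n a n); [|lra].
      clear -Ha. induction n.
      * rewrite sum_O; auto.
      * rewrite sum_Sn. unfold plus; simpl. specialize (Ha (S n)); lra.
  - now apply sum_n_le_Series.
Qed.

Lemma ex_series_of_bounded (a : nat -> R) (B : R) :
  (forall n, 0 <= a n) -> (forall n, sum_n a n <= B) -> ex_series a.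
Proof.
  intros Ha HB. destruct (ex_finite_lim_seq_incr (sum_n a) B) as [l Hl]; auto.
  - intros n. rewrite sum_Sn. unfold plus; simpl. specialize (Ha (S n)). lra.
  - exists l. exact Hl.
Qed.

Lemma sqs_mult (u v : nat -> R) : sqs u -> sqs v -> ex_series (fun n => u n * v n).
Proof.
  intros Hu Hv.
  apply ex_series_Rle with (fun n => u n ^ 2 + v n ^ 2).
  - intros n. apply Rabs_le. split; nra.
  - apply (ex_series_plus (fun n => u n ^ 2) (fun n => v n ^ 2)); auto.
Qed.

Lemma ex_series_lin (a b : nat -> R) (x y : R) :
  ex_series a -> ex_series b -> ex_series (fun n => x * a n + y * b n).
Proof.
  intros Ha Hb.
  apply (ex_series_plus (fun n => x * a n) (fun n => y * b n));
    now apply ex_series_scal_R.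
Qed.

Lemma Series_lin (a b : nat -> R) (x y : R) :
  ex_series a -> ex_series b ->
  Series (fun n => x * a n + y * b n) = x * Series a + y * Series b.
Proof.
  intros Ha Hb. rewrite Series_plus.
  - now rewrite !Series_scal_l.
  - now apply ex_series_scal_R.
  - now apply ex_series_scal_R.
Qed.

Lemma sqs_lin (u v : nat -> R) (x y : R) :
  sqs u -> sqs v -> sqs (fun n => x * u n + y * v n).
Proof.
  intros Hu Hv.
  apply ex_series_Rle with (fun n => (2 * x ^ 2) * u n ^ 2 + (2 * y ^ 2) * v n ^ 2).
  - intros n. rewrite Rabs_pos_eq by apply pow2_ge_0.
    assert (0 <= (x * u n - y * v n) ^ 2) by apply pow2_ge_0. nra.
  - now apply ex_series_lin.
Qed.

Lemma ip_sym (u v : nat -> R) : ip u v = ip v u.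
Proof. apply Series_ext. intros; ring. Qed.

Lemma ip_lin (u v w : nat -> R) (x y : R) :
  sqs u -> sqs v -> sqs w ->
  ip (fun n => x * u n + y * v n) w = x * ip u w + y * ip v w.
Proof.
  intros. unfold ip. rewrite <- Series_lin by now apply sqs_mult.
  apply Series_ext; intros; ring.
Qed.

Lemma ip_self (u : nat -> R) : ip u u = Series (fun n => u n ^ 2).
Proof. apply Series_ext. intros; ring. Qed.

Lemma ip_ge0 (u : nat -> R) : sqs u -> 0 <= ip u u.
Proof. intros H. rewrite ip_self. apply Series_nonneg; auto. intros; apply pow2_ge_0. Qed.

Lemma entry_sqr_le_ip (u : nat -> R) (n : nat) : sqs u -> u n ^ 2 <= ip u u.
Proof.
  intros H. rewrite ip_self. apply (term_le_Series (fun n => u n ^ 2)); auto.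
  intros; apply pow2_ge_0.
Qed.

Lemma ip_Cauchy_Schwarz (u v : nat -> R) : sqs u -> sqs v -> ip u v ^ 2 <= ip u u * ip v v.
Proof.
  intros Hu Hv.
  assert (Hq : forall x y, 0 <= x ^ 2 * ip u u + 2 * x * y * ip u v + y ^ 2 * ip v v).
  { intros x y. pose proof (ip_ge0 _ (sqs_lin u v x y Hu Hv)) as H.
    rewrite ip_lin in H; auto using sqs_lin.
    rewrite (ip_sym u), (ip_sym v), !ip_lin in H; auto.
    rewrite (ip_sym v u) in H. lra. }
  pose proof (ip_ge0 _ Hu). pose proof (ip_ge0 _ Hv).
  destruct (Req_dec (ip v v) 0) as [E|E].
  - rewrite E. destruct (Req_dec (ip u v) 0) as [E'|E'].
    + rewrite E'; lra.
    (* When [ip v v = 0] the form is affine in [y], and this [y] gives it the value -1. *)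
    + specialize (Hq 1 (- (ip u u + 1) / (2 * ip u v))). rewrite E in Hq.
      replace (_ + _) with (-1) in Hq by (field; auto). lra.
  - specialize (Hq (ip v v) (- ip u v)).
    assert (0 <= ip v v * (ip u u * ip v v - ip u v ^ 2)) by lra.
    destruct (Rle_lt_dec (ip u v ^ 2) (ip u u * ip v v)); [assumption|].
    assert (0 < ip v v) by lra. nra.
Qed.

Lemma geom_sqs (r : R) : 0 <= r < 1 -> sqs (fun n => r ^ n).
Proof.
  intros Hr. apply ex_series_Rext with (fun n => (r ^ 2) ^ n).
  - intros n. rewrite <- !pow_mult. f_equal; lia.
  - apply ex_series_geom. rewrite Rabs_pos_eq; nra.
Qed.

Lemma sqs_abs (u : nat -> R) : sqs u -> sqs (fun n => Rabs (u n)).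
Proof. apply ex_series_Rext. intros n. now rewrite pow2_abs. Qed.

Lemma sqs_ext (u v : nat -> R) : (forall n, u n = v n) -> sqs u -> sqs v.
Proof. intros H. apply ex_series_Rext. intros n; now rewrite H. Qed.

Lemma ip_ext (u u' v v' : nat -> R) :
  (forall n, u n = u' n) -> (forall n, v n = v' n) -> ip u v = ip u' v'.
Proof. intros H H'. apply Series_ext; intros; now rewrite H, H'. Qed.

Lemma is_series_delta (a : nat -> R) (n : nat) :
  is_series (fun i => a i * (if Nat.eqb i n then 1 else 0)) (a n).
Proof.
  assert (H0 : forall m, sum_n (fun i => a i * (if Nat.eqb i n then 1 else 0)) m
                         = if Nat.leb n m then a n else 0).
  { intros m. induction m as [|m IH].
    - rewrite sum_O. destruct n; simpl; ring.
    - rewrite sum_Sn, IH. unfold plus; simpl plus.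
      destruct (Nat.eqb_spec (S m) n), (Nat.leb_spec n m), (Nat.leb_spec n (S m));
        subst; simpl; try lia; try ring. }
  apply filterlim_ext_loc with (fun _ => a n); [|apply filterlim_const].
  exists n. intros m Hm. rewrite H0. destruct (Nat.leb_spec n m); [auto|lia].
Qed.

Lemma Series_sum_n (a : nat -> nat -> R) (J : nat) :
  (forall j, ex_series (a j)) ->
  ex_series (fun m => sum_n (fun j => a j m) J) /\
  Series (fun m => sum_n (fun j => a j m) J) = sum_n (fun j => Series (a j)) J.
Proof.
  intros Ha. induction J as [|J [IH1 IH2]].
  - split.
    + apply ex_series_Rext with (a 0%nat); auto. intros; now rewrite sum_O.
    + rewrite sum_O. apply Series_ext. intros; now rewrite sum_O.
  - assert (E : forall m, 1 * sum_n (fun j => a j m) J + 1 * a (S J) m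
                          = sum_n (fun j => a j m) (S J)).
    { intros m. rewrite sum_Sn. unfold plus; simpl; ring. }
    split.
    + eapply ex_series_Rext; [exact E|]. now apply ex_series_lin.
    + rewrite sum_Sn, <- IH2. rewrite <- (Series_ext _ _ E).
      rewrite Series_lin; auto. unfold plus; simpl; ring.
Qed.

Lemma Cmod_sqr (z : C) : Cmod z ^ 2 = Re z ^ 2 + Im z ^ 2.
Proof.
  unfold Cmod. rewrite pow2_sqrt; [reflexivity|].
  apply Rplus_le_le_0_compat; apply pow2_ge_0.
Qed.

Lemma in_l2_iff (u : nat -> C) :
  in_l2 u <-> sqs (fun n => Re (u n)) /\ sqs (fun n => Im (u n)).
Proof.
  unfold in_l2, sqs. split.
  - intros H; split; apply ex_series_Rle with (2 := H); intros n;
      rewrite Cmod_sqr, Rabs_pos_eq by apply pow2_ge_0;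
      [pose proof (pow2_ge_0 (Im (u n))) | pose proof (pow2_ge_0 (Re (u n)))]; lra.
  - intros [H1 H2]. eapply ex_series_Rext.
    2: exact (ex_series_lin _ _ 1 1 H1 H2).
    intros n. cbv beta. rewrite (Cmod_sqr (u n)). ring.
Qed.

Lemma l2_inner_ip (u v : nat -> C) :
  in_l2 u -> in_l2 v ->
  l2_inner u v =
  (ip (fun n => Re (u n)) (fun n => Re (v n)) + ip (fun n => Im (u n)) (fun n => Im (v n)),
   ip (fun n => Im (u n)) (fun n => Re (v n)) - ip (fun n => Re (u n)) (fun n => Im (v n))).
Proof.
  intros Hu Hv. apply in_l2_iff in Hu as [? ?]. apply in_l2_iff in Hv as [? ?].
  unfold l2_inner, Cseries, ip. f_equal.
  - rewrite <- Series_plus by now apply sqs_mult.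
    apply Series_ext. intros n. unfold Re, Im; simpl; ring.
  - rewrite <- Series_minus by now apply sqs_mult.
    apply Series_ext. intros n. unfold Re, Im; simpl; ring.
Qed.

Lemma Series_Cmod_sqr (u : nat -> C) :
  in_l2 u ->
  Series (fun n => Cmod (u n) ^ 2) =
  ip (fun n => Re (u n)) (fun n => Re (u n)) + ip (fun n => Im (u n)) (fun n => Im (u n)).
Proof.
  intros Hu. apply in_l2_iff in Hu as [? ?]. unfold ip.
  rewrite <- Series_plus by now apply sqs_mult.
  apply Series_ext. intros n. rewrite Cmod_sqr. ring.
Qed.

(** Evaluating [w = sum_j c_j e_j] with [c_j = Re (e_j n)] (resp. [Im]) at [n]
    gives [S = sum_j c_j ^ 2], while [S] is also the squared norm of [w];
    hence [S ^ 2 <= S]. *)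
Lemma orthonormal_entries_bounded (e : nat -> nat -> C) (n J : nat) :
  (forall j, in_l2 (e j)) ->
  (forall i j, l2_inner (e i) (e j) = if Nat.eqb i j then RtoC 1 else RtoC 0) ->
  sum_n (fun j => Re (e j n) ^ 2 + Im (e j n) ^ 2) J <= 2.
Proof.
  intros He Ho.
  set (a := fun j i => Re (e j i)). set (b := fun j i => Im (e j i)).
  assert (Ha : forall j, sqs (a j)) by (intros j; apply (proj1 (in_l2_iff _) (He j))).
  assert (Hb : forall j, sqs (b j)) by (intros j; apply (proj1 (in_l2_iff _) (He j))).
  assert (Hab : forall i j, ip (a i) (a j) + ip (b i) (b j) = if Nat.eqb i j then 1 else 0).
  { intros i j. specialize (Ho i j). rewrite l2_inner_ip in Ho by auto.
    apply (f_equal fst) in Ho. simpl in Ho. unfold a, b. rewrite Ho.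
    destruct (Nat.eqb i j); reflexivity. }
  set (W := fun (c : nat -> R) (x : nat -> nat -> R) J i => (sum_n (fun j => c j * x j i) J : R)).
  assert (WS : forall c x J i, W c x (S J) i = 1 * W c x J i + c (S J) * x (S J) i).
  { intros. unfold W. rewrite sum_Sn. unfold plus; simpl; ring. }
  assert (Wl : forall c x, (forall j, sqs (x j)) -> forall J, sqs (W c x J)).
  { intros c x Hx. induction J0.
    - apply sqs_ext with (fun i => c 0%nat * x 0%nat i + 0 * x 0%nat i).
      + intros i. unfold W. rewrite sum_O. ring.
      + now apply sqs_lin.
    - eapply sqs_ext; [intros i; symmetry; apply WS|]. now apply sqs_lin. }
  assert (Worth : forall c J l, (J < l)%nat ->
     ip (W c a J) (a l) + ip (W c b J) (b l) = 0).
  { intros c. induction J0; intros l Hl.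
    - rewrite (ip_ext (W c a 0%nat) (fun i => c 0%nat * a 0%nat i + 0 * a 0%nat i) (a l) (a l));
        [|intros; unfold W; rewrite sum_O; ring|auto].
      rewrite (ip_ext (W c b 0%nat) (fun i => c 0%nat * b 0%nat i + 0 * b 0%nat i) (b l) (b l));
        [|intros; unfold W; rewrite sum_O; ring|auto].
      rewrite !ip_lin by auto. specialize (Hab 0%nat l).
      destruct (Nat.eqb_spec 0 l); [lia|nra].
    - rewrite (ip_ext _ _ (a l) (a l) (WS c a J0)) by auto.
      rewrite (ip_ext _ _ (b l) (b l) (WS c b J0)) by auto.
      rewrite !ip_lin by auto. specialize (Hab (S J0) l).
      specialize (IHJ0 l ltac:(lia)).
      destruct (Nat.eqb_spec (S J0) l); [lia|nra]. }
  assert (Wnorm : forall c J,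
     ip (W c a J) (W c a J) + ip (W c b J) (W c b J) = sum_n (fun j => c j ^ 2) J).
  { intros c. induction J0.
    - rewrite sum_O.
      assert (E : forall x i, W c x 0%nat i = c 0%nat * x 0%nat i + 0 * x 0%nat i)
        by (intros; unfold W; rewrite sum_O; ring).
      rewrite (ip_ext _ _ _ _ (E a) (E a)), (ip_ext _ _ _ _ (E b) (E b)).
      rewrite !ip_lin by auto using sqs_lin.
      rewrite (ip_sym (a 0%nat)), (ip_sym (b 0%nat)), !ip_lin by auto.
      specialize (Hab 0%nat 0%nat). simpl in Hab. simpl. nra.
    - rewrite (ip_ext _ _ _ _ (WS c a J0) (WS c a J0)), (ip_ext _ _ _ _ (WS c b J0) (WS c b J0)).
      rewrite !ip_lin by auto using sqs_lin.
      rewrite (ip_sym (a _) (fun _ => _)), (ip_sym (b _) (fun _ => _)),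
        (ip_sym (W _ _ _) (fun _ => _)), (ip_sym (W _ b _) (fun _ => _)), !ip_lin by auto.
      rewrite (ip_sym (a (S J0)) (W _ _ _)), (ip_sym (b (S J0)) (W _ _ _)).
      rewrite sum_Sn, <- IHJ0. specialize (Worth c J0 (S J0) ltac:(lia)).
      specialize (Hab (S J0) (S J0)). rewrite Nat.eqb_refl in Hab.
      unfold plus; simpl. nra. }
  assert (B1 : sum_n (fun j => a j n ^ 2) J <= 1).
  { specialize (Wnorm (fun j => a j n) J).
    pose proof (entry_sqr_le_ip (W (fun j => a j n) a J) n (Wl _ _ Ha J)) as H.
    pose proof (ip_ge0 _ (Wl (fun j => a j n) b Hb J)).
    assert (E : W (fun j => a j n) a J n = sum_n (fun j => a j n ^ 2) J)
      by (unfold W; apply sum_n_ext; intros; Rring).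
    rewrite E in H. nra. }
  assert (B2 : sum_n (fun j => b j n ^ 2) J <= 1).
  { specialize (Wnorm (fun j => b j n) J).
    pose proof (entry_sqr_le_ip (W (fun j => b j n) b J) n (Wl _ _ Hb J)) as H.
    pose proof (ip_ge0 _ (Wl (fun j => b j n) a Ha J)).
    assert (E : W (fun j => b j n) b J n = sum_n (fun j => b j n ^ 2) J)
      by (unfold W; apply sum_n_ext; intros; Rring).
    rewrite E in H. nra. }
  pose proof (sum_n_plus (fun j => a j n ^ 2) (fun j => b j n ^ 2) J) as H.
  unfold plus in H; simpl in H. unfold a, b in *. simpl in *. rewrite H. lra.
Qed.

(** * Hankel operators with geometrically decaying entries *)

Definition hmul (h u : nat -> R) (n : nat) : R := Series (fun j => h (n + j)%nat * u j).

Section HankelOperator.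
Context (h : nat -> R) (M r : R).
Hypothesis Hr : 0 <= r < 1.
Hypothesis Hh : forall n, Rabs (h n) <= M * r ^ n.

Lemma hankel_bound_ge0 : 0 <= M.
Proof. specialize (Hh 0%nat). pose proof (Rabs_pos (h 0%nat)). simpl in Hh. lra. Qed.

Lemma ex_hmul (u : nat -> R) (n : nat) : sqs u -> ex_series (fun j => h (n + j)%nat * u j).
Proof.
  intros Hu. apply sqs_mult; auto.
  apply ex_series_Rle with (fun j => (M * r ^ n) ^ 2 * (r ^ j) ^ 2).
  - intros j. rewrite Rabs_pos_eq by apply pow2_ge_0. rewrite <- Rpow_mult_distr, <- pow2_abs.
    apply pow_incr. split; [apply Rabs_pos|].
    rewrite Rmult_assoc, <- pow_add. apply Hh.
  - apply ex_series_scal_R. now apply geom_sqs.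
Qed.

Lemma hmul_lin (u v : nat -> R) (x y : R) (n : nat) : sqs u -> sqs v ->
  hmul h (fun i => x * u i + y * v i) n = x * hmul h u n + y * hmul h v n.
Proof.
  intros. unfold hmul. rewrite <- Series_lin by now apply ex_hmul.
  apply Series_ext; intros; ring.
Qed.

Lemma ex_geom_abs (u : nat -> R) : sqs u -> ex_series (fun j => r ^ j * Rabs (u j)).
Proof. intros. apply sqs_mult; [now apply geom_sqs | now apply sqs_abs]. Qed.

(** Since [r ^ (n + j) = r ^ n * r ^ j], the Hankel matrix is dominated entrywise by [M] times a
    rank-one matrix. Boundedness on l^2, with the bound [M / (1 - r ^ 2)], comes from this. *)
Lemma hmul_abs_le (u : nat -> R) (n : nat) : sqs u ->
  Rabs (hmul h u n) <= M * Series (fun j => r ^ j * Rabs (u j)) * r ^ n.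
Proof.
  intros Hu. unfold hmul.
  assert (Hex : ex_series (fun j => M * r ^ n * (r ^ j * Rabs (u j)))).
  { apply ex_series_scal_R. now apply ex_geom_abs. }
  assert (Hle : forall j, Rabs (h (n + j)%nat * u j) <= M * r ^ n * (r ^ j * Rabs (u j))).
  { intros j. rewrite Rabs_mult.
    replace (M * r ^ n * (r ^ j * Rabs (u j))) with (M * r ^ (n + j) * Rabs (u j))
      by (rewrite pow_add; ring).
    apply Rmult_le_compat_r; [apply Rabs_pos | apply Hh]. }
  eapply Rle_trans; [apply Series_Rabs|].
  - apply ex_series_Rle with (2 := Hex). intros j. rewrite Rabs_Rabsolu. apply Hle.
  - eapply Rle_trans; [apply Series_le; [|exact Hex]|].
    + intros j. split; [apply Rabs_pos | apply Hle].
    + rewrite Series_scal_l. right; ring.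
Qed.

Lemma geom_abs_sqr_le (u : nat -> R) : sqs u ->
  Series (fun j => r ^ j * Rabs (u j)) ^ 2 <= / (1 - r ^ 2) * ip u u.
Proof.
  intros Hu.
  pose proof (ip_Cauchy_Schwarz _ _ (geom_sqs r Hr) (sqs_abs _ Hu)) as H.
  unfold ip at 1 in H. eapply Rle_trans; [exact H|]. right. f_equal.
  - rewrite ip_self, <- Series_geom by (rewrite Rabs_pos_eq; nra).
    apply Series_ext. intros n. rewrite <- !pow_mult. f_equal; lia.
  - apply Series_ext. intros n. rewrite <- Rabs_mult. apply Rabs_pos_eq. nra.
Qed.

Lemma hmul_sqs (u : nat -> R) : sqs u -> sqs (hmul h u).
Proof.
  intros Hu.
  apply ex_series_Rle with
    (fun n => (M * Series (fun j => r ^ j * Rabs (u j))) ^ 2 * (r ^ n) ^ 2).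
  - intros n. rewrite Rabs_pos_eq by apply pow2_ge_0. rewrite <- Rpow_mult_distr, <- pow2_abs.
    apply pow_incr. split; [apply Rabs_pos | now apply hmul_abs_le].
  - apply ex_series_scal_R. now apply geom_sqs.
Qed.

Lemma hmul_norm_le (u : nat -> R) : sqs u ->
  ip (hmul h u) (hmul h u) <= (M / (1 - r ^ 2)) ^ 2 * ip u u.
Proof.
  intros Hu. set (S := Series (fun j => r ^ j * Rabs (u j))).
  rewrite ip_self.
  apply Rle_trans with (Series (fun n => (M * S) ^ 2 * (r ^ n) ^ 2)).
  - apply Series_le.
    + intros n. split; [apply pow2_ge_0|]. rewrite <- Rpow_mult_distr, <- pow2_abs.
      apply pow_incr. split; [apply Rabs_pos | now apply hmul_abs_le].
    + apply ex_series_scal_R. now apply geom_sqs.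
  - rewrite Series_scal_l.
    replace (Series (fun n => (r ^ n) ^ 2)) with (/ (1 - r ^ 2)).
    + pose proof (geom_abs_sqr_le u Hu) as H. fold S in H.
      assert (0 < / (1 - r ^ 2)) by (apply Rinv_0_lt_compat; nra).
      replace ((M / (1 - r ^ 2)) ^ 2 * ip u u)
        with ((M ^ 2 * / (1 - r ^ 2)) * (/ (1 - r ^ 2) * ip u u)) by (field; nra).
      replace ((M * S) ^ 2 * / (1 - r ^ 2)) with ((M ^ 2 * / (1 - r ^ 2)) * S ^ 2) by ring.
      apply Rmult_le_compat_l; auto. apply Rmult_le_pos; [apply pow2_ge_0 | lra].
    + rewrite <- Series_geom by (rewrite Rabs_pos_eq; nra).
      apply Series_ext. intros n. rewrite <- !pow_mult. f_equal; lia.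
Qed.

Lemma ex_geom_sqr (u : nat -> R) : sqs u -> ex_series (fun j => r ^ j * u j ^ 2).
Proof.
  intros Hu. apply ex_series_Rle with (2 := Hu). intros n.
  rewrite Rabs_mult, (Rabs_pos_eq (_ ^ 2)) by apply pow2_ge_0.
  pose proof (pow2_ge_0 (u n)). rewrite Rabs_pos_eq by (apply pow_le; lra).
  assert (r ^ n <= 1); [|nra]. rewrite <- (pow1 n). apply pow_incr; lra.
Qed.

(** A diagonal majorant can be summed over an orthonormal basis one coordinate at a time.
    Cauchy-Schwarz is applied to [r ^ j = sqrt r ^ j * sqrt r ^ j], so that half of the decay stays
    with [u j]. *)
Lemma hmul_form_le (u : nat -> R) : sqs u ->
  ip (hmul h u) u <= M / (1 - r) * Series (fun j => r ^ j * u j ^ 2).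
Proof.
  intros Hu. set (S := Series (fun j => r ^ j * Rabs (u j))).
  assert (HS : S ^ 2 <= / (1 - r) * Series (fun j => r ^ j * u j ^ 2)).
  { assert (E : forall j, sqrt r ^ j * sqrt r ^ j = r ^ j).
    { intros. rewrite <- Rpow_mult_distr, sqrt_sqrt; lra. }
    assert (G1 : sqs (fun j => sqrt r ^ j)).
    { apply geom_sqs. split; [apply sqrt_pos|]. rewrite <- sqrt_1. apply sqrt_lt_1; lra. }
    assert (G2 : sqs (fun j => sqrt r ^ j * Rabs (u j))).
    { apply ex_series_Rext with (2 := ex_geom_sqr u Hu). intros j.
      rewrite Rpow_mult_distr, pow2_abs, <- (E j). ring. }
    pose proof (ip_Cauchy_Schwarz _ _ G1 G2) as H.
    replace (ip (fun j => sqrt r ^ j) (fun j => sqrt r ^ j * Rabs (u j))) with S in H.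
    2: { apply Series_ext. intros j. rewrite <- (E j). ring. }
    eapply Rle_trans; [exact H|]. right. f_equal.
    - rewrite <- Series_geom by (rewrite Rabs_pos_eq; lra). apply Series_ext, E.
    - apply Series_ext. intros j. rewrite <- (E j), <- pow2_abs. ring. }
  apply Rle_trans with (M * S ^ 2).
  2: { unfold Rdiv. rewrite Rmult_assoc. apply Rmult_le_compat_l; auto using hankel_bound_ge0. }
  apply Rle_trans with (Rabs (ip (hmul h u) u)); [apply Rle_abs|].
  unfold ip.
  assert (Hex : ex_series (fun n => M * S * (r ^ n * Rabs (u n)))).
  { apply ex_series_scal_R. now apply ex_geom_abs. }
  assert (Hle : forall n, Rabs (hmul h u n * u n) <= M * S * (r ^ n * Rabs (u n))).
  { intros n. rewrite Rabs_mult, <- Rmult_assoc.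
    apply Rmult_le_compat_r; [apply Rabs_pos | now apply hmul_abs_le]. }
  eapply Rle_trans; [apply Series_Rabs|].
  - apply ex_series_Rle with (2 := Hex). intros j. rewrite Rabs_Rabsolu. apply Hle.
  - eapply Rle_trans; [apply Series_le; [|exact Hex]|].
    + intros j. split; [apply Rabs_pos | apply Hle].
    + rewrite Series_scal_l. fold S. right; ring.
Qed.

Definition hop (u : nat -> C) : nat -> C :=
  fun n => (hmul h (fun j => Re (u j)) n, hmul h (fun j => Im (u j)) n).

Lemma hop_in_l2 (u : nat -> C) : in_l2 u -> in_l2 (hop u).
Proof.
  intros Hu. apply in_l2_iff in Hu as [? ?]. apply in_l2_iff. split; now apply hmul_sqs.
Qed.

Lemma hop_bounded : bounded_operator hop.
Proof.
  split; [apply hop_in_l2 | split].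
  - intros [a1 a2] [b1 b2] u v Hu Hv n.
    apply in_l2_iff in Hu as [U1 U2]. apply in_l2_iff in Hv as [V1 V2].
    assert (E : forall x y z w, hmul h (fun i => (x * Re (u i) + y * Im (u i)) + (z * Re (v i) + w * Im (v i))) n
      = x * hmul h (fun i => Re (u i)) n + y * hmul h (fun i => Im (u i)) n
        + (z * hmul h (fun i => Re (v i)) n + w * hmul h (fun i => Im (v i)) n)).
    { intros. rewrite <- !hmul_lin by auto.
      rewrite <- (Rmult_1_l (hmul h (fun i => x * Re (u i) + y * Im (u i)) n)).
      rewrite <- (Rmult_1_l (hmul h (fun i => z * Re (v i) + w * Im (v i)) n)).
      rewrite <- (hmul_lin _ _ 1 1) by (apply sqs_lin; auto).
      apply Series_ext; intros; ring. }
    apply injective_projections.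
    + transitivity (a1 * hmul h (fun i => Re (u i)) n + - a2 * hmul h (fun i => Im (u i)) n
        + (b1 * hmul h (fun i => Re (v i)) n + - b2 * hmul h (fun i => Im (v i)) n));
        [rewrite <- E; apply Series_ext; intros; unfold Re, Im; simpl; ring | simpl; ring].
    + transitivity (a2 * hmul h (fun i => Re (u i)) n + a1 * hmul h (fun i => Im (u i)) n
        + (b2 * hmul h (fun i => Re (v i)) n + b1 * hmul h (fun i => Im (v i)) n));
        [rewrite <- E; apply Series_ext; intros; unfold Re, Im; simpl; ring | simpl; ring].
  - exists (M / (1 - r ^ 2)). intros u Hu. unfold l2_norm.
    rewrite !Series_Cmod_sqr by auto using hop_in_l2.
    apply in_l2_iff in Hu as [U1 U2].
    assert (0 <= M / (1 - r ^ 2)) by (pose proof hankel_bound_ge0; apply Rdiv_le_0_compat; nra).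
    rewrite <- (sqrt_pow2 (M / (1 - r ^ 2))) by assumption.
    rewrite <- sqrt_mult_alt by apply pow2_ge_0.
    apply sqrt_le_1_alt.
    pose proof (hmul_norm_le _ U1). pose proof (hmul_norm_le _ U2).
    change (fun n => Re (hop u n)) with (hmul h (fun n => Re (u n))); change (fun n => Im (hop u n)) with (hmul h (fun n => Im (u n))). lra.
Qed.

Lemma hop_represents : represents (hankel h) hop.
Proof.
  split; [apply hop_bounded|]. intros m n.
  unfold hop, l2_unit, hankel. apply injective_projections; simpl.
  - rewrite <- (is_series_unique _ _ (is_series_delta (fun j => h (m + j)%nat) n)).
    apply Series_ext. intros j. destruct (Nat.eqb j n); simpl; ring.
  - transitivity (Series (fun _ : nat => 0 * 0)); [|rewrite Series_scal_l; ring].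
    apply Series_ext. intros j. destruct (Nat.eqb j n); simpl; ring.
Qed.

(** * Symmetric positive Hankel operators *)

Hypothesis Hsym : forall u v, sqs u -> sqs v -> ip (hmul h u) v = ip (hmul h v) u.
Hypothesis Hpos : forall u, sqs u -> 0 <= ip (hmul h u) u.

Lemma hop_selfadjoint (u v : nat -> C) : in_l2 u -> in_l2 v ->
  l2_inner (hop u) v = l2_inner u (hop v).
Proof.
  intros Hu Hv. rewrite !l2_inner_ip by auto using hop_in_l2.
  apply in_l2_iff in Hu as [U1 U2]. apply in_l2_iff in Hv as [V1 V2].
  change (fun n => Re (hop u n)) with (hmul h (fun n => Re (u n))); change (fun n => Im (hop u n)) with (hmul h (fun n => Im (u n))).
  change (fun n => Re (hop v n)) with (hmul h (fun n => Re (v n))); change (fun n => Im (hop v n)) with (hmul h (fun n => Im (v n))).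
  rewrite !(ip_sym _ (hmul h (fun n => _ (v n)))), !(Hsym (fun n => _ (v n))) by auto.
  reflexivity.
Qed.

Lemma hop_positive : positive_operator hop.
Proof.
  intros u Hu. rewrite l2_inner_ip by auto using hop_in_l2.
  apply in_l2_iff in Hu as [U1 U2].
  change (fun n => Re (hop u n)) with (hmul h (fun n => Re (u n))); change (fun n => Im (hop u n)) with (hmul h (fun n => Im (u n))).
  split; simpl.
  - rewrite (Hsym (fun j => Im (u j))) by auto. ring.
  - pose proof (Hpos _ U1). pose proof (Hpos _ U2). lra.
Qed.

(** A positive operator is its own modulus, so the trace sum is that of the form itself. By
    [hmul_form_le] it is enough to sum [r ^ n * Cmod (e j n) ^ 2], and summing over [j] first leaves
    a geometric series in [n]. *)
Lemma hop_trace_class : trace_class hop.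
Proof.
  split; [apply hop_bounded|]. exists hop.
  split; [split; [apply hop_bounded | split; [apply hop_positive|]]|].
  - intros u v Hu Hv. now apply hop_selfadjoint; [apply hop_in_l2|].
  - intros e (He & Ho & _).
    assert (E : forall j, Re (l2_inner (hop (e j)) (e j)) =
      ip (hmul h (fun n => Re (e j n))) (fun n => Re (e j n)) +
      ip (hmul h (fun n => Im (e j n))) (fun n => Im (e j n))).
    { intros j. rewrite l2_inner_ip by auto using hop_in_l2. reflexivity. }
    assert (HR : forall j, sqs (fun n => Re (e j n))) by (intros j; apply (proj1 (in_l2_iff _) (He j))).
    assert (HI : forall j, sqs (fun n => Im (e j n))) by (intros j; apply (proj1 (in_l2_iff _) (He j))).
    set (t := fun j n => r ^ n * (Re (e j n) ^ 2 + Im (e j n) ^ 2)).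
    assert (Et : forall j n, 1 * (r ^ n * Re (e j n) ^ 2) + 1 * (r ^ n * Im (e j n) ^ 2) = t j n)
      by (intros; unfold t; ring).
    assert (Ht : forall j, ex_series (t j)).
    { intros j. eapply ex_series_Rext; [apply Et|].
      apply ex_series_lin; now apply ex_geom_sqr. }
    assert (Hle : forall j, Re (l2_inner (hop (e j)) (e j)) <= M / (1 - r) * Series (t j)).
    { intros j. rewrite E, <- (Series_ext _ _ (Et j)), Series_lin by now apply ex_geom_sqr.
      pose proof (hmul_form_le _ (HR j)). pose proof (hmul_form_le _ (HI j)). lra. }
    assert (HM1 : 0 <= M / (1 - r)) by (pose proof hankel_bound_ge0; apply Rdiv_le_0_compat; lra).
    (* The 2 is the bound of [orthonormal_entries_bounded], and the last [/ (1 - r)] is the sum of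
       the weights [r ^ n]. *)
    apply ex_series_of_bounded with (M / (1 - r) * (2 * / (1 - r))).
    + intros j. rewrite E. pose proof (Hpos _ (HR j)). pose proof (Hpos _ (HI j)). lra.
    + intros J. apply Rle_trans with (sum_n (fun j => M / (1 - r) * Series (t j)) J).
      { clear -Hle. induction J.
        - rewrite !sum_O. apply Hle.
        - rewrite !sum_n_Sn. specialize (Hle (S J)). lra. }
      rewrite sum_n_scal.
      apply Rmult_le_compat_l; auto.
      destruct (Series_sum_n t J Ht) as [Hex Heq]. rewrite <- Heq.
      rewrite <- Series_geom by (rewrite Rabs_pos_eq; lra).
      rewrite <- Series_scal_l. apply Series_le.
      2: { apply ex_series_scal_R, ex_series_geom.
           rewrite Rabs_pos_eq; lra. }
      intros n.
      replace (sum_n (fun j => t j n) J)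
        with (r ^ n * sum_n (fun j => Re (e j n) ^ 2 + Im (e j n) ^ 2) J).
      2: { symmetry. apply sum_n_scal. }
      pose proof (orthonormal_entries_bounded e n J He Ho).
      assert (0 <= r ^ n) by (apply pow_le; lra).
      assert (0 <= sum_n (fun j => Re (e j n) ^ 2 + Im (e j n) ^ 2) J); [|nra].
      clear. induction J.
      * rewrite sum_O. nra.
      * rewrite sum_n_Sn. pose proof (pow2_ge_0 (Re (e (S J) n))). pose proof (pow2_ge_0 (Im (e (S J) n))). lra.
Qed.

(** * The spectrum from a complete sequence of eigenvectors *)

Context (m0 : nat) (nu : nat -> R) (Psi : nat -> nat -> R) (N : nat -> R).
Hypothesis Psi_sqs : forall m, (m0 <= m)%nat -> sqs (Psi m).
Hypothesis Psi_norm : forall m, (m0 <= m)%nat -> ip (Psi m) (Psi m) = N m.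
Hypothesis Psi_nonzero : forall m, (m0 <= m)%nat -> exists n, Psi m n <> 0.
Hypothesis Psi_eig : forall m n, (m0 <= m)%nat -> hmul h (Psi m) n = nu m * Psi m n.
Hypothesis Psi_complete : forall u, sqs u ->
  (forall m, (m0 <= m)%nat -> ip u (Psi m) = 0) -> forall n, u n = 0.
Hypothesis nu_decr : forall m, (m0 <= m)%nat -> nu (S m) < nu m.

Lemma nu_inj (m l : nat) : (m0 <= m)%nat -> (m0 <= l)%nat -> nu m = nu l -> m = l.
Proof.
  assert (H : forall d m, (m0 <= m)%nat -> nu (S (m + d)) < nu m).
  { induction d; intros p Hp.
    - rewrite Nat.add_0_r. auto.
    - rewrite Nat.add_succ_r. specialize (IHd p Hp). specialize (nu_decr (S (p + d)) ltac:(lia)). lra. }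
  intros Hm Hl E. destruct (Nat.lt_trichotomy m l) as [L|[L|L]]; auto.
  - specialize (H (l - m - 1)%nat m Hm). replace (S (m + (l - m - 1))) with l in H by lia. lra.
  - specialize (H (m - l - 1)%nat l Hl). replace (S (l + (m - l - 1))) with m in H by lia. lra.
Qed.

Lemma Psi_orth (m l : nat) : (m0 <= m)%nat -> (m0 <= l)%nat -> m <> l -> ip (Psi m) (Psi l) = 0.
Proof.
  intros Hm Hl D. pose proof (Hsym _ _ (Psi_sqs m Hm) (Psi_sqs l Hl)) as H.
  rewrite (ip_ext _ _ _ _ (fun n => Psi_eig m n Hm) (fun _ => eq_refl)) in H.
  rewrite (ip_ext _ _ _ _ (fun n => Psi_eig l n Hl) (fun _ => eq_refl)) in H.
  unfold ip in H.
  rewrite (Series_ext _ (fun n => nu m * (Psi m n * Psi l n))) in H by (intros; ring).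
  rewrite (Series_ext (fun n => nu l * Psi l n * Psi m n)
             (fun n => nu l * (Psi m n * Psi l n))) in H by (intros; ring).
  rewrite !Series_scal_l in H. unfold ip.
  assert (nu m - nu l <> 0) by (intros E; apply D, nu_inj; auto; lra).
  apply Rmult_eq_reg_l with (nu m - nu l); auto. lra.
Qed.

(** By symmetry, pairing the eigenvalue equation with [Psi m] gives [(nu m - lambda) <u, Psi m> = 0]
    for [lambda = x + i y]; the two equations are its real and imaginary parts. *)
Lemma eigenvector_coefficients (x y : R) (u : nat -> C) (m : nat) :
  (m0 <= m)%nat -> is_eigenvector hop (x, y) u ->
  ((nu m - x) * ip (fun n => Re (u n)) (Psi m) = - y * ip (fun n => Im (u n)) (Psi m)) /\
  ((nu m - x) * ip (fun n => Im (u n)) (Psi m) = y * ip (fun n => Re (u n)) (Psi m)).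
Proof.
  intros Hm (Hu & _ & Hev). apply in_l2_iff in Hu as [U1 U2].
  assert (A : forall v, sqs v -> ip (hmul h v) (Psi m) = nu m * ip v (Psi m)).
  { intros v Hv. rewrite Hsym by auto. unfold ip. rewrite <- Series_scal_l.
    apply Series_ext. intros n. rewrite Psi_eig by auto. ring. }
  pose proof (A _ U1) as A1. pose proof (A _ U2) as A2.
  assert (R1 : forall n, hmul h (fun n => Re (u n)) n = x * Re (u n) + - y * Im (u n)).
  { intros n. specialize (Hev n). apply (f_equal fst) in Hev. simpl in Hev.
    rewrite Hev. unfold Re, Im. ring. }
  assert (R2 : forall n, hmul h (fun n => Im (u n)) n = y * Re (u n) + x * Im (u n)).
  { intros n. specialize (Hev n). apply (f_equal snd) in Hev. simpl in Hev.
    rewrite Hev. unfold Re, Im. ring. }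
  rewrite (ip_ext _ _ _ _ R1 (fun _ => eq_refl)), ip_lin in A1 by auto.
  rewrite (ip_ext _ _ _ _ R2 (fun _ => eq_refl)), ip_lin in A2 by auto.
  lra.
Qed.

Lemma eigenvalue_cases (x y : R) (u : nat -> C) (m : nat) :
  (m0 <= m)%nat -> is_eigenvector hop (x, y) u ->
  (x = nu m /\ y = 0) \/
  (ip (fun n => Re (u n)) (Psi m) = 0 /\ ip (fun n => Im (u n)) (Psi m) = 0).
Proof.
  intros Hm He. destruct (eigenvector_coefficients x y u m Hm He) as [E1 E2].
  set (p := ip _ _) in *. set (q := ip _ _) in E1, E2 |- *.
  destruct (Req_dec (p ^ 2 + q ^ 2) 0) as [Z|Z].
  - right. split; nra.
  - left.
    assert (X1 : (nu m - x) * (p ^ 2 + q ^ 2) = 0)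
      by (replace (_ * _) with ((nu m - x) * p * p + (nu m - x) * q * q) by ring;
          rewrite E1, E2; ring).
    assert (X2 : y * (p ^ 2 + q ^ 2) = 0)
      by (replace (_ * _) with ((y * p) * p - (- y * q) * q) by ring;
          rewrite <- E1, <- E2; ring).
    apply Rmult_integral in X1. apply Rmult_integral in X2. split; lra.
Qed.

Lemma Psi_eigenvector (m : nat) : (m0 <= m)%nat ->
  is_eigenvector hop (RtoC (nu m)) (fun n => RtoC (Psi m n)).
Proof.
  intros Hm.
  assert (Z : forall n, hmul h (fun _ => 0) n = 0).
  { intros n. unfold hmul. rewrite (Series_ext _ (fun _ => 0 * 0)) by (intros; ring).
    rewrite Series_scal_l. ring. }
  assert (Z2 : sqs (fun _ : nat => 0)).
  { apply sqs_ext with (fun n => 0 * Psi m n + 0 * Psi m n); [intros; ring|].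
    apply sqs_lin; auto. }
  split; [apply in_l2_iff; split; [now apply Psi_sqs | exact Z2] | split].
  - destruct (Psi_nonzero m Hm) as [n Hn]. exists n. intros E. apply Hn.
    now apply RtoC_inj.
  - intros n. apply injective_projections; simpl.
    + rewrite Psi_eig by auto. ring.
    + rewrite Z. ring.
Qed.

Lemma hankel_has_spectral_data : has_spectral_data (hankel h) m0 nu Psi N.
Proof.
  exists hop.
  split; [apply hop_represents|]. split; [apply hop_positive|]. split; [apply hop_trace_class|].
  (* An eigenvalue different from all [nu m] would have an eigenvector orthogonal to every [Psi m],
     which is zero by completeness. *)
  assert (Hfind : forall x y u, is_eigenvector hop (x, y) u ->
            exists m, (m0 <= m)%nat /\ x = nu m /\ y = 0).
  { intros x y u Hu. apply NNPP. intros Hno.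
    destruct Hu as (Hl & [n Hn] & Hev). apply Hn.
    assert (Hz : forall m, (m0 <= m)%nat ->
       ip (fun n => Re (u n)) (Psi m) = 0 /\ ip (fun n => Im (u n)) (Psi m) = 0).
    { intros m Hm. destruct (eigenvalue_cases x y u m Hm) as [C|C]; auto.
      - split; [auto | split; [now exists n | auto]].
      - exfalso. apply Hno. exists m. tauto. }
    apply in_l2_iff in Hl as [U1 U2].
    apply injective_projections; simpl.
    - apply (Psi_complete (fun n => Re (u n))); auto. intros m Hm; now apply Hz.
    - apply (Psi_complete (fun n => Im (u n))); auto. intros m Hm; now apply Hz. }
  split; [|split; [|split]].
  - intros [x y]. split.
    + intros [u Hu]. destruct (Hfind x y u Hu) as (m & Hm & Ex & Ey).
      exists m. split; auto. now rewrite Ex, Ey.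
    + intros (m & Hm & E). rewrite E. exists (fun n => RtoC (Psi m n)). now apply Psi_eigenvector.
  - intros [x y] [w Hw]. destruct (Hfind x y w Hw) as (m & Hm & Ex & Ey). subst x y. clear w Hw.
    exists (fun n => RtoC (Psi m n)). split; [now apply Psi_eigenvector|].
    intros v Hv.
    assert (HN : N m <> 0).
    { rewrite <- Psi_norm by auto. destruct (Psi_nonzero m Hm) as [n Hn].
      pose proof (entry_sqr_le_ip (Psi m) n (Psi_sqs m Hm)).
      assert (0 < Psi m n ^ 2) by (apply pow2_gt_0; auto). lra. }
    (* A vector orthogonal to all the other [Psi l] equals its projection on [Psi m], because the
       difference is orthogonal to the whole family. *)
    assert (K : forall w, sqs w -> (forall l, (m0 <= l)%nat -> l <> m -> ip w (Psi l) = 0) ->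
       forall n, w n = ip w (Psi m) / N m * Psi m n).
    { intros w Hw Ho n.
      assert (E : 1 * w n + - (ip w (Psi m) / N m) * Psi m n = 0); [|lra].
      apply (Psi_complete (fun n => 1 * w n + - (ip w (Psi m) / N m) * Psi m n)).
      - apply sqs_lin; auto.
      - intros l Hl. rewrite ip_lin by auto. destruct (Nat.eq_dec l m) as [->|D].
        + rewrite Psi_norm by auto. field. auto.
        + rewrite Ho, Psi_orth by auto. ring. }
    assert (Hz : forall l, (m0 <= l)%nat -> l <> m ->
       ip (fun n => Re (v n)) (Psi l) = 0 /\ ip (fun n => Im (v n)) (Psi l) = 0).
    { intros l Hl D. destruct (eigenvalue_cases _ _ v l Hl Hv) as [[C _]|C]; auto.
      exfalso. apply D. symmetry. now apply nu_inj. }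
    destruct Hv as (Hvl & _ & _). apply in_l2_iff in Hvl as [V1 V2].
    exists (ip (fun n => Re (v n)) (Psi m) / N m, ip (fun n => Im (v n)) (Psi m) / N m).
    intros n. apply injective_projections; simpl.
    + rewrite Rmult_0_r, Rminus_0_r. apply (K (fun n => Re (v n))); auto. intros; now apply Hz.
    + rewrite Rmult_0_r, Rplus_0_l. apply (K (fun n => Im (v n))); auto. intros; now apply Hz.
  - exact nu_decr.
  - intros m Hm. split; [now apply Psi_eigenvector|].
    destruct (Psi_eigenvector m Hm) as (Hl & _ & _).
    unfold l2_norm. rewrite pow2_sqrt.
    + rewrite Series_Cmod_sqr by auto. simpl. rewrite <- Psi_norm by auto.
      change (fun n => Psi m n) with (Psi m).
      unfold ip at 2. rewrite Series_scal_l. ring.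
    + apply Series_nonneg; [intros; apply pow2_ge_0 | exact Hl].
Qed.
End HankelOperator.

(** * Derivatives and integrals along the elliptic integral *)

Definition Delta (k phi : R) : R := sqrt (1 - k ^ 2 * sin phi ^ 2).
Definition ellF (k phi : R) : R := RInt (fun theta => / Delta k theta) 0 phi.

Lemma continuous_of_derivable (f : R -> R) (x : R) : ex_derive f x -> continuous f x.
Proof. apply (ex_derive_continuous (K := R_AbsRing) (V := R_NormedModule)). Qed.

Lemma ball_R (x e y : R) : ball x e y <-> x - e < y < x + e.
Proof. apply Rabs_lt_between'. Qed.

Lemma is_lim_seq_scal_0 (c : R) (u : nat -> R) :
  is_lim_seq u 0 -> is_lim_seq (fun n => c * u n) 0.
Proof. intros H. rewrite <- (Rmult_0_r c). now apply (is_lim_seq_scal_l u c 0). Qed.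

Lemma cont_of_derive (f df : R -> R) : (forall x, is_derive f x (df x)) -> forall x, continuous f x.
Proof. intros H x. apply continuous_of_derivable. exists (df x). apply H. Qed.

Lemma ex_RInt_cont (f : R -> R) (a b : R) : (forall x, continuous f x) -> ex_RInt f a b.
Proof. intros H. apply (ex_RInt_continuous (V := R_CompleteNormedModule)). auto. Qed.

Lemma RInt_lin (f g : R -> R) (a b x y : R) :
  ex_RInt f a b -> ex_RInt g a b ->
  RInt (fun t => x * f t + y * g t) a b = x * RInt f a b + y * RInt g a b.
Proof.
  intros Hf Hg. apply is_RInt_unique.
  apply (is_RInt_plus (V := R_NormedModule) (fun t => x * f t) (fun t => y * g t));
    apply (is_RInt_scal (V := R_NormedModule)); now apply (RInt_correct (V := R_CompleteNormedModule)).
Qed.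

Lemma is_derive_eq (f : R -> R) (x l l' : R) : is_derive f x l -> l = l' -> is_derive f x l'.
Proof. intros H E. now rewrite <- E. Qed.

Lemma cont_ext (f g : R -> R) (x : R) :
  (forall t, f t = g t) -> continuous f x -> continuous g x.
Proof. apply continuous_ext. Qed.

Lemma cont_plus (f g : R -> R) (x : R) :
  continuous f x -> continuous g x -> continuous (fun t => f t + g t) x.
Proof. apply (continuous_plus (V := R_NormedModule)). Qed.

Lemma cont_mult (f g : R -> R) (x : R) :
  continuous f x -> continuous g x -> continuous (fun t => f t * g t) x.
Proof. apply (continuous_mult (K := R_AbsRing)). Qed.

Lemma cont_pow (f : R -> R) (n : nat) (x : R) :
  continuous f x -> continuous (fun t => f t ^ n) x.
Proof.
  intros Hf. induction n; simpl.
  - apply continuous_const.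
  - now apply cont_mult.
Qed.

Create HintDb cont.
Hint Resolve continuous_id continuous_sin continuous_cos : cont.
Ltac cont :=
  intros;
  repeat lazymatch goal with
    | |- continuous (fun _ => ?c) _ => apply continuous_const
    | |- continuous (fun t => @?f t + @?g t) _ => apply (cont_plus f g)
    | |- continuous (fun t => @?f t * @?g t) _ => apply (cont_mult f g)
    | |- continuous (fun t => @?f t / @?g t) _ => apply (cont_mult f (fun t => / g t))
    | |- continuous (fun t => @?f t ^ ?n) _ => apply (cont_pow f n)
    end;
  auto with cont.

Lemma RInt_of_derive (F f : R -> R) (a b : R) :
  (forall x, is_derive F x (f x)) -> (forall x, continuous f x) -> RInt f a b = F b - F a.
Proof.
  intros HF Cf. apply is_RInt_unique.
  apply (is_RInt_derive (V := R_CompleteNormedModule) F); auto.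
Qed.

Lemma is_derive_primitive (f : R -> R) (a x : R) :
  (forall x, continuous f x) -> is_derive (fun b => RInt f a b) x (f x).
Proof.
  intros Cf. apply (is_derive_RInt (V := R_NormedModule) f (fun b => RInt f a b) a x); auto.
  apply filter_forall. intros b.
  now apply (RInt_correct (V := R_CompleteNormedModule)), ex_RInt_cont.
Qed.

Section Modulus.
Context (k : R).
Hypothesis Hk : 0 < k < 1.

Lemma Delta_radicand_pos (x : R) : 0 < 1 - k ^ 2 <= 1 - k ^ 2 * sin x ^ 2.
Proof.
  pose proof (SIN_bound x). assert (sin x ^ 2 <= 1) by nra. assert (0 < k ^ 2 < 1) by nra. nra.
Qed.

Lemma Delta_pos (x : R) : 0 < Delta k x.
Proof. apply sqrt_lt_R0. pose proof (Delta_radicand_pos x). lra. Qed.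

Lemma Delta_neq0 (x : R) : Delta k x <> 0.
Proof. pose proof (Delta_pos x); lra. Qed.

Lemma Delta_sqr (x : R) : Delta k x ^ 2 = 1 - k ^ 2 * sin x ^ 2.
Proof. apply pow2_sqrt. pose proof (Delta_radicand_pos x). lra. Qed.

Lemma cos_sqr (x : R) : cos x ^ 2 = 1 - sin x ^ 2.
Proof. pose proof (sin2_cos2 x). unfold Rsqr in *. nra. Qed.

Lemma Delta_le1 (x : R) : Delta k x <= 1.
Proof. pose proof (Delta_sqr x). pose proof (Delta_pos x). pose proof (pow2_ge_0 (k * sin x)). nra. Qed.

Lemma Delta_ge (x : R) : sqrt (1 - k ^ 2) <= Delta k x.
Proof. apply sqrt_le_1_alt. apply Delta_radicand_pos. Qed.

Lemma Delta_0 : Delta k 0 = 1.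
Proof. unfold Delta. rewrite sin_0. replace (1 - _) with 1 by ring. apply sqrt_1. Qed.

Lemma is_derive_Delta (x : R) :
  is_derive (Delta k) x (- k ^ 2 * sin x * cos x / Delta k x).
Proof.
  unfold Delta. auto_derive.
  - pose proof (Delta_radicand_pos x). lra.
  - fold (Delta k x). pose proof (Delta_neq0 x).
    replace (sqrt _) with (Delta k x) by (unfold Delta; f_equal; ring). field. auto.
Qed.

Lemma Derive_Delta (x : R) :
  Derive (fun t : R => Delta k t) x = - k ^ 2 * sin x * cos x / Delta k x.
Proof. apply is_derive_unique, is_derive_Delta. Qed.

Lemma continuous_Delta (x : R) : continuous (Delta k) x.
Proof. exact (cont_of_derive _ _ is_derive_Delta x). Qed.

Lemma continuous_inv_Delta (x : R) : continuous (fun t => / Delta k t) x.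
Proof. apply continuous_Rinv_comp; [apply continuous_Delta | apply Delta_neq0]. Qed.

Hint Resolve continuous_Delta continuous_inv_Delta : cont.

Lemma is_derive_ellF (x : R) : is_derive (ellF k) x (/ Delta k x).
Proof. apply (is_derive_primitive (fun theta => / Delta k theta)), continuous_inv_Delta. Qed.

Lemma Derive_ellF (x : R) : Derive (fun t : R => ellF k t) x = / Delta k x.
Proof. apply is_derive_unique, is_derive_ellF. Qed.

Lemma ellF_0 : ellF k 0 = 0.
Proof. apply (RInt_point (V := R_CompleteNormedModule)). Qed.

(** [E1] is the derivative of [E] with respect to [u = ellF k x]. *)
Definition ellD (E E1 : R -> R) : Prop := forall x, is_derive E x (E1 x / Delta k x).
Definition ellD2 (E E1 E2 : R -> R) : Prop := ellD E E1 /\ ellD E1 E2.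

Lemma ellD_continuous (E E1 : R -> R) : ellD E E1 -> forall x, continuous E x.
Proof. intros H. exact (cont_of_derive _ _ H). Qed.

Lemma ellD_mult (E E1 G G1 : R -> R) : ellD E E1 -> ellD G G1 ->
  ellD (fun x => E x * G x) (fun x => E1 x * G x + E x * G1 x).
Proof.
  intros HE HG x. eapply is_derive_eq.
  - apply (is_derive_mult E G x _ _ (HE x) (HG x)). intros; apply Rmult_comm.
  - unfold plus, mult; simpl. field. apply Delta_neq0.
Qed.

Lemma ellD_plus (E E1 G G1 : R -> R) : ellD E E1 -> ellD G G1 ->
  ellD (fun x => E x + G x) (fun x => E1 x + G1 x).
Proof.
  intros HE HG x. eapply is_derive_eq.
  - apply (is_derive_plus E G x _ _ (HE x) (HG x)).
  - unfold plus; simpl. field. apply Delta_neq0.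
Qed.

Lemma ellD2_mult (E E1 E2 G G1 G2 : R -> R) : ellD2 E E1 E2 -> ellD2 G G1 G2 ->
  ellD2 (fun x => E x * G x) (fun x => E1 x * G x + E x * G1 x)
        (fun x => E2 x * G x + 2 * (E1 x * G1 x) + E x * G2 x).
Proof.
  intros [HE HE1] [HG HG1]. split; [now apply ellD_mult|].
  intros x. eapply is_derive_eq.
  - apply (ellD_plus _ _ _ _ (ellD_mult _ _ _ _ HE1 HG) (ellD_mult _ _ _ _ HE HG1)).
  - field. apply Delta_neq0.
Qed.

Lemma ellD2_ext (E E1 E2 E2' : R -> R) :
  (forall x, E2 x = E2' x) -> ellD2 E E1 E2 -> ellD2 E E1 E2'.
Proof. intros H [H1 H2]. split; auto. intros x. rewrite <- H. auto. Qed.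

Ltac ellfield x :=
  pose proof (Delta_neq0 x); pose proof (Delta_sqr x) as HDsqr; pose proof (cos_sqr x) as HCsqr;
  field [HDsqr HCsqr]; auto.

(** In Jacobi's terms, the second derivative of [sn^p]. For [p <= 1] the truncated exponent [p - 2]
    does no harm, because its coefficient [p (p - 1)] is zero. *)
Lemma ellD2_sin_pow (p : nat) :
  ellD2 (fun x => sin x ^ p)
        (fun x => INR p * sin x ^ (p - 1) * cos x * Delta k x)
        (fun x => INR p * INR (p - 1) * sin x ^ (p - 2)
                  - INR p ^ 2 * (1 + k ^ 2) * sin x ^ p
                  + INR p * INR (p + 1) * k ^ 2 * sin x ^ (p + 2)).
Proof.
  split; intros x.
  - auto_derive; auto. replace (Init.Nat.pred p) with (p - 1)%nat by lia.
    field. apply Delta_neq0.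
  - eapply is_derive_eq.
    + auto_derive; [|reflexivity]. exists (- k ^ 2 * sin x * cos x / Delta k x). apply is_derive_Delta.
    + rewrite Derive_Delta.
      destruct p as [|[|p]].
      * simpl. ellfield x.
      * simpl. ellfield x.
      * replace (S (S p) - 2)%nat with p by lia. replace (S (S p) - 1)%nat with (S p) by lia.
        replace (S (S p) + 2)%nat with (S (S (S (S p)))) by lia.
        rewrite plus_INR, !S_INR. simpl Init.Nat.pred. simpl pow. simpl INR. ellfield x.
Qed.

Lemma ellD2_Delta :
  ellD2 (Delta k) (fun x => - k ^ 2 * sin x * cos x)
        (fun x => - k ^ 2 * (1 - 2 * sin x ^ 2) * Delta k x).
Proof.
  split; intros x; [apply is_derive_Delta|].
  auto_derive; auto. ellfield x.
Qed.

Lemma ellD2_cos :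
  ellD2 cos (fun x => - sin x * Delta k x) (fun x => (2 * k ^ 2 * sin x ^ 2 - 1) * cos x).
Proof.
  split; intros x.
  - eapply is_derive_eq; [apply is_derive_cos | ellfield x].
  - eapply is_derive_eq.
    + auto_derive; [|reflexivity]. exists (- k ^ 2 * sin x * cos x / Delta k x). apply is_derive_Delta.
    + rewrite Derive_Delta. ellfield x.
Qed.

Lemma ellD2_cos_ellF (w : R) :
  ellD2 (fun x => cos (w * ellF k x)) (fun x => - w * sin (w * ellF k x))
        (fun x => - w ^ 2 * cos (w * ellF k x)).
Proof.
  split; intros x; (eapply is_derive_eq;
    [auto_derive; [exists (/ Delta k x); apply is_derive_ellF | reflexivity]
    | rewrite Derive_ellF; field; apply Delta_neq0]).
Qed.

Lemma ellD2_sin_ellF (w : R) :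
  ellD2 (fun x => sin (w * ellF k x)) (fun x => w * cos (w * ellF k x))
        (fun x => - w ^ 2 * sin (w * ellF k x)).
Proof.
  split; intros x; (eapply is_derive_eq;
    [auto_derive; [exists (/ Delta k x); apply is_derive_ellF | reflexivity]
    | rewrite Derive_ellF; field; apply Delta_neq0]).
Qed.

Lemma ellD2_Delta_pow (p : nat) :
  ellD2 (fun x => Delta k x ^ p)
        (fun x => INR p * Delta k x ^ (p - 1) * (- k ^ 2 * sin x * cos x))
        (fun x => - INR p * INR (p + 1) * Delta k x ^ (p + 2)
                  + INR p ^ 2 * (2 - k ^ 2) * Delta k x ^ p
                  - INR p * INR (p - 1) * (1 - k ^ 2) * Delta k x ^ (p - 2)).
Proof.
  assert (Hex : forall x, ex_derive (Delta k) x).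
  { intros x. exists (- k ^ 2 * sin x * cos x / Delta k x). apply is_derive_Delta. }
  split; intros x.
  - eapply is_derive_eq; [auto_derive; [apply Hex | reflexivity]|].
    rewrite Derive_Delta.
    replace (Init.Nat.pred p) with (p - 1)%nat by lia. field. apply Delta_neq0.
  - eapply is_derive_eq; [auto_derive; [apply Hex | reflexivity]|].
    rewrite Derive_Delta.
    pose proof (Delta_neq0 x). pose proof (cos_sqr x) as HC.
    assert (HS : k ^ 2 * sin x ^ 2 = 1 - Delta k x ^ 2) by (rewrite Delta_sqr; ring).
    set (d := Delta k x) in *.
    destruct p as [|[|p]].
    + simpl. field. auto.
    + simpl pow. simpl INR. simpl Init.Nat.pred. simpl pow.
      field [HS HC]. auto.
    + replace (S (S p) - 2)%nat with p by lia. replace (S (S p) - 1)%nat with (S p) by lia.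
      replace (S (S p) + 2)%nat with (S (S (S (S p)))) by lia.
      rewrite plus_INR, !S_INR. simpl Init.Nat.pred. simpl pow. simpl INR.
      field [HS HC]. auto.
Qed.

(** The integral over [[0, K]] in the variable [u = ellF k x]. *)
Definition ellInt (E : R -> R) : R := RInt (fun x => E x / Delta k x) 0 (PI / 2).

Lemma ex_ellInt (E : R -> R) (a b : R) :
  (forall x, continuous E x) -> ex_RInt (fun x => E x / Delta k x) a b.
Proof. intros H. apply ex_RInt_cont. cont. Qed.

Lemma ellInt_ext (E G : R -> R) : (forall x, E x = G x) -> ellInt E = ellInt G.
Proof. intros H. apply RInt_ext. intros x _. now rewrite H. Qed.

Lemma ellInt_lin (E G : R -> R) (a b : R) :
  (forall x, continuous E x) -> (forall x, continuous G x) ->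
  ellInt (fun x => a * E x + b * G x) = a * ellInt E + b * ellInt G.
Proof.
  intros HE HG. unfold ellInt. rewrite <- RInt_lin by now apply ex_ellInt.
  apply RInt_ext. intros x _. Rfield. apply Delta_neq0.
Qed.

Lemma ellInt_lin3 (E G H : R -> R) (a b c : R) :
  (forall x, continuous E x) -> (forall x, continuous G x) -> (forall x, continuous H x) ->
  ellInt (fun x => a * E x + b * G x + c * H x) = a * ellInt E + b * ellInt G + c * ellInt H.
Proof.
  intros HE HG HH.
  rewrite (ellInt_ext _ (fun x => 1 * (a * E x + b * G x) + c * H x)) by (intros; ring).
  rewrite (ellInt_lin (fun x => a * E x + b * G x)); auto.
  - rewrite ellInt_lin; auto; ring.
  - cont.
Qed.

(** Green's identity in [u]: [E1 f - E f1] has the derivative [E2 f + w^2 E f], since the second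
    derivative of [f] is [- w^2 f]. *)
Lemma ellInt_green (E E1 E2 f f1 : R -> R) (w : R) :
  ellD2 E E1 E2 -> ellD2 f f1 (fun x => - w ^ 2 * f x) -> (forall x, continuous E2 x) ->
  ellInt (fun x => E2 x * f x) = - w ^ 2 * ellInt (fun x => E x * f x)
    + ((E1 (PI / 2) * f (PI / 2) - E (PI / 2) * f1 (PI / 2)) - (E1 0 * f 0 - E 0 * f1 0)).
Proof.
  intros [HE HE1] [Hf Hf1] HE2.
  pose proof (ellD_continuous _ _ HE) as CE. pose proof (ellD_continuous _ _ Hf) as Cf.
  assert (H : RInt (fun x => (1 * (E2 x * f x) + w ^ 2 * (E x * f x)) / Delta k x) 0 (PI / 2)
    = (fun x => E1 x * f x - E x * f1 x) (PI / 2) - (fun x => E1 x * f x - E x * f1 x) 0).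
  { apply (RInt_of_derive (fun x => E1 x * f x - E x * f1 x)).
    - intros x. eapply is_derive_eq.
      + apply (is_derive_minus (fun x => E1 x * f x) (fun x => E x * f1 x)).
        * apply (ellD_mult _ _ _ _ HE1 Hf).
        * apply (ellD_mult _ _ _ _ HE Hf1).
      + unfold minus, plus, opp; simpl. field. apply Delta_neq0.
    - cont. }
  change (ellInt (fun x => 1 * (E2 x * f x) + w ^ 2 * (E x * f x)) =
    (E1 (PI / 2) * f (PI / 2) - E (PI / 2) * f1 (PI / 2)) - (E1 0 * f 0 - E 0 * f1 0)) in H.
  rewrite ellInt_lin in H by cont. rewrite <- H. ring.
Qed.

Lemma continuous_sin_pow_mult (p : nat) (g : R -> R) (x : R) :
  continuous g x -> continuous (fun t => sin t ^ p * g t) x.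
Proof. cont. Qed.

(** * Three-term recurrences for moments against an eigenfunction of the second derivative *)

Section Recurrences.
Context (f f1 : R -> R) (w : R).
Hypothesis Hf : ellD2 f f1 (fun x => - w ^ 2 * f x).

(** Integrating by parts twice moves the second derivative from [E] to [f], where it acts as
    [- w^2]. The last two hypotheses say that the boundary Wronskians vanish at [u = K] and at
    [u = 0]. *)
Lemma moment_rec (E E1 Em E0 Ep : R -> R) (a b c : R) :
  ellD2 E E1 (fun x => a * Em x + b * E0 x + c * Ep x) ->
  (forall x, continuous Em x) -> (forall x, continuous E0 x) -> (forall x, continuous Ep x) ->
  E1 (PI / 2) * f (PI / 2) - E (PI / 2) * f1 (PI / 2) = 0 -> E1 0 * f 0 - E 0 * f1 0 = 0 ->
  a * ellInt (fun x => Em x * f x) + b * ellInt (fun x => E0 x * f x)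
    + c * ellInt (fun x => Ep x * f x) = - w ^ 2 * ellInt (fun x => E x * f x).
Proof.
  intros HE Cm C0 Cp B1 B0. pose proof (ellD_continuous _ _ (proj1 Hf)) as Cf.
  rewrite <- ellInt_lin3 by cont.
  transitivity (ellInt (fun x => (a * Em x + b * E0 x + c * Ep x) * f x)).
  - apply ellInt_ext. intros; ring.
  - rewrite (ellInt_green E E1 (fun x => a * Em x + b * E0 x + c * Ep x) f f1 w); auto.
    + rewrite B1, B0. ring.
    + cont.
Qed.

(** The middle coefficient is, up to sign, the diagonal of the recurrence of [SC_r] for [p = 2 n]
    and of [SC_q] for [p = 2 n + 1]. *)
Lemma ellD2_sin_pow_Delta (p : nat) :
  ellD2 (fun x => sin x ^ p * Delta k x)
    (fun x => INR p * sin x ^ (p - 1) * cos x * Delta k x * Delta k x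
              + sin x ^ p * (- k ^ 2 * sin x * cos x))
    (fun x => INR p * INR (p - 1) * (sin x ^ (p - 2) * Delta k x)
              + - (INR p ^ 2 + k ^ 2 * INR (p + 1) ^ 2) * (sin x ^ p * Delta k x)
              + k ^ 2 * INR (p + 1) * INR (p + 2) * (sin x ^ (p + 2) * Delta k x)).
Proof.
  eapply ellD2_ext; [|apply (ellD2_mult _ _ _ _ _ _ (ellD2_sin_pow p) ellD2_Delta)].
  intros x. cbv beta. destruct p as [|p].
  - simpl. ring.
  - replace (S p - 1)%nat with p by lia. rewrite !pow_add, !plus_INR, !S_INR. simpl.
    pose proof (cos_sqr x) as HC. ring [HC].
Qed.

(** Here even [p] leads to [SC_p] and odd [p] to [SC_s]. *)
Lemma ellD2_sin_pow_cos (p : nat) :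
  ellD2 (fun x => sin x ^ p * cos x)
    (fun x => INR p * sin x ^ (p - 1) * cos x * Delta k x * cos x
              + sin x ^ p * (- sin x * Delta k x))
    (fun x => INR p * INR (p - 1) * (sin x ^ (p - 2) * cos x)
              + - (INR (p + 1) ^ 2 + k ^ 2 * INR p ^ 2) * (sin x ^ p * cos x)
              + k ^ 2 * INR (p + 1) * INR (p + 2) * (sin x ^ (p + 2) * cos x)).
Proof.
  eapply ellD2_ext; [|apply (ellD2_mult _ _ _ _ _ _ (ellD2_sin_pow p) ellD2_cos)].
  intros x. cbv beta. pose proof (Delta_sqr x) as HD. destruct p as [|p].
  - simpl. ring.
  - replace (S p - 1)%nat with p by lia. rewrite !pow_add, !plus_INR, !S_INR. simpl.
    ring [HD].
Qed.

(** Serves the moments [cn_moment]: the addition formula for [cn(u + i v)] expands in even powers of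
    [dn(u)], not of [sn(u)]. *)
Lemma ellD2_cos_Delta_pow (p : nat) :
  ellD2 (fun x => cos x * Delta k x ^ p)
    (fun x => - sin x * Delta k x * Delta k x ^ p
              + cos x * (INR p * Delta k x ^ (p - 1) * (- k ^ 2 * sin x * cos x)))
    (fun x => - (INR p * INR (p - 1) * (1 - k ^ 2)) * (cos x * Delta k x ^ (p - 2))
              + (INR (p + 1) ^ 2 + (1 - k ^ 2) * INR p ^ 2) * (cos x * Delta k x ^ p)
              + - (INR (p + 1) * INR (p + 2)) * (cos x * Delta k x ^ (p + 2))).
Proof.
  eapply ellD2_ext; [|apply (ellD2_mult _ _ _ _ _ _ ellD2_cos (ellD2_Delta_pow p))].
  intros x. cbv beta.
  assert (HS : k ^ 2 * sin x ^ 2 = 1 - Delta k x ^ 2) by (rewrite Delta_sqr; ring).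
  destruct p as [|p].
  - simpl. simpl in HS. ring [HS].
  - replace (S p - 1)%nat with p by lia. rewrite !pow_add, !plus_INR, !S_INR. simpl. simpl in HS.
    ring [HS].
Qed.
End Recurrences.
End Modulus.
Hint Resolve continuous_Delta continuous_inv_Delta continuous_sin_pow_mult : cont.

(** * Completeness of monomials in a monotone function *)

Lemma geom_tail (a : nat -> R) (l M r : R) (n : nat) : 0 <= r < 1 ->
  (forall n, Rabs (a n) <= M * r ^ n) -> is_series a l ->
  Rabs (l - sum_n a n) <= M * r ^ S n / (1 - r).
Proof.
  intros Hr Ha Hl.
  assert (He : ex_series a) by (exists l; auto).
  rewrite <- (is_series_unique _ _ Hl), (Series_incr_n a (S n)) by (auto; lia).
  simpl pred. rewrite sum_n_Reals.
  replace (_ + _ - _) with (Series (fun i => a (S n + i)%nat)) by ring.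
  assert (Hg : ex_series (fun i => M * r ^ S n * r ^ i)).
  { apply ex_series_scal_R, ex_series_geom.
    rewrite Rabs_pos_eq; lra. }
  assert (Hle : forall i, Rabs (a (S n + i)%nat) <= M * r ^ S n * r ^ i).
  { intros i. rewrite Rmult_assoc, <- pow_add. apply Ha. }
  eapply Rle_trans; [apply Series_Rabs|].
  - apply ex_series_Rle with (2 := Hg). intros i. rewrite Rabs_Rabsolu. apply Hle.
  - eapply Rle_trans; [apply Series_le; [|exact Hg]|].
    + intros i. split; [apply Rabs_pos | apply Hle].
    + rewrite Series_scal_l, Series_geom by (rewrite Rabs_pos_eq; lra). right; reflexivity.
Qed.

Lemma RInt_sum_n (f : nat -> R -> R) (a b : R) (n : nat) :
  (forall n x, continuous (f n) x) ->
  (forall x, continuous (fun x => sum_n (fun i => f i x) n) x) /\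
  RInt (fun x => sum_n (fun i => f i x) n) a b = sum_n (fun i => RInt (f i) a b : R) n.
Proof.
  intros Hf. induction n as [|n [IHc IH]].
  - split.
    + intros x. apply cont_ext with (f 0%nat); [intros; now rewrite sum_O|auto].
    + rewrite sum_O. apply RInt_ext. intros; now rewrite sum_O.
  - assert (E : forall x, sum_n (fun i => f i x) (S n) = 1 * sum_n (fun i => f i x) n + 1 * f (S n) x).
    { intros x. rewrite sum_n_Sn. Rring. }
    split.
    + intros x. apply cont_ext with (fun x => sum_n (fun i => f i x) n + f (S n) x).
      * intros; now rewrite sum_n_Sn.
      * now apply cont_plus.
    + rewrite sum_n_Sn, <- IH. rewrite (RInt_ext _ _ _ _ (fun x _ => E x)).
      rewrite RInt_lin; [Rring | now apply ex_RInt_cont | now apply ex_RInt_cont].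
Qed.

(** The Weierstrass M-test with a geometric majorant. The later exchanges of series and integral
    rest on it. *)
Lemma is_series_RInt (f : nat -> R -> R) (F : R -> R) (a b M r : R) :
  a <= b -> 0 <= r < 1 ->
  (forall n x, continuous (f n) x) -> (forall x, continuous F x) ->
  (forall x, a <= x <= b -> is_series (fun n => f n x) (F x)) ->
  (forall n x, a <= x <= b -> Rabs (f n x) <= M * r ^ n) ->
  is_series (fun n => RInt (f n) a b) (RInt F a b).
Proof.
  intros Hab Hr Cf CF Hs Hb.
  assert (H0 : is_lim_seq (fun n => (b - a) * (M * r ^ S n / (1 - r))) 0).
  { apply is_lim_seq_ext with (fun n => ((b - a) * M * r / (1 - r)) * r ^ n).
    - intros n. simpl. field. lra.
    - apply is_lim_seq_scal_0, is_lim_seq_geom. rewrite Rabs_pos_eq; lra. }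
  assert (Hd : forall n, Rabs (sum_n (fun i => RInt (f i) a b : R) n - RInt F a b)
                         <= (b - a) * (M * r ^ S n / (1 - r))).
  { intros n. destruct (RInt_sum_n f a b n Cf) as [Cs <-].
    replace (RInt (fun x => sum_n (fun i => f i x) n) a b - RInt F a b)
      with (RInt (fun x => 1 * sum_n (fun i => f i x) n + -1 * F x) a b)
      by (rewrite RInt_lin by (now apply ex_RInt_cont); Rring).
    apply abs_RInt_le_const; auto.
    - apply ex_RInt_cont. cont.
    - intros x Hx. rewrite <- Rabs_Ropp.
      replace (- _) with (F x - sum_n (fun i => f i x) n) by ring.
      apply geom_tail; auto. }
  change (is_lim_seq (sum_n (fun n => RInt (f n) a b : R)) (RInt F a b)).
  apply is_lim_seq_ext with (fun n => RInt F a b + (sum_n (fun n => RInt (f n) a b : R) n - RInt F a b));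
    [intros; ring|].
  replace (Finite (RInt F a b)) with (Rbar_plus (Finite (RInt F a b)) (Finite 0))
    by (simpl; f_equal; ring).
  apply (is_lim_seq_plus _ _ (RInt F a b) 0); [apply is_lim_seq_const | | reflexivity].
  apply is_lim_seq_abs_0.
  apply is_lim_seq_le_le with (fun _ => 0) (fun n => (b - a) * (M * r ^ S n / (1 - r))); auto.
  - intros n. split; [apply Rabs_pos | apply Hd].
  - apply is_lim_seq_const.
Qed.

Lemma RInt_subinterval_le (f : R -> R) (a c d b : R) :
  a <= c -> c <= d -> d <= b -> (forall x, continuous f x) ->
  (forall x, a <= x <= b -> 0 <= f x) -> RInt f c d <= RInt f a b.
Proof.
  intros H1 H2 H3 Cf Hf.
  assert (He : forall u v, ex_RInt f u v) by (intros; now apply ex_RInt_cont).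
  pose proof (RInt_Chasles (V := R_CompleteNormedModule) f a c b (He _ _) (He _ _)) as E1.
  pose proof (RInt_Chasles (V := R_CompleteNormedModule) f c d b (He _ _) (He _ _)) as E2.
  change (RInt f a c + RInt f c b = RInt f a b) in E1.
  change (RInt f c d + RInt f d b = RInt f c b) in E2.
  assert (0 <= RInt f a c) by (apply RInt_ge_0; auto; intros; apply Hf; lra).
  assert (0 <= RInt f d b) by (apply RInt_ge_0; auto; intros; apply Hf; lra).
  lra.
Qed.

Lemma continuous_bounded (f : R -> R) (a b : R) :
  a <= b -> (forall x, continuous f x) ->
  exists M, 0 <= M /\ forall x, a <= x <= b -> Rabs (f x) <= M.
Proof.
  intros Hab Cf.
  destruct (continuity_ab_maj (fun x => Rabs (f x)) a b Hab) as (m & Hm & _).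
  - intros c _. apply continuity_pt_filterlim.
    apply (continuous_comp f Rabs); [apply Cf | apply continuous_Rabs].
  - exists (Rabs (f m)). split; [apply Rabs_pos | exact Hm].
Qed.

Lemma pow_unbounded_ratio (t r S d : R) : 0 <= t < r -> 0 < d ->
  (forall N, d * r ^ N <= t ^ N * S) -> False.
Proof.
  intros [Ht Hr] Hd H.
  assert (Hq : Rabs (t / r) < 1).
  { rewrite Rabs_pos_eq by (apply Rdiv_le_0_compat; lra). apply Rlt_div_l; lra. }
  assert (Hle : Rbar_le d 0); [|simpl in Hle; lra].
  apply (is_lim_seq_le (fun _ => d) (fun N => S * (t / r) ^ N)).
  - intros N. unfold Rdiv. rewrite Rpow_mult_distr, pow_inv.
    assert (0 < r ^ N) by (apply pow_lt; lra).
    apply Rmult_le_reg_r with (r ^ N); auto.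
    replace (S * (t ^ N * / r ^ N) * r ^ N) with (t ^ N * S) by (field; lra). apply H.
  - apply is_lim_seq_const.
  - apply is_lim_seq_scal_0, is_lim_seq_geom, Hq.
Qed.

(** The powers of [T = 1 - (X - X x0) ^ 2 / 4] concentrate at [x0]: from
    [H >= eta - M' (X - X x0) ^ 2] the integrals of [T ^ N] would decay at a
    rate [1 - eta / (4 M') < 1], which is impossible because [T x0 = 1]. *)
Lemma moments_zero_not_pos (X H : R -> R) (a b x0 : R) :
  a < x0 < b ->
  (forall x, continuous X x) -> (forall x, continuous H x) ->
  (forall x, a <= x <= b -> -1 <= X x <= 1) ->
  (forall x y, a <= x -> x < y -> y <= b -> X y < X x) ->
  (forall j, RInt (fun x => H x * X x ^ j) a b = 0) -> ~ 0 < H x0.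
Proof.
  intros Hx0 CX CH HX Hdec Hmom Hpos.
  (* As [X x] and [X x0] differ by at most 2, the divisor 4 keeps [T] in [[0, 1]]. *)
  set (T := fun x => 1 - (X x - X x0) ^ 2 / 4).
  assert (CT : forall x, continuous T x).
  { intros x. apply cont_ext with (fun x => 1 + -1/4 * ((X x + - X x0) * (X x + - X x0))).
    - intros; unfold T; field.
    - cont. }
  assert (HT : forall x, a <= x <= b -> 0 <= T x).
  { intros x Hx. unfold T. pose proof (HX x Hx). pose proof (HX x0 ltac:(lra)). nra. }
  assert (Cp : forall N x, continuous (fun x => T x ^ N) x) by cont.
  assert (HTm : forall N j, RInt (fun x => H x * X x ^ j * T x ^ N) a b = 0).
  { assert (C0 : forall N j x, continuous (fun x => H x * X x ^ j * T x ^ N) x).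
    { cont. }
    induction N as [|N IH]; intros j.
    - rewrite <- (Hmom j). apply RInt_ext. intros; simpl; Rring.
    - rewrite (RInt_ext _ (fun x => 1 * ((1 - X x0 ^ 2 / 4) * (H x * X x ^ j * T x ^ N)
         + X x0 / 2 * (H x * X x ^ S j * T x ^ N)) + - (1 / 4) * (H x * X x ^ S (S j) * T x ^ N))).
      2: { intros x _. unfold T. simpl. Rfield. }
      rewrite RInt_lin.
      + rewrite RInt_lin by now apply ex_RInt_cont. rewrite !IH. Rring.
      + apply ex_RInt_cont. cont.
      + now apply ex_RInt_cont. }
  destruct (CH x0 (fun y => H x0 / 2 < y)) as [d1 Hd1].
  { exists (mkposreal _ (Rdiv_lt_0_compat _ _ Hpos Rlt_0_2)). intros y Hy.
    apply ball_R in Hy; simpl in Hy. lra. }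
  set (eta := H x0 / 2) in *.
  set (d := Rmin (d1 / 2) (Rmin (x0 - a) (b - x0))).
  assert (Hd : 0 < d /\ d < d1 /\ d <= x0 - a /\ d <= b - x0).
  { pose proof (cond_pos d1). unfold d. repeat split.
    - apply Rmin_glb_lt; [lra | apply Rmin_glb_lt; lra].
    - eapply Rle_lt_trans; [apply Rmin_l | lra].
    - eapply Rle_trans; [apply Rmin_r | apply Rmin_l].
    - eapply Rle_trans; [apply Rmin_r | apply Rmin_r]. }
  assert (Hin : forall x, x0 - d <= x <= x0 + d -> eta < H x).
  { intros x Hx. apply Hd1. apply ball_R. lra. }
  destruct (continuous_bounded H a b ltac:(lra) CH) as (M & HM0 & HM).
  set (tau := Rmin (X (x0 - d) - X x0) (X x0 - X (x0 + d))).
  assert (Htau : 0 < tau).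
  { apply Rmin_glb_lt; [pose proof (Hdec (x0 - d) x0) | pose proof (Hdec x0 (x0 + d))]; lra. }
  assert (Hout : forall x, a <= x <= b -> ~ (x0 - d <= x <= x0 + d) -> tau ^ 2 <= (X x - X x0) ^ 2).
  { intros x Hx Hn. destruct (Rlt_le_dec x x0).
    - assert (X (x0 - d) < X x) by (apply Hdec; lra).
      assert (tau <= X (x0 - d) - X x0) by apply Rmin_l. nra.
    - assert (X x < X (x0 + d)) by (apply Hdec; lra).
      assert (tau <= X x0 - X (x0 + d)) by apply Rmin_r. nra. }
  assert (He : 0 < eta) by (unfold eta; lra).
  (* Away from [x0] the inequality [M' * tau ^ 2 >= M + eta] pushes the lower bound below [- M]. The
     summand [eta] ensures [M' >= eta], which makes the rate [th] nonnegative. *)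
  set (M' := (M + eta) / tau ^ 2 + eta).
  assert (HM' : eta <= M' /\ M + eta <= M' * tau ^ 2).
  { assert (0 < tau ^ 2) by nra.
    assert (0 <= (M + eta) / tau ^ 2) by (apply Rdiv_le_0_compat; lra).
    unfold M'. split; [lra|].
    replace (((M + eta) / tau ^ 2 + eta) * tau ^ 2) with (M + eta + eta * tau ^ 2) by (field; lra). nra. }
  assert (Hlow : forall x, a <= x <= b -> eta - M' * (X x - X x0) ^ 2 <= H x).
  { intros x Hx. destruct (classic (x0 - d <= x <= x0 + d)) as [Hi|Ho].
    - pose proof (Hin x Hi). pose proof (pow2_ge_0 (X x - X x0)). nra.
    - pose proof (Hout x Hx Ho). pose proof (HM x Hx) as HMx. apply Rabs_le_between in HMx. nra. }
  set (S := fun N => RInt (fun x => T x ^ N) a b : R).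
  assert (HS : forall N, 4 * M' * S (Datatypes.S N) <= (4 * M' - eta) * S N).
  { intros N.
    assert (H1 : RInt (fun x => (eta - 4 * M') * T x ^ N + 4 * M' * T x ^ Datatypes.S N) a b
                 <= RInt (fun x => H x * X x ^ 0 * T x ^ N) a b).
    { apply RInt_le; [lra | | |].
      - apply ex_RInt_cont. cont.
      - apply ex_RInt_cont. cont.
      - intros x Hx. pose proof (Hlow x ltac:(lra)) as L.
        assert (0 <= T x ^ N) by (apply pow_le, HT; lra).
        replace ((eta - 4 * M') * T x ^ N + 4 * M' * T x ^ Datatypes.S N)
          with ((eta - M' * (X x - X x0) ^ 2) * T x ^ N) by (unfold T; simpl; field).
        replace (H x * X x ^ 0 * T x ^ N) with (H x * T x ^ N) by (simpl; ring).
        now apply Rmult_le_compat_r. }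
    rewrite HTm, RInt_lin in H1 by (apply ex_RInt_cont; cont).
    change (RInt (fun t => T t ^ N) a b) with (S N) in H1.
    change (RInt (fun t => T t ^ Datatypes.S N) a b) with (S (Datatypes.S N)) in H1. lra. }
  set (th := 1 - eta / (4 * M')).
  assert (Hth : 0 <= th < 1).
  { unfold th. assert (0 < eta / (4 * M')) by (apply Rdiv_lt_0_compat; lra).
    assert (eta / (4 * M') <= 1) by (apply Rle_div_l; lra). lra. }
  assert (HSN : forall N, S N <= th ^ N * S 0%nat).
  { induction N; [simpl; lra|].
    assert (E : S (Datatypes.S N) <= th * S N).
    { apply Rmult_le_reg_l with (4 * M'); [lra|]. eapply Rle_trans; [apply HS|]. right.
      unfold th. field. lra. }
    simpl. rewrite Rmult_assoc. eapply Rle_trans; [exact E|]. apply Rmult_le_compat_l; lra. }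
  (* A number strictly between the decay rate [th] and [T x0 = 1]: near [x0] the integrand stays
     above [rho ^ N], which contradicts decay like [th ^ N]. *)
  set (rho := (1 + th) / 2).
  destruct (CT x0 (fun y => rho < y)) as [d2 Hd2].
  { assert (Hp : 0 < 1 - rho) by (unfold rho; lra). exists (mkposreal _ Hp). intros y Hy.
    apply ball_R in Hy; simpl in Hy. assert (T x0 = 1) by (unfold T; field). lra. }
  set (d' := Rmin (d2 / 2) d).
  assert (Hd' : 0 < d' /\ d' < d2 /\ d' <= d).
  { pose proof (cond_pos d2). unfold d'. repeat split.
    - apply Rmin_glb_lt; lra.
    - eapply Rle_lt_trans; [apply Rmin_l | lra].
    - apply Rmin_r. }
  apply (pow_unbounded_ratio th rho (S 0%nat) (2 * d')); [unfold rho; lra | lra |].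
  intros N. eapply Rle_trans; [|apply HSN].
  apply Rle_trans with (RInt (fun x => T x ^ N) (x0 - d') (x0 + d')).
  - apply Rle_trans with (RInt (fun _ => rho ^ N) (x0 - d') (x0 + d')).
    + rewrite (RInt_const (V := R_CompleteNormedModule)). unfold scal; simpl; unfold mult; simpl. right; ring.
    + apply RInt_le; [lra | apply ex_RInt_const | now apply ex_RInt_cont |].
      intros x Hx. apply pow_incr. split; [unfold rho; lra|].
      left. apply Hd2. apply ball_R. lra.
  - apply RInt_subinterval_le; try lra; auto. intros x Hx. apply pow_le, HT; lra.
Qed.

Lemma moments_zero (X H : R -> R) (a b x : R) :
  a < x < b ->
  (forall x, continuous X x) -> (forall x, continuous H x) ->
  (forall x, a <= x <= b -> -1 <= X x <= 1) ->
  (forall x y, a <= x -> x < y -> y <= b -> X y < X x) ->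
  (forall j, RInt (fun x => H x * X x ^ j) a b = 0) -> H x = 0.
Proof.
  intros Hx CX CH HX Hdec Hmom.
  pose proof (moments_zero_not_pos X H a b x Hx CX CH HX Hdec Hmom).
  assert (~ 0 < 0 * H x + -1 * H x); [|lra].
  apply (moments_zero_not_pos X (fun x => 0 * H x + -1 * H x) a b x); auto.
  - cont.
  - intros j.
    assert (C : forall y, continuous (fun y => H y * X y ^ j) y)
      by cont.
    rewrite (RInt_ext _ (fun y => 0 * (H y * X y ^ j) + -1 * (H y * X y ^ j))) by (intros; Rring).
    rewrite RInt_lin, Hmom by now apply ex_RInt_cont. Rring.
Qed.

(** * Gram matrices of power-type bases *)

Lemma CV_radius_geom (a : nat -> R) (B r x : R) : 0 < r < 1 ->
  (forall n, Rabs (a n) <= B * r ^ n) -> Rabs x <= 1 -> Rbar_lt (Rabs x) (CV_radius a).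
Proof.
  intros Hr Ha Hx.
  apply Rbar_lt_le_trans with (/ r).
  - simpl. apply Rle_lt_trans with 1; auto. rewrite <- Rinv_1. apply Rinv_lt_contravar; lra.
  - apply CV_radius_bounded. exists B. intros n.
    rewrite Rabs_mult, pow_inv, (Rabs_pos_eq (/ _)).
    + assert (0 < r ^ n) by (apply pow_lt; lra).
      apply Rmult_le_reg_r with (r ^ n); auto. rewrite Rmult_assoc, Rinv_l by lra.
      rewrite Rmult_1_r. apply Ha.
    + left. apply Rinv_0_lt_compat, pow_lt; lra.
Qed.

Lemma is_series_PSeries (a : nat -> R) (B r x : R) : 0 < r < 1 ->
  (forall n, Rabs (a n) <= B * r ^ n) -> Rabs x <= 1 ->
  is_series (fun n => a n * x ^ n) (PSeries a x).
Proof.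
  intros Hr Ha Hx. apply Series_correct.
  apply ex_series_Rext with (fun n => x ^ n * a n); [intros; ring|].
  eapply ex_series_ext; [|exact (CV_radius_inside a x (CV_radius_geom a B r x Hr Ha Hx))].
  intros n. unfold scal; simpl; unfold mult; simpl. now rewrite pow_n_pow.
Qed.

Lemma continuous_PSeries (a : nat -> R) (x : R) :
  Rbar_lt (Rabs x) (CV_radius a) -> continuous (PSeries a) x.
Proof.
  intros H. apply continuous_of_derivable.
  now apply ex_derive_PSeries.
Qed.

Lemma at_right_in (a b : R) : a < b -> at_right a (fun x => a < x < b).
Proof.
  intros Hab. assert (Hp : 0 < b - a) by lra. exists (mkposreal _ Hp). intros y Hy Hy'.
  apply ball_R in Hy; simpl in Hy. lra.
Qed.

Lemma filterlim_at_right_unique (f g : R -> R) (a b l l' : R) : a < b ->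
  (forall x, a < x < b -> f x = g x) ->
  filterlim f (at_right a) (locally l) -> filterlim g (at_right a) (locally l') -> l = l'.
Proof.
  intros Hab E Hf Hg.
  assert (Hf' : filterlim g (at_right a) (locally l)).
  { apply filterlim_ext_loc with f; auto.
    apply filter_imp with (2 := at_right_in a b Hab). exact E. }
  exact (filterlim_locally_unique g l l' Hf' Hg).
Qed.

Lemma continuous_at_right (f : R -> R) (x : R) :
  continuous f x -> filterlim f (at_right x) (locally (f x)).
Proof. intros H. apply filterlim_filter_le_1 with (2 := H). apply filter_le_within. Qed.

(** Zeros are given only to the right of 0, since the argument will be [sin x ^ 2]. Continuity from
    the right at 0 gives the constant coefficient, and division by [y] passes to the next one. *)
Lemma PSeries_zero_right (r : R) (a : nat -> R) (B : R) : 0 < r < 1 ->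
  (forall n, Rabs (a n) <= B * r ^ n) ->
  (forall y, 0 < y < 1 -> PSeries a y = 0) -> forall n, a n = 0.
Proof.
  intros Hr Ha Hz n. revert a B Ha Hz. induction n as [|n IH]; intros a B Ha Hz.
  - symmetry.
    apply (filterlim_at_right_unique (fun _ => 0) (PSeries a) 0 1 0 (a 0%nat)); [lra | | |].
    + intros x Hx. symmetry. auto.
    + apply filterlim_const.
    + rewrite <- (PSeries_0 a). apply continuous_at_right, continuous_PSeries.
      apply (CV_radius_geom a B r); auto. rewrite Rabs_R0; lra.
  - apply (IH (PS_decr_1 a) (B * r)).
    + intros i. unfold PS_decr_1. eapply Rle_trans; [apply Ha|]. right; simpl; ring.
    + intros y Hy.
      assert (He : ex_pseries a y).
      { apply CV_radius_inside, (CV_radius_geom a B r); auto. apply Rabs_le; lra. }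
      pose proof (PSeries_decr_1 a y He) as E. rewrite Hz in E by auto.
      assert (a 0%nat = 0).
      { symmetry.
        apply (filterlim_at_right_unique (fun _ => 0) (PSeries a) 0 1 0 (a 0%nat)); [lra | | |].
        + intros x Hx. symmetry. auto.
        + apply filterlim_const.
        + rewrite <- (PSeries_0 a). apply continuous_at_right, continuous_PSeries.
          apply (CV_radius_geom a B r); auto. rewrite Rabs_R0; lra. }
      apply Rmult_eq_reg_l with y; lra.
Qed.

(** Kills the Casoratian in [coef_orth], where the off-diagonal weights grow like [n ^ 2] and the
    products of two coefficients decay like [k ^ (2 n)]. With [r = t ^ 2], Bernoulli's inequality
    for [/ t] keeps [n * t ^ n] bounded. *)
Lemma is_lim_seq_square_geom (r : R) : 0 < r < 1 ->
  is_lim_seq (fun n => (INR n + 1) ^ 2 * (r ^ n * r ^ n)) 0.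
Proof.
  intros Hr. set (t := sqrt r).
  assert (Ht : 0 < t < 1).
  { split; [apply sqrt_lt_R0; lra|]. unfold t. rewrite <- sqrt_1. apply sqrt_lt_1; lra. }
  assert (Er : forall n, r ^ n = t ^ n * t ^ n).
  { intros n. rewrite <- Rpow_mult_distr. unfold t. rewrite sqrt_sqrt; lra. }
  set (x := / t - 1).
  assert (Hx : 0 < x).
  { unfold x. assert (1 < / t); [rewrite <- Rinv_1; apply Rinv_lt_contravar; lra | lra]. }
  assert (Hb : forall n, INR n * t ^ n <= / x).
  { intros n. pose proof (poly n x Hx) as P.
    replace (1 + x) with (/ t) in P by (unfold x; ring). rewrite pow_inv in P.
    assert (0 < t ^ n) by (apply pow_lt; lra).
    apply Rmult_le_reg_r with x; auto. rewrite Rinv_l by lra.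
    apply Rmult_le_reg_r with (/ t ^ n); [now apply Rinv_0_lt_compat|].
    replace (INR n * t ^ n * x * / t ^ n) with (INR n * x) by (field; lra). lra. }
  apply is_lim_seq_le_le with (fun _ => 0) (fun n => (/ x + 1) ^ 2 * r ^ n).
  - intros n. assert (0 < t ^ n <= 1).
    { split; [apply pow_lt; lra|]. rewrite <- (pow1 n). apply pow_incr; lra. }
    pose proof (pos_INR n). specialize (Hb n). split.
    + apply Rmult_le_pos; [apply pow2_ge_0|]. apply Rmult_le_pos; apply pow_le; lra.
    + rewrite Er.
      replace ((INR n + 1) ^ 2 * (t ^ n * t ^ n * (t ^ n * t ^ n)))
        with ((INR n * t ^ n + t ^ n) ^ 2 * (t ^ n * t ^ n)) by ring.
      apply Rmult_le_compat_r; [nra|]. apply pow_incr. split; [nra|lra].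
  - apply is_lim_seq_const.
  - apply is_lim_seq_scal_0, is_lim_seq_geom. rewrite Rabs_pos_eq; lra.
Qed.

Lemma ellInt_scal (k : R) (c : R) (E : R -> R) : 0 < k < 1 -> (forall x, continuous E x) ->
  ellInt k (fun x => c * E x) = c * ellInt k E.
Proof.
  intros Hk HE. rewrite (ellInt_ext k _ (fun x => c * E x + 0 * E x)) by (intros; ring).
  rewrite ellInt_lin by auto. ring.
Qed.

Lemma ellInt_abs_le (k : R) (E : R -> R) (M : R) : 0 < k < 1 ->
  (forall x, continuous E x) -> (forall x, Rabs (E x) <= M) ->
  Rabs (ellInt k E) <= PI / 2 / sqrt (1 - k ^ 2) * M.
Proof.
  intros Hk CE HE. pose proof PI_RGT_0.
  replace (PI / 2 / sqrt (1 - k ^ 2) * M) with ((PI / 2 - 0) * (M * / sqrt (1 - k ^ 2)))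
    by (unfold Rdiv; ring).
  apply abs_RInt_le_const; [lra | now apply ex_ellInt |].
  intros x _. unfold Rdiv. rewrite Rabs_mult. pose proof (Delta_pos k Hk x).
  apply Rmult_le_compat; auto using Rabs_pos.
  rewrite Rabs_pos_eq by (left; now apply Rinv_0_lt_compat).
  apply Rinv_le_contravar; [apply sqrt_lt_R0; nra | now apply Delta_ge].
Qed.

Section Family.
Context (k : R).
Hypothesis Hk : 0 < k < 1.
Context (g : R -> R).
Hypothesis Cg : forall x, continuous g x.
Hypothesis Hg1 : forall x, Rabs (g x) <= 1.
Hypothesis Hg0 : forall x, 0 < x < PI / 2 -> g x <> 0.

(** The factor [k ^ n] balances the coefficients [p (p - 1)] and [k ^ 2 (p + 1) (p + 2)] of the
    second derivative, so that its tridiagonal matrix becomes symmetric. It also supplies the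
    geometric decay on which convergence, trace class and orthogonality rely. *)
Definition basis (n : nat) (x : R) : R := k ^ n * sin x ^ (2 * n) * g x.

Lemma continuous_basis (n : nat) (x : R) : continuous (basis n) x.
Proof. unfold basis. cont. Qed.
Hint Resolve continuous_basis : cont.

Lemma sin_sqr_le1 (x : R) : Rabs (sin x ^ 2) <= 1.
Proof. apply Rabs_le. pose proof (SIN_bound x). nra. Qed.

Lemma basis_abs_le (n : nat) (x : R) : Rabs (basis n x) <= k ^ n.
Proof.
  unfold basis. rewrite !Rabs_mult, pow_mult, (Rabs_pos_eq (k ^ n)) by (apply pow_le; lra).
  rewrite <- RPow_abs.
  assert (0 <= Rabs (sin x ^ 2) ^ n <= 1).
  { split; [apply pow_le, Rabs_pos|]. rewrite <- (pow1 n). apply pow_incr.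
    split; [apply Rabs_pos | apply sin_sqr_le1]. }
  assert (0 < k ^ n) by (apply pow_lt; lra). pose proof (Rabs_pos (g x)). specialize (Hg1 x).
  assert (Rabs (sin x ^ 2) ^ n * Rabs (g x) <= 1) by nra. nra.
Qed.

(** The sum of [u n * basis n]. For bounded [u] the coefficients [u n * k ^ n] give a radius of
    convergence above 1, hence continuity also where [sin x ^ 2 = 1]. *)
Definition bseries (u : nat -> R) (x : R) : R := PSeries (fun n => u n * k ^ n) (sin x ^ 2) * g x.

Section Expand.
Context (u : nat -> R) (B : R).
Hypothesis Hu : forall n, Rabs (u n) <= B.

Lemma bseries_coef_le (n : nat) : Rabs (u n * k ^ n) <= B * k ^ n.
Proof.
  rewrite Rabs_mult, (Rabs_pos_eq (k ^ n)) by (apply pow_le; lra).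
  apply Rmult_le_compat_r; [apply pow_le; lra | apply Hu].
Qed.

Lemma is_series_bseries (x : R) : is_series (fun n => u n * basis n x) (bseries u x).
Proof.
  eapply is_series_ext; [|exact (is_series_scal_r (g x) _ _
    (is_series_PSeries _ B k (sin x ^ 2) Hk bseries_coef_le (sin_sqr_le1 x)))].
  intros n. unfold basis. rewrite pow_mult. simpl. Rring.
Qed.

Lemma continuous_bseries_coef (x : R) :
  continuous (fun t => PSeries (fun n => u n * k ^ n) (sin t ^ 2)) x.
Proof.
  apply (continuous_comp (fun t => sin t ^ 2) (PSeries (fun n => u n * k ^ n))).
  - apply cont_pow, continuous_sin.
  - apply continuous_PSeries, (CV_radius_geom _ B k); auto using bseries_coef_le, sin_sqr_le1.
Qed.

Lemma continuous_bseries (x : R) : continuous (bseries u) x.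
Proof. apply cont_mult; auto. apply continuous_bseries_coef. Qed.

Lemma is_series_ellInt (G : R -> R) : (forall x, continuous G x) ->
  is_series (fun n => u n * ellInt k (fun x => basis n x * G x))
            (ellInt k (fun x => bseries u x * G x)).
Proof.
  intros CG. pose proof PI_RGT_0.
  destruct (continuous_bounded G 0 (PI / 2) ltac:(lra) CG) as (MG & HMG0 & HMG).
  set (s := / sqrt (1 - k ^ 2)).
  assert (Hs : 0 < s) by (apply Rinv_0_lt_compat, sqrt_lt_R0; nra).
  eapply is_series_ext;
    [|apply (is_series_RInt (fun n x => (u n * (basis n x * G x)) / Delta k x)
        (fun x => bseries u x * G x / Delta k x) 0 (PI / 2) (B * MG * s) k); try lra].
  - intros n. cbv beta. rewrite <- ellInt_scal; auto.
    cont.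
  - cont.
  - pose proof continuous_bseries. cont.
  - intros x _.
    replace (bseries u x * G x / Delta k x) with (bseries u x * (G x / Delta k x))
      by (field; now apply Delta_neq0).
    eapply is_series_ext; [|exact (is_series_scal_r (G x / Delta k x) _ _ (is_series_bseries x))].
    intros n. Rfield. now apply Delta_neq0.
  - intros n x Hx. unfold Rdiv. rewrite !Rabs_mult.
    pose proof (Hu n). pose proof (basis_abs_le n x). pose proof (HMG x Hx).
    pose proof (Rabs_pos (u n)). pose proof (Rabs_pos (basis n x)). pose proof (Rabs_pos (G x)).
    assert (0 < k ^ n) by (apply pow_lt; lra).
    assert (Hd : 0 < / Delta k x <= s).
    { split; [now apply Rinv_0_lt_compat, Delta_pos|].
      apply Rinv_le_contravar; [apply sqrt_lt_R0; nra | now apply Delta_ge]. }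
    rewrite (Rabs_pos_eq (/ _)) by lra.
    replace (B * MG * s * k ^ n) with (B * (k ^ n * MG) * s) by ring.
    repeat apply Rmult_le_compat; auto; try lra; repeat apply Rmult_le_pos; auto; lra.
Qed.
End Expand.

Lemma sqs_bounded (u : nat -> R) : sqs u -> exists B, forall n, Rabs (u n) <= B.
Proof.
  intros Hu. exists (ip u u + 1). intros n. pose proof (entry_sqr_le_ip u n Hu) as H.
  apply Rabs_le. split; nra.
Qed.

(** * The Hankel form as a Gram form *)

Context (C0 : R) (h : nat -> R).
Hypothesis HC0 : 0 < C0.
Hypothesis Hh : forall n, h n = C0 * ellInt k (fun x => k ^ n * sin x ^ (2 * n) * (g x * g x)).

Lemma hankel_entry (m n : nat) : h (m + n)%nat = C0 * ellInt k (fun x => basis n x * basis m x).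
Proof.
  rewrite Hh. f_equal. apply ellInt_ext. intros x. unfold basis.
  replace (2 * (m + n))%nat with (2 * m + 2 * n)%nat by lia. rewrite !pow_add. ring.
Qed.

Lemma hankel_geom_bound : exists M, forall n, Rabs (h n) <= M * k ^ n.
Proof.
  exists (C0 * (PI / 2 / sqrt (1 - k ^ 2))). intros n.
  replace n with (n + 0)%nat at 1 by lia. rewrite hankel_entry.
  rewrite Rabs_mult, (Rabs_pos_eq C0), Rmult_assoc by lra.
  apply Rmult_le_compat_l; [lra|]. apply ellInt_abs_le; auto; [cont|].
  intros x. rewrite Rabs_mult. pose proof (basis_abs_le n x). pose proof (basis_abs_le 0 x) as H0.
  simpl in H0. pose proof (Rabs_pos (basis n x)). pose proof (Rabs_pos (basis 0 x)). nra.
Qed.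

Lemma hmul_ellInt (u : nat -> R) (B : R) (n : nat) : (forall n, Rabs (u n) <= B) ->
  hmul h u n = C0 * ellInt k (fun x => basis n x * bseries u x).
Proof.
  intros Hu. unfold hmul.
  pose proof (is_series_ellInt u B Hu (basis n) (continuous_basis n)) as H.
  apply is_series_unique in H.
  rewrite (ellInt_ext k (fun x => basis n x * bseries u x) (fun x => bseries u x * basis n x))
    by (intros; ring).
  rewrite <- H, <- Series_scal_l. apply Series_ext. intros j. rewrite hankel_entry.
  ring.
Qed.

(** Symmetry and positivity of the Hankel operator are read off from this inner product in
    [L^2 (0, K)]. *)
Lemma form_ellInt (u v : nat -> R) : sqs u -> sqs v ->
  ip (hmul h u) v = C0 * ellInt k (fun x => bseries u x * bseries v x).
Proof.
  intros Hu Hv. destruct (sqs_bounded u Hu) as [Bu HBu]. destruct (sqs_bounded v Hv) as [Bv HBv].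
  pose proof (is_series_ellInt v Bv HBv (bseries u) (continuous_bseries u Bu HBu)) as H.
  apply is_series_unique in H.
  rewrite (ellInt_ext k (fun x => bseries u x * bseries v x) (fun x => bseries v x * bseries u x))
    by (intros; ring).
  rewrite <- H, <- Series_scal_l. apply Series_ext. intros n. rewrite (hmul_ellInt u Bu) by auto.
  ring.
Qed.

Lemma form_sym (u v : nat -> R) : sqs u -> sqs v -> ip (hmul h u) v = ip (hmul h v) u.
Proof.
  intros Hu Hv. rewrite !form_ellInt by auto. f_equal. apply ellInt_ext. intros; ring.
Qed.

Lemma form_ge0 (u : nat -> R) : sqs u -> 0 <= ip (hmul h u) u.
Proof.
  intros Hu. rewrite form_ellInt by auto. destruct (sqs_bounded u Hu) as [B HB].
  apply Rmult_le_pos; [lra|]. pose proof PI_RGT_0. apply RInt_ge_0; [lra | |].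
  - apply ex_ellInt; auto. pose proof (continuous_bseries u B HB). cont.
  - intros x _. pose proof (Delta_pos k Hk x). apply Rdiv_le_0_compat; nra.
Qed.

(** * Trigonometric eigenfunctions and their completeness *)

Context (m0 : nat) (w : nat -> R) (f f1 : nat -> R -> R).
Hypothesis Hf : forall m, ellD2 k (f m) (f1 m) (fun x => - w m ^ 2 * f m x).
Hypothesis Hb0 : forall l m, f1 l 0 * f m 0 - f l 0 * f1 m 0 = 0.
Hypothesis Hb1 : forall l m, f1 l (PI / 2) * f m (PI / 2) - f l (PI / 2) * f1 m (PI / 2) = 0.
Hypothesis Hw : forall l m, (m0 <= l)%nat -> (m0 <= m)%nat -> l <> m -> w l ^ 2 <> w m ^ 2.
Hypothesis Hcos : forall m, (m0 <= m)%nat -> exists m' eps, (m0 <= m')%nat /\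
  forall x, 2 * cos (PI / ellF k (PI / 2) * ellF k x) * f m x = f (S m) x + eps * f m' x.
Hypothesis Hfm0 : forall x, 0 < x < PI / 2 -> f m0 x <> 0.

Lemma continuous_f (m : nat) (x : R) : continuous (f m) x.
Proof. exact (ellD_continuous _ _ _ (proj1 (Hf m)) x). Qed.
Hint Resolve continuous_f : cont.

Lemma f_orth (l m : nat) : (m0 <= l)%nat -> (m0 <= m)%nat -> l <> m ->
  ellInt k (fun x => f l x * f m x) = 0.
Proof.
  intros Hl Hm D. pose proof (Hw l m Hl Hm D) as W.
  assert (C2 : forall x, continuous (fun x => - w l ^ 2 * f l x) x)
    by cont.
  pose proof (ellInt_green k Hk _ _ _ _ _ (w m) (Hf l) (Hf m) C2) as G.
  rewrite Hb0, Hb1 in G.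
  rewrite (ellInt_ext k _ (fun x => - w l ^ 2 * (f l x * f m x))) in G by (intros; ring).
  rewrite ellInt_scal in G by (auto; cont).
  apply Rmult_eq_reg_l with (w l ^ 2 - w m ^ 2); lra.
Qed.

Lemma ellF_increasing (x y : R) : x < y -> ellF k x < ellF k y.
Proof.
  intros Hxy. apply (incr_function (ellF k) m_infty p_infty (fun x => / Delta k x)); simpl; auto.
  - intros t _ _. now apply is_derive_ellF.
  - intros t _ _. now apply Rinv_0_lt_compat, Delta_pos.
Qed.

(** By the product formula [Hcos], multiplication by [X = cos (PI u / K)] keeps the span of the
    [f m]. So all moments of [H * f m0 / Delta] against powers of [X] vanish, and [moments_zero]
    applies because [X] decreases strictly on the interval. Inside, [f m0] has no zero. *)
Lemma f_complete (H : R -> R) : (forall x, continuous H x) ->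
  (forall m, (m0 <= m)%nat -> ellInt k (fun x => H x * f m x) = 0) ->
  forall x, 0 < x < PI / 2 -> H x = 0.
Proof.
  intros CH Hz x Hx. pose proof PI_RGT_0.
  set (X := fun x => cos (PI / ellF k (PI / 2) * ellF k x)).
  assert (CX : forall x, continuous X x) by exact (ellD_continuous _ _ _ (proj1 (ellD2_cos_ellF k Hk _))).
  assert (CXj : forall j m x, continuous (fun x => H x * X x ^ j * f m x) x).
  { cont. }
  assert (Hj : forall j m, (m0 <= m)%nat -> ellInt k (fun x => H x * X x ^ j * f m x) = 0).
  { induction j as [|j IH]; intros m Hm.
    - rewrite <- (Hz m Hm). apply ellInt_ext. intros; simpl; ring.
    - destruct (Hcos m Hm) as (m' & eps & Hm' & E).
      rewrite (ellInt_ext k _ (fun x => / 2 * (H x * X x ^ j * f (S m) x)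
                                        + eps / 2 * (H x * X x ^ j * f m' x))).
      + rewrite ellInt_lin by auto. rewrite !IH by lia. ring.
      + intros t. specialize (E t). fold (X t) in E. simpl.
        replace (H t * (X t * X t ^ j) * f m t) with (H t * X t ^ j * (2 * X t * f m t) / 2) by field.
        rewrite E. field. }
  assert (HK : 0 < ellF k (PI / 2)) by (rewrite <- (ellF_0 k); apply ellF_increasing; lra).
  assert (Hrange : forall y, 0 <= y <= PI / 2 -> 0 <= PI / ellF k (PI / 2) * ellF k y <= PI).
  { intros y Hy.
    assert (0 <= ellF k y).
    { rewrite <- (ellF_0 k). destruct (Req_dec 0 y) as [<-|]; [lra|left; apply ellF_increasing; lra]. }
    assert (ellF k y <= ellF k (PI / 2)).
    { destruct (Req_dec y (PI / 2)) as [->|]; [lra|left; apply ellF_increasing; lra]. }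
    split; [apply Rmult_le_pos; auto; apply Rdiv_le_0_compat; lra|].
    replace (PI / ellF k (PI / 2) * ellF k y) with (PI * (ellF k y / ellF k (PI / 2))) by (field; lra).
    apply Rle_trans with (PI * 1); [|lra]. apply Rmult_le_compat_l; [lra|]. apply Rle_div_l; lra. }
  assert (Z : H x * f m0 x / Delta k x = 0).
  { apply (moments_zero X (fun x => H x * f m0 x / Delta k x) 0 (PI / 2) x); auto.
    - cont.
    - intros; unfold X. apply COS_bound.
    - intros a b Ha Hab Hb. unfold X. pose proof (Hrange a ltac:(lra)). pose proof (Hrange b ltac:(lra)).
      apply cos_decreasing_1; try lra. apply Rmult_lt_compat_l.
      + apply Rdiv_lt_0_compat; lra.
      + now apply ellF_increasing.
    - intros j. transitivity (ellInt k (fun x => H x * X x ^ j * f m0 x)); [|apply Hj; lia].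
      apply RInt_ext. intros t _. Rfield. now apply Delta_neq0. }
  pose proof (Hfm0 x Hx). pose proof (Delta_neq0 k Hk x).
  apply Rmult_integral in Z as [Z|Z].
  - apply Rmult_integral in Z as [Z|Z]; [auto | tauto].
  - exfalso. revert Z. now apply Rinv_neq_0_compat.
Qed.

(** * The coefficients of an eigenfunction and their orthogonality *)

Definition coef (m n : nat) : R := ellInt k (fun x => basis n x * f m x).

Hypothesis Hf_abs : forall m x, Rabs (f m x) <= 1.
Context (al A : nat -> R).
Hypothesis Hal0 : al 0%nat = 0.
Hypothesis Hal : forall n, 0 < al (S n) <= 9 * (INR n + 1) ^ 2.
Hypothesis Hrec : forall m n, (m0 <= m)%nat ->
  al n * coef m (n - 1) - A n * coef m n + al (S n) * coef m (S n) = - w m ^ 2 * coef m n.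

Lemma coef_abs_le : exists M, 0 <= M /\ forall m n, Rabs (coef m n) <= M * k ^ n.
Proof.
  pose proof PI_RGT_0. assert (0 < sqrt (1 - k ^ 2)) by (apply sqrt_lt_R0; nra).
  exists (PI / 2 / sqrt (1 - k ^ 2)). split; [apply Rdiv_le_0_compat; lra|]. intros m n.
  apply ellInt_abs_le; auto; [cont|]. intros x. rewrite Rabs_mult.
  pose proof (basis_abs_le n x). pose proof (Hf_abs m x).
  pose proof (Rabs_pos (basis n x)). pose proof (Rabs_pos (f m x)). nra.
Qed.

Lemma coef_sqs (m : nat) : sqs (coef m).
Proof.
  destruct coef_abs_le as (M & HM & H).
  apply ex_series_Rle with (fun n => M ^ 2 * (k ^ n) ^ 2).
  - intros n. rewrite Rabs_pos_eq by apply pow2_ge_0. rewrite <- Rpow_mult_distr, <- pow2_abs.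
    apply pow_incr. split; [apply Rabs_pos | auto].
  - apply ex_series_scal_R. apply geom_sqs; lra.
Qed.

Lemma coef_bounded : exists B, forall m n, Rabs (coef m n) <= B.
Proof.
  destruct coef_abs_le as (M & HM & H). exists M. intros m n. eapply Rle_trans; [apply H|].
  rewrite <- (Rmult_1_r M) at 2. apply Rmult_le_compat_l; auto.
  rewrite <- (pow1 n). apply pow_incr; lra.
Qed.

(** Christoffel-Darboux: the partial sums of [sum_n coef l n * coef m n]
    are multiples of a Casoratian that tends to 0. *)
Lemma coef_orth (l m : nat) : (m0 <= l)%nat -> (m0 <= m)%nat -> l <> m -> ip (coef l) (coef m) = 0.
Proof.
  intros Hl Hm D. pose proof (Hw l m Hl Hm D) as W.
  set (T := fun n => al (S n) * (coef m (S n) * coef l n - coef m n * coef l (S n))).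
  assert (HT : forall n, (w l ^ 2 - w m ^ 2) * sum_n (fun i => coef l i * coef m i) n = T n).
  { assert (Step : forall n, (w l ^ 2 - w m ^ 2) * (coef l n * coef m n)
              = T n - al n * (coef m n * coef l (n - 1)%nat - coef m (n - 1)%nat * coef l n)).
    { intros n. unfold T. pose proof (Hrec l n Hl). pose proof (Hrec m n Hm).
      replace ((w l ^ 2 - w m ^ 2) * (coef l n * coef m n))
        with ((- w m ^ 2 * coef m n) * coef l n - (- w l ^ 2 * coef l n) * coef m n) by ring.
      rewrite <- H, <- H0. ring. }
    induction n as [|n IH].
    - rewrite sum_O, Step, Hal0. ring.
    - rewrite sum_n_Sn, Rmult_plus_distr_l, IH, Step.
      replace (S n - 1)%nat with n by lia. unfold T. ring. }
  destruct coef_abs_le as (M & HM & HB).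
  assert (LT : is_lim_seq T 0).
  { apply is_lim_seq_abs_0.
    apply is_lim_seq_le_le with (fun _ => 0)
      (* 18 is the 9 of [Hal] times the two products in the Casoratian. *)
      (fun n => (18 * M ^ 2) * ((INR n + 1) ^ 2 * (k ^ n * k ^ n))).
    - intros n. split; [apply Rabs_pos|]. unfold T. rewrite Rabs_mult.
      pose proof (Hal n). rewrite (Rabs_pos_eq (al _)) by lra.
      assert (P : forall i j, Rabs (coef i (S n) * coef j n) <= M * k ^ n * (M * k ^ n)).
      { intros i j. rewrite Rabs_mult.
        apply Rmult_le_compat; auto using Rabs_pos. eapply Rle_trans; [apply HB|].
        simpl. apply Rmult_le_compat_l; auto.
        assert (0 < k ^ n) by (apply pow_lt; lra). nra. }
      assert (Q : Rabs (coef m (S n) * coef l n - coef m n * coef l (S n)) <= 2 * (M * k ^ n * (M * k ^ n))).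
      { unfold Rminus. eapply Rle_trans; [apply Rabs_triang|]. rewrite Rabs_Ropp.
        pose proof (P m l). pose proof (P l m). rewrite (Rmult_comm (coef m n)). lra. }
      replace (18 * M ^ 2 * ((INR n + 1) ^ 2 * (k ^ n * k ^ n)))
        with (9 * (INR n + 1) ^ 2 * (2 * (M * k ^ n * (M * k ^ n)))) by ring.
      apply Rmult_le_compat; auto using Rabs_pos; lra.
    - apply is_lim_seq_const.
    - now apply is_lim_seq_scal_0, is_lim_seq_square_geom. }
  pose proof (Series_correct _ (sqs_mult _ _ (coef_sqs l) (coef_sqs m))) as HS.
  change (is_lim_seq (sum_n (fun n => coef l n * coef m n)) (ip (coef l) (coef m))) in HS.
  apply (is_lim_seq_scal_l _ (w l ^ 2 - w m ^ 2)) in HS. simpl in HS.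
  apply (is_lim_seq_ext _ T) in HS; [|exact HT].
  pose proof (is_lim_seq_unique _ _ HS) as U1. rewrite (is_lim_seq_unique _ _ LT) in U1.
  apply (f_equal real) in U1. simpl in U1.
  apply Rmult_eq_reg_l with (w l ^ 2 - w m ^ 2); lra.
Qed.

Lemma bseries_coef_inner (u : nat -> R) (B : R) (m : nat) : (forall n, Rabs (u n) <= B) ->
  ellInt k (fun x => bseries u x * f m x) = ip u (coef m).
Proof.
  intros Hu. symmetry. apply is_series_unique.
  exact (is_series_ellInt u B Hu (f m) (continuous_f m)).
Qed.

Context (L : nat -> R).
Hypothesis HL : forall m, (m0 <= m)%nat ->
  filterlim (fun x => f m x / g x) (at_right 0) (locally (L m)).
Hypothesis HL0 : forall m, (m0 <= m)%nat -> L m <> 0.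
Hypothesis Hc0 : forall m, (m0 <= m)%nat -> coef m 0 <> 0.
Hypothesis Hnf : forall m, (m0 <= m)%nat -> ellInt k (fun x => f m x * f m x) <> 0.

(** By [coef_orth] and [f_orth], the left-hand side pairs with every [f l] as a multiple of [f m]
    does, so it is one by [f_complete]. The factor [c] first appears as a quotient of squared norms
    and is then evaluated at [x = 0]. *)
Lemma bseries_coef (m : nat) (x : R) : (m0 <= m)%nat -> 0 < x < PI / 2 ->
  bseries (coef m) x = coef m 0 / L m * f m x.
Proof.
  intros Hm. revert x. destruct coef_bounded as [B HB]. pose proof PI_RGT_0.
  set (c := ip (coef m) (coef m) / ellInt k (fun x => f m x * f m x)).
  assert (E : forall x, 0 < x < PI / 2 -> bseries (coef m) x = c * f m x).
  { intros x Hx. assert (1 * bseries (coef m) x + - c * f m x = 0); [|lra].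
    apply (f_complete (fun x => 1 * bseries (coef m) x + - c * f m x)); auto.
    - pose proof (continuous_bseries _ B (HB m)). cont.
    - intros l Hl.
      rewrite (ellInt_ext k _ (fun x => 1 * (bseries (coef m) x * f l x) + - c * (f m x * f l x)))
        by (intros; ring).
      rewrite ellInt_lin; auto.
      + rewrite (bseries_coef_inner _ B) by auto. destruct (Nat.eq_dec m l) as [<-|D].
        * unfold c. field. auto.
        * rewrite coef_orth, f_orth by auto. ring.
      + pose proof (continuous_bseries _ B (HB m)). cont.
      + cont. }
  (* Divided by [g], the series reduces at [x = 0] to its term [n = 0], while [f m / g] tends to
     [L m]. *)
  assert (Ec : coef m 0 = c * L m).
  { apply (filterlim_at_right_unique (fun x => PSeries (fun n => coef m n * k ^ n) (sin x ^ 2))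
      (fun x => c * (f m x / g x)) 0 (PI / 2)); [lra | | |].
    - intros x Hx. pose proof (Hg0 x Hx). specialize (E x Hx). unfold bseries in E.
      apply Rmult_eq_reg_r with (g x); auto. rewrite E. field. auto.
    - pose proof (continuous_at_right _ _ (continuous_bseries_coef (coef m) B (HB m) 0)) as C.
      cbv beta in C. rewrite sin_0 in C. replace (0 ^ 2) with 0 in C by ring.
      rewrite PSeries_0 in C. simpl in C. rewrite Rmult_1_r in C. exact C.
    - apply (filterlim_comp _ _ _ (fun x => f m x / g x) (fun y => c * y) _ (locally (L m))); auto.
      apply (continuous_scal_r (K := R_AbsRing) (V := R_NormedModule) c (fun y => y)), continuous_id. }
  intros x Hx. rewrite E by auto. rewrite Ec. field. auto.
Qed.

(** * Eigenvalues, eigenvectors and norms *)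

Context (nu : nat -> R) (Psi : nat -> nat -> R) (N : nat -> R).
Hypothesis Hnu : forall m, (m0 <= m)%nat -> nu m = C0 * (coef m 0 / L m).
Hypothesis Hdecr : forall m, (m0 <= m)%nat -> nu (S m) < nu m.
Hypothesis HPsi0 : forall m, (m0 <= m)%nat -> Psi m 0%nat = 1.
Hypothesis HPsi : forall m n, (m0 <= m)%nat ->
  al (S n) * Psi m (S n) = (A n - w m ^ 2) * Psi m n - al n * Psi m (n - 1)%nat.
Hypothesis HN : forall m, (m0 <= m)%nat ->
  N m = ellInt k (fun x => f m x * f m x) / (L m * coef m 0).

(** Both sides solve the same recurrence and agree at [n = 0]. As [al 0 = 0] and [al (S n) > 0],
    this single value determines the solution. *)
Lemma coef_Psi (m n : nat) : (m0 <= m)%nat -> coef m n = coef m 0 * Psi m n.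
Proof.
  intros Hm. enough (H : coef m n = coef m 0 * Psi m n /\ coef m (S n) = coef m 0 * Psi m (S n)) by tauto.
  induction n as [|n [IH1 IH2]].
  - rewrite HPsi0 by auto. split; [ring|].
    pose proof (Hrec m 0%nat Hm) as R0. pose proof (HPsi m 0%nat Hm) as P0.
    rewrite Hal0 in R0, P0. rewrite HPsi0 in P0 by auto. pose proof (Hal 0) as [Ha _].
    apply Rmult_eq_reg_l with (al 1%nat); [|lra].
    transitivity (coef m 0 * (al 1%nat * Psi m 1%nat)); [rewrite P0; lra | ring].
  - split; auto.
    pose proof (Hrec m (S n) Hm) as R0. pose proof (HPsi m (S n) Hm) as P0.
    replace (S n - 1)%nat with n in R0, P0 by lia. pose proof (Hal (S n)) as [Ha _].
    apply Rmult_eq_reg_l with (al (S (S n))); [|lra].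
    transitivity (coef m 0 * (al (S (S n)) * Psi m (S (S n)))); [|ring].
    rewrite P0. rewrite IH1, IH2 in R0. lra.
Qed.

Lemma family_spectral_data : has_spectral_data (hankel h) m0 nu Psi N.
Proof.
  destruct hankel_geom_bound as [M HM]. destruct coef_bounded as [B HB].
  assert (EP : forall m n, (m0 <= m)%nat -> Psi m n = / coef m 0 * coef m n).
  { intros m n Hm. rewrite (coef_Psi m n Hm). field. auto. }
  assert (SP : forall m, (m0 <= m)%nat -> sqs (Psi m)).
  { intros m Hm. apply sqs_ext with (fun n => / coef m 0 * coef m n + 0 * coef m n).
    - intros n. rewrite EP by auto. ring.
    - apply sqs_lin; apply coef_sqs. }
  assert (Ein : forall u m, (m0 <= m)%nat -> ip u (Psi m) = / coef m 0 * ip u (coef m)).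
  { intros u m Hm. unfold ip. rewrite <- Series_scal_l. apply Series_ext. intros n.
    rewrite EP by auto. ring. }
  apply (hankel_has_spectral_data h M k ltac:(lra) HM form_sym form_ge0); auto.
  (* [ip (coef m) (coef m)] is the integral of [bseries (coef m) * f m], that is [coef m 0 / L m]
     times the squared norm of [f m]. Division by [coef m 0 ^ 2] gives [N m]. *)
  - intros m Hm. rewrite Ein, ip_sym, Ein, HN by auto.
    rewrite <- (bseries_coef_inner _ B) by auto.
    transitivity (/ coef m 0 * (/ coef m 0 * (coef m 0 / L m * ellInt k (fun x => f m x * f m x)))).
    + do 2 f_equal. rewrite <- ellInt_scal by (auto; cont).
      apply RInt_ext. intros x Hx. pose proof PI_RGT_0.
      rewrite Rmin_left, Rmax_right in Hx by lra. rewrite bseries_coef by auto. Rfield.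
      split; auto; now apply Delta_neq0.
    + field. auto.
  - intros m Hm. exists 0%nat. rewrite HPsi0 by auto. lra.
  (* [hmul h (coef m)] pairs [basis n] with [bseries (coef m)], a multiple of [f m], and so returns
     that multiple of [coef m n]. *)
  - intros m n Hm. transitivity (/ coef m 0 * hmul h (coef m) n).
    { unfold hmul. rewrite <- Series_scal_l. apply Series_ext. intros j. rewrite EP by auto. ring. }
    rewrite (hmul_ellInt _ B) by auto. rewrite EP, Hnu by auto.
    transitivity (/ coef m 0 * (C0 * (coef m 0 / L m * coef m n))); [|ring].
    do 2 f_equal. unfold coef at 3.
    rewrite <- ellInt_scal by (auto; cont).
    apply RInt_ext. intros x Hx. pose proof PI_RGT_0.
    rewrite Rmin_left, Rmax_right in Hx by lra. rewrite bseries_coef by auto. Rfield.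
    split; auto; now apply Delta_neq0.
  (* Completeness of the [f m] makes [bseries u] vanish inside the interval. Its power series then
     vanishes at every [y = sin x ^ 2] in [(0, 1)], so all its coefficients are zero. *)
  - intros u Hu Hz. destruct (sqs_bounded u Hu) as [Bu HBu].
    assert (Hy : forall x, 0 < x < PI / 2 -> bseries u x = 0).
    { apply f_complete.
      - now apply (continuous_bseries u Bu).
      - intros m Hm. rewrite (bseries_coef_inner u Bu) by auto. specialize (Hz m Hm).
        rewrite Ein in Hz by auto. apply Rmult_integral in Hz as [Hz|Hz]; auto.
        exfalso. revert Hz. apply Rinv_neq_0_compat. auto. }
    intros n.
    assert (Hn : u n * k ^ n = 0).
    { apply (PSeries_zero_right k (fun n => u n * k ^ n) Bu); auto.
      - intros i. now apply bseries_coef_le.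
      - intros y Hyy.
        assert (Hsq : 0 < sqrt y < 1).
        { split; [apply sqrt_lt_R0; lra|]. rewrite <- sqrt_1. apply sqrt_lt_1; lra. }
        assert (Hx : 0 < asin (sqrt y) < PI / 2).
        { pose proof (asin_bound_lt (sqrt y) ltac:(lra)) as Hb. split; [|tauto].
          destruct (Rlt_le_dec 0 (asin (sqrt y))) as [|Hle]; auto. exfalso.
          pose proof (sin_asin (sqrt y) ltac:(lra)) as Es.
          assert (0 <= sin (- asin (sqrt y))) by (apply sin_ge_0; pose proof PI_RGT_0; lra).
          rewrite sin_neg in *. lra. }
        specialize (Hy _ Hx). unfold bseries in Hy. rewrite sin_asin in Hy by lra.
        rewrite pow2_sqrt in Hy by lra. apply Rmult_integral in Hy as [Hy|Hy]; auto.
        exfalso. revert Hy. now apply Hg0. }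
    apply Rmult_integral in Hn as [Hn|Hn]; auto.
    exfalso. revert Hn. apply pow_nonzero. lra.
Qed.
End Family.

(** * Fourier coefficients of dn and cn *)

Lemma CV_radius_bounded_coef (b : nat -> R) (B x : R) :
  (forall n, Rabs (b n) <= B) -> Rabs x < 1 -> Rbar_lt (Rabs x) (CV_radius b).
Proof.
  intros Hb Hx. apply Rbar_lt_le_trans with 1; [exact Hx|].
  apply CV_radius_bounded. exists B. intros n. now rewrite pow1, Rmult_1_r.
Qed.

(** The two conditions on [b] are the coefficients of [x ^ 0] and of [x ^ (n + 1)] in the equation.
    The free parameters allow one statement for the moments of [dn] and of [cn]. *)
Lemma PSeries_ode (k2 b1 b2 c0 c1 : R) (b : nat -> R) (B x : R) :
  (forall n, Rabs (b n) <= B) -> Rabs x < 1 ->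
  2 * b 1%nat + c0 * b 0%nat = 0 ->
  (forall n, (2 * INR n + 4) * (2 * INR n + 3) * b (S (S n))
     + (- 4 * (1 + k2) * (INR n + 1) * INR n + b1 * (INR n + 1) + c0) * b (S n)
     + (4 * k2 * INR n * (INR n - 1) + b2 * INR n + c1) * b n = 0) ->
  4 * x * (1 - x) * (1 - k2 * x) * PSeries (PS_derive (PS_derive b)) x
  + (2 + b1 * x + b2 * x ^ 2) * PSeries (PS_derive b) x + (c0 + c1 * x) * PSeries b x = 0.
Proof.
  intros Hb Hx H0 Hn.
  assert (R0 : Rbar_lt (Rabs x) (CV_radius b)) by now apply (CV_radius_bounded_coef b B).
  assert (R1 : Rbar_lt (Rabs x) (CV_radius (PS_derive b))) by now rewrite CV_radius_derive.
  assert (R2 : Rbar_lt (Rabs x) (CV_radius (PS_derive (PS_derive b)))) by now rewrite !CV_radius_derive.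
  assert (Q0 : is_pseries b x (PSeries b x)) by now apply PSeries_correct, CV_radius_inside.
  assert (Q1 : is_pseries (PS_derive b) x (PSeries (PS_derive b) x))
    by now apply PSeries_correct, CV_radius_inside.
  assert (Q2 : is_pseries (PS_derive (PS_derive b)) x (PSeries (PS_derive (PS_derive b)) x))
    by now apply PSeries_correct, CV_radius_inside.
  set (p0 := PSeries b x) in *. set (p1 := PSeries (PS_derive b) x) in *.
  set (p2 := PSeries (PS_derive (PS_derive b)) x) in *.
  assert (I : forall (a : nat -> R) (l : R), is_pseries a x l -> is_pseries (PS_incr_1 a) x (x * l)).
  { intros a l Ha. exact (is_pseries_incr_1 a x l Ha). }
  assert (P : forall (a a' : nat -> R) (l l' c : R), is_pseries a x l -> is_pseries a' x l' ->
     is_pseries (fun n => a n + c * a' n) x (l + c * l')).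
  { intros a a' l l' c Ha Ha'.
    apply (is_pseries_plus (K := R_AbsRing) (V := R_NormedModule) a (fun n => c * a' n)); auto.
    apply (is_pseries_scal (K := R_AbsRing) (V := R_NormedModule) c a'); auto.
    apply Rmult_comm. }
  pose proof (I _ _ Q2) as X2. pose proof (I _ _ X2) as XX2. pose proof (I _ _ XX2) as XXX2.
  pose proof (I _ _ Q1) as X1. pose proof (I _ _ X1) as XX1. pose proof (I _ _ Q0) as X0.
  (* The term [4 x P''] is entered as [X2 + 3 X2], because [P] adds a multiple to a series already
     at hand. *)
  pose proof (P _ _ _ _ 3 X2 X2) as S1. pose proof (P _ _ _ _ (- 4 * (1 + k2)) S1 XX2) as S2.
  pose proof (P _ _ _ _ (4 * k2) S2 XXX2) as S3. pose proof (P _ _ _ _ 2 S3 Q1) as S4.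
  pose proof (P _ _ _ _ b1 S4 X1) as S5. pose proof (P _ _ _ _ b2 S5 XX1) as S6.
  pose proof (P _ _ _ _ c0 S6 Q0) as S7. pose proof (P _ _ _ _ c1 S7 X0) as S8.
  clear S1 S2 S3 S4 S5 S6 S7 P I.
  apply is_pseries_unique in S8.
  transitivity (PSeries (fun _ => 0) x); [|apply PSeries_const_0].
  transitivity (PSeries (fun n : nat => PS_incr_1 (PS_derive (PS_derive b)) n + 3 * PS_incr_1 (PS_derive (PS_derive b)) n +
          - 4 * (1 + k2) * PS_incr_1 (PS_incr_1 (PS_derive (PS_derive b))) n +
          4 * k2 * PS_incr_1 (PS_incr_1 (PS_incr_1 (PS_derive (PS_derive b)))) n +
          2 * PS_derive b n + b1 * PS_incr_1 (PS_derive b) n +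
          b2 * PS_incr_1 (PS_incr_1 (PS_derive b)) n + c0 * b n + c1 * PS_incr_1 b n) x).
  - rewrite S8. ring.
  - apply PSeries_ext. intros n. cbv beta.
    destruct n as [|[|[|n]]]; unfold PS_incr_1, PS_derive; cbv beta iota;
      change (zero : R) with 0.
    + simpl INR. lra.
    + specialize (Hn 0%nat). simpl INR in *. lra.
    + specialize (Hn 1%nat). simpl INR in *. lra.
    + specialize (Hn (S (S n))). rewrite !S_INR in *. lra.
Qed.

Lemma is_derive_cosh (x : R) : is_derive cosh x (sinh x).
Proof. apply is_derive_Reals, derivable_pt_lim_cosh. Qed.

Lemma is_derive_sinh (x : R) : is_derive sinh x (cosh x).
Proof. apply is_derive_Reals, derivable_pt_lim_sinh. Qed.

Lemma cosh_gt0 (x : R) : 0 < cosh x.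
Proof. unfold cosh. pose proof (exp_pos x). pose proof (exp_pos (- x)). lra. Qed.

Lemma const_of_derive_0 (f : R -> R) (a b : R) :
  (forall t, a <= t <= b -> is_derive f t 0) -> a <= b -> f b = f a.
Proof.
  intros H Hab. destruct (Req_dec a b) as [<-|]; auto. symmetry.
  apply (eq_is_derive (V := R_NormedModule) f a b); auto. lra.
Qed.

Lemma ellD2_cosh_ellF (k w : R) : 0 < k < 1 ->
  ellD2 k (fun x => cosh (w * ellF k x)) (fun x => w * sinh (w * ellF k x))
          (fun x => w ^ 2 * cosh (w * ellF k x)).
Proof.
  intros Hk.
  assert (A : forall x, is_derive (fun x => w * ellF k x) x (w / Delta k x)).
  { intros x. apply (is_derive_scal (ellF k) x w). now apply is_derive_ellF. }
  split; intros x.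
  - eapply is_derive_eq; [apply (is_derive_comp cosh (fun x => w * ellF k x)); [apply is_derive_cosh | apply A]|].
    unfold scal; simpl; unfold mult; simpl. field. now apply Delta_neq0.
  - eapply is_derive_eq.
    + apply (is_derive_scal (fun x => sinh (w * ellF k x)) x w).
      apply (is_derive_comp sinh (fun x => w * ellF k x)); [apply is_derive_sinh | apply A].
    + unfold scal; simpl; unfold mult; simpl. field. now apply Delta_neq0.
Qed.

(** The Wronskian of [G] with [cosh (w v)] is constant and vanishes at 0, so their quotient has
    derivative 0; [cosh] has no zero to obstruct the division. *)
Lemma ode_cosh (k w : R) (G G1 : R -> R) (psi : R) : 0 < k < 1 -> 0 <= psi ->
  (forall t, 0 <= t <= psi -> is_derive G t (G1 t / Delta k t)) ->
  (forall t, 0 <= t <= psi -> is_derive G1 t (w ^ 2 * G t / Delta k t)) ->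
  G1 0 = 0 -> G psi = G 0 * cosh (w * ellF k psi).
Proof.
  intros Hk Hpsi HG HG1 H0.
  destruct (ellD2_cosh_ellF k w Hk) as [HC HS].
  set (C := fun x => cosh (w * ellF k x)) in *.
  set (D := fun x => w * sinh (w * ellF k x)) in *.
  assert (Ci : C 0 = 1) by (unfold C; rewrite ellF_0, Rmult_0_r; apply cosh_0).
  assert (Di : D 0 = 0) by (unfold D; rewrite ellF_0, Rmult_0_r, sinh_0; ring).
  assert (CN : forall t, C t <> 0) by (intros t; unfold C; pose proof (cosh_gt0 (w * ellF k t)); lra).
  assert (U : forall t, 0 <= t <= psi -> G1 t * C t - G t * D t = 0).
  { intros t Ht. transitivity (G1 0 * C 0 - G 0 * D 0); [|rewrite H0, Di; ring].
    apply (const_of_derive_0 (fun t => G1 t * C t - G t * D t) 0 t); [|lra].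
    intros s Hs. eapply is_derive_eq.
    - apply (is_derive_minus (fun t => G1 t * C t) (fun t => G t * D t)).
      + apply (is_derive_mult G1 C s); [apply HG1; lra | apply HC | intros; apply Rmult_comm].
      + apply (is_derive_mult G D s); [apply HG; lra | apply HS | intros; apply Rmult_comm].
    - unfold minus, plus, opp, mult; simpl. fold (C s). field. now apply Delta_neq0. }
  assert (E : G psi / C psi = G 0 / C 0).
  { apply (const_of_derive_0 (fun t => G t / C t) 0 psi); auto.
    intros s Hs. eapply is_derive_eq.
    - apply is_derive_div; [apply HG; lra | apply HC | apply CN].
    - specialize (U s Hs). pose proof (Delta_neq0 k Hk s). pose proof (CN s).
      replace (_ / _) with ((G1 s * C s - G s * D s) / (Delta k s * C s ^ 2)) by (field; auto).
      rewrite U. field. auto. }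
  rewrite Ci in E. change (G psi = G 0 * C psi).
  replace (G psi) with (G psi / C psi * C psi) by (field; auto). rewrite E. field.
Qed.

(** [PSeries_ode] for [x = sin psi ^ 2], conjugated by [g], is
    [d^2 G / d v^2 = w ^ 2 G] in [v = ellF k psi]. *)
Lemma PSeries_ode_cosh (k w b1 b2 c0 c1 B psi : R) (b : nat -> R) (g g1 g2 : R -> R) :
  0 < k < 1 -> 0 <= psi < PI / 2 ->
  (forall n, Rabs (b n) <= B) ->
  2 * b 1%nat + c0 * b 0%nat = 0 ->
  (forall n, (2 * INR n + 4) * (2 * INR n + 3) * b (S (S n))
     + (- 4 * (1 + k ^ 2) * (INR n + 1) * INR n + b1 * (INR n + 1) + c0) * b (S n)
     + (4 * k ^ 2 * INR n * (INR n - 1) + b2 * INR n + c1) * b n = 0) ->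
  ellD2 k g g1 g2 -> g 0 = 1 -> g1 0 = 0 ->
  (forall x, g2 x = g x * (c0 + w ^ 2 + c1 * sin x ^ 2)) ->
  (forall x, 4 * g1 x * cos x * Delta k x
     = g x * sin x * (b1 + 4 * (1 + k ^ 2) + (b2 - 6 * k ^ 2) * sin x ^ 2)) ->
  g psi * PSeries b (sin psi ^ 2) = b 0%nat * cosh (w * ellF k psi).
Proof.
  intros Hk Hpsi Hb H0 Hn [Hg Hg1] Eg Eg1 Hgg Hg2.
  set (P0 := PSeries b). set (P1 := PSeries (PS_derive b)). set (P2 := PSeries (PS_derive (PS_derive b))).
  assert (Hs : forall t, 0 <= t <= psi -> Rabs (sin t ^ 2) < 1).
  { intros t Ht. rewrite Rabs_pos_eq by apply pow2_ge_0.
    assert (0 < cos t) by (apply cos_gt_0; lra). pose proof (cos_sqr t). nra. }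
  assert (D0 : forall t, 0 <= t <= psi ->
     is_derive (fun t => P0 (sin t ^ 2)) t (2 * sin t * cos t * P1 (sin t ^ 2))).
  { intros t Ht. eapply is_derive_eq.
    - apply (is_derive_comp P0 (fun t => sin t ^ 2)).
      + apply is_derive_PSeries, (CV_radius_bounded_coef b B); auto.
      + auto_derive; [auto|reflexivity].
    - unfold scal; simpl; unfold mult; simpl. unfold P1. ring. }
  assert (D1 : forall t, 0 <= t <= psi ->
     is_derive (fun t => P1 (sin t ^ 2)) t (2 * sin t * cos t * P2 (sin t ^ 2))).
  { intros t Ht. eapply is_derive_eq.
    - apply (is_derive_comp P1 (fun t => sin t ^ 2)).
      + apply is_derive_PSeries. rewrite CV_radius_derive. apply (CV_radius_bounded_coef b B); auto.
      + auto_derive; [auto|reflexivity].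
    - unfold scal; simpl; unfold mult; simpl. unfold P2. ring. }
  (* The derivative [2 sn cn dn] of [sin t ^ 2] with respect to [v = ellF k t]. *)
  set (sc := fun t => 2 * sin t * cos t * Delta k t).
  assert (Dsc : forall t, is_derive sc t
     ((2 * (1 - 2 * sin t ^ 2) * Delta k t ^ 2 - 2 * k ^ 2 * sin t ^ 2 * (1 - sin t ^ 2)) / Delta k t)).
  { intros t. unfold sc. eapply is_derive_eq.
    - auto_derive; [|reflexivity].
      exists (- k ^ 2 * sin t * cos t / Delta k t). now apply is_derive_Delta.
    - rewrite Derive_Delta by auto. pose proof (Delta_neq0 k Hk t). pose proof (cos_sqr t) as HC.
      field [HC]. auto. }
  pose proof (ode_cosh k w (fun t => g t * P0 (sin t ^ 2))
    (fun t => g1 t * P0 (sin t ^ 2) + g t * (sc t * P1 (sin t ^ 2))) psi Hk (proj1 Hpsi)) as E.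
  cbv beta in E. rewrite sin_0, Eg in E. replace (0 ^ 2) with 0 in E by ring.
  replace (P0 0) with (b 0%nat) in E by (symmetry; apply PSeries_0).
  rewrite (Rmult_1_l (b 0%nat)) in E. apply E; clear E.
  - intros t Ht. eapply is_derive_eq.
    + apply (is_derive_mult g (fun t => P0 (sin t ^ 2))); [apply Hg | now apply D0 | intros; apply Rmult_comm].
    + unfold plus, mult, sc; simpl. field. now apply Delta_neq0.
  - intros t Ht. eapply is_derive_eq.
    + apply (is_derive_plus (fun t => g1 t * P0 (sin t ^ 2)) (fun t => g t * (sc t * P1 (sin t ^ 2)))).
      * apply (is_derive_mult g1 (fun t => P0 (sin t ^ 2))); [apply Hg1 | now apply D0 | intros; apply Rmult_comm].
      * apply (is_derive_mult g (fun t => sc t * P1 (sin t ^ 2))); [apply Hg | | intros; apply Rmult_comm].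
        apply (is_derive_mult sc (fun t => P1 (sin t ^ 2))); [apply Dsc | now apply D1 | intros; apply Rmult_comm].
    + pose proof (PSeries_ode (k ^ 2) b1 b2 c0 c1 b B (sin t ^ 2) Hb (Hs t Ht) H0 Hn) as O.
      fold P0 P1 P2 in O. specialize (Hgg t). specialize (Hg2 t).
      pose proof (Delta_neq0 k Hk t). pose proof (Delta_sqr k Hk t) as HD. pose proof (cos_sqr t) as HC.
      unfold plus, mult, sc; simpl. change (sin t * (sin t * 1)) with (sin t ^ 2).
      change (Delta k t * (Delta k t * 1)) with (Delta k t ^ 2) in *.
      change (k * (k * 1)) with (k ^ 2).
      apply Rmult_eq_reg_r with (Delta k t); auto.
      set (d := Delta k t) in *. set (s := sin t) in *. set (c := cos t) in *.
      set (p0 := P0 (s ^ 2)) in *. set (p1 := P1 (s ^ 2)) in *. set (p2 := P2 (s ^ 2)) in *.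
      transitivity (g2 t * p0 + s * p1 * (4 * g1 t * c * d)
        + g t * (4 * s ^ 2 * c ^ 2 * d ^ 2 * p2
                 + (2 * (1 - 2 * s ^ 2) * d ^ 2 - 2 * k ^ 2 * s ^ 2 * (1 - s ^ 2)) * p1)); [field; auto|].
      rewrite Hgg, Hg2, HC, HD.
      transitivity (w ^ 2 * (g t * p0)); [|field; auto].
      transitivity (g t * (w ^ 2 * p0) + g t * 0); [rewrite <- O; ring | ring].
  - rewrite Eg1. unfold sc. rewrite sin_0. ring.
Qed.

Section FourierCoefficients.
Context (k : R).
Hypothesis Hk : 0 < k < 1.
Let kc := sqrt (1 - k ^ 2).

Lemma kc_sqr : kc ^ 2 = 1 - k ^ 2.
Proof. apply pow2_sqrt. nra. Qed.

Lemma kc_bounds : 0 < kc < 1.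
Proof.
  split; [apply sqrt_lt_R0; nra|]. unfold kc. rewrite <- sqrt_1 at 2. apply sqrt_lt_1; nra.
Qed.

Lemma Delta_pow_bounds (n : nat) (x : R) : 0 <= Delta k x ^ n <= 1.
Proof.
  pose proof (Delta_pos k Hk x). pose proof (Delta_le1 k Hk x).
  split; [apply pow_le; lra|]. rewrite <- (pow1 n). apply pow_incr; lra.
Qed.

Lemma continuous_Delta_pow (n : nat) (x : R) : continuous (fun t => Delta k t ^ n) x.
Proof. cont. Qed.

(** * Generating functions of moments as resolvent integrals *)

Section Resolvent.
Context (q : R -> R) (b : nat -> R).
Hypothesis Cq : forall y, continuous q y.
Hypothesis Hb : forall n, b n = RInt (fun y => q y * Delta k y ^ (2 * n)) 0 (PI / 2).

Lemma moment_bounded : exists B, forall n, Rabs (b n) <= B.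
Proof.
  pose proof PI_RGT_0.
  destruct (continuous_bounded q 0 (PI / 2) ltac:(lra) Cq) as (M & HM0 & HM).
  exists ((PI / 2 - 0) * M). intros n. rewrite Hb. apply abs_RInt_le_const; [lra | |].
  - apply ex_RInt_cont. cont.
  - intros y Hy. rewrite Rabs_mult. pose proof (Delta_pow_bounds (2 * n) y).
    rewrite (Rabs_pos_eq (_ ^ _)) by lra. specialize (HM y Hy). pose proof (Rabs_pos (q y)). nra.
Qed.

Lemma resolvent_pos (x y : R) : 0 <= x < 1 -> 0 < 1 - Delta k y ^ 2 * x.
Proof. intros Hx. pose proof (Delta_pow_bounds 2 y). nra. Qed.

Lemma continuous_resolvent (r : R -> R) (x y : R) : (forall y, continuous r y) -> 0 <= x < 1 ->
  continuous (fun y => r y / (1 - Delta k y ^ 2 * x)) y.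
Proof.
  intros Cr Hx. cont. apply continuous_Rinv_comp.
  - apply cont_ext with (fun y => 1 + - x * Delta k y ^ 2); [intros; ring|].
    cont.
  - pose proof (resolvent_pos x y Hx). lra.
Qed.

(** The geometric series in [Delta k y ^ 2 * x], integrated term by term. With [x = sn(v)^2] the
    denominator is that of the addition formulas for [dn(u + i v)] and [cn(u + i v)]. *)
Lemma PSeries_resolvent (x : R) : 0 <= x < 1 ->
  PSeries b x = RInt (fun y => q y / (1 - Delta k y ^ 2 * x)) 0 (PI / 2).
Proof.
  intros Hx. pose proof PI_RGT_0.
  destruct (continuous_bounded q 0 (PI / 2) ltac:(lra) Cq) as (M & HM0 & HM).
  assert (Cn : forall n y, continuous (fun y => x ^ n * (q y * Delta k y ^ (2 * n))) y).
  { cont. }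
  assert (H1 : is_series (fun n => RInt (fun y => x ^ n * (q y * Delta k y ^ (2 * n))) 0 (PI / 2))
                 (RInt (fun y => q y / (1 - Delta k y ^ 2 * x)) 0 (PI / 2))).
  { apply (is_series_RInt (fun n y => x ^ n * (q y * Delta k y ^ (2 * n))) _ 0 (PI / 2) M x); auto; try lra.
    - intros y. now apply continuous_resolvent.
    - intros y _. apply is_series_ext with (fun n => q y * (Delta k y ^ 2 * x) ^ n).
      + intros n. rewrite Rpow_mult_distr, <- pow_mult. Rring.
      + apply (is_series_scal_l (K := R_AbsRing) (V := R_NormedModule) (q y) (fun n => (Delta k y ^ 2 * x) ^ n)
          (/ (1 - Delta k y ^ 2 * x))), is_series_geom.
        pose proof (resolvent_pos x y Hx). pose proof (Delta_pow_bounds 2 y).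
        rewrite Rabs_pos_eq; nra.
    - intros n y Hy. rewrite !Rabs_mult. pose proof (Delta_pow_bounds (2 * n) y).
      rewrite (Rabs_pos_eq (_ ^ (2 * n))) by lra. rewrite (Rabs_pos_eq (x ^ n)) by (apply pow_le; lra).
      specialize (HM y Hy). pose proof (Rabs_pos (q y)).
      assert (0 <= x ^ n) by (apply pow_le; lra).
      assert (Rabs (q y) * Delta k y ^ (2 * n) <= M) by nra. nra. }
  apply is_series_unique in H1. rewrite <- H1. apply Series_ext. intros n.
  rewrite Hb. symmetry.
  transitivity (RInt (fun y => x ^ n * (q y * Delta k y ^ (2 * n)) + 0 * 0) 0 (PI / 2)).
  - apply RInt_ext; intros; Rring.
  - rewrite (RInt_lin (fun y => q y * Delta k y ^ (2 * n)) (fun _ => 0)); [Rring | |].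
    + apply ex_RInt_cont. cont.
    + apply ex_RInt_const.
Qed.
End Resolvent.

(** * Moments of dn *)

Section Dn.
Context (w : R).
Hypothesis Hw : sin (w * ellF k (PI / 2)) = 0.
(** By the addition formula, [Re dn(u + i v)] is [cn(v) dn(v)] times
    [dn(u) / (1 - dn(u)^2 sn(v)^2)], with the functions of [v] at modulus [kc]. These are the
    coefficients of [sn(v)^(2 n)] in the cosine integral of the quotient. *)
Definition dn_moment (n : nat) : R :=
  ellInt k (fun x => Delta k x ^ (2 * n + 1) * cos (w * ellF k x)).

Lemma dn_moment_rec (n : nat) :
  - (2 * INR n + 1) * (2 * INR n + 2) * dn_moment (S n)
  + (2 * INR n + 1) ^ 2 * (1 + kc ^ 2) * dn_moment n
  - (2 * INR n + 1) * (2 * INR n) * kc ^ 2 * dn_moment (n - 1) = - w ^ 2 * dn_moment n.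
Proof.
  assert (E : ellD2 k (fun x => Delta k x ^ (2 * n + 1))
    (fun x => INR (2 * n + 1) * Delta k x ^ (2 * n + 1 - 1) * (- k ^ 2 * sin x * cos x))
    (fun x => - ((2 * INR n + 1) * (2 * INR n) * kc ^ 2) * Delta k x ^ (2 * n + 1 - 2)
              + (2 * INR n + 1) ^ 2 * (1 + kc ^ 2) * Delta k x ^ (2 * n + 1)
              + - (2 * INR n + 1) * (2 * INR n + 2) * Delta k x ^ (2 * n + 1 + 2))).
  { eapply ellD2_ext; [|apply (ellD2_Delta_pow k Hk (2 * n + 1))].
    intros x. cbv beta. replace (2 * n + 1 - 1)%nat with (2 * n)%nat by lia.
    rewrite kc_sqr, !plus_INR, mult_INR. simpl INR. ring. }
  pose proof (moment_rec k Hk _ _ w (ellD2_cos_ellF k Hk w) _ _ _ _ _ _ _ _ E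
    (continuous_Delta_pow _) (continuous_Delta_pow _) (continuous_Delta_pow _)) as H.
  unfold dn_moment. replace (2 * S n + 1)%nat with (2 * n + 1 + 2)%nat by lia.
  (* The derivatives of [dn^(2 n + 1)] and of [cos (w u)] vanish at both ends; for the latter at
     [u = K] this is [Hw]. *)
  cbv beta in H. rewrite ellF_0, Rmult_0_r, sin_0, cos_PI2, Hw in H.
  specialize (H ltac:(ring) ltac:(ring)).
  rewrite <- H. destruct n as [|n].
  - simpl INR. ring.
  - replace (2 * (S n - 1) + 1)%nat with (2 * S n + 1 - 2)%nat by lia. ring.
Qed.

(** With [v = ellF kc psi] the left-hand side is the integral of
    [Re dn(u + i v) * cos (w * u)] over [0 <= u <= K]. *)
Lemma dn_moment_PSeries (psi : R) : 0 <= psi < PI / 2 ->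
  cos psi * Delta kc psi * PSeries dn_moment (sin psi ^ 2) = dn_moment 0 * cosh (w * ellF kc psi).
Proof.
  intros Hpsi.
  assert (Cq : forall y, continuous (fun x => cos (w * ellF k x)) y)
    by exact (ellD_continuous _ _ _ (proj1 (ellD2_cos_ellF k Hk w))).
  destruct (moment_bounded (fun x => cos (w * ellF k x)) dn_moment Cq) as [B HB].
  { intros n. apply RInt_ext. intros y _. rewrite pow_add. simpl pow. Rfield. now apply Delta_neq0. }
  pose proof (ellD2_mult kc kc_bounds _ _ _ _ _ _ (ellD2_cos kc kc_bounds) (ellD2_Delta kc kc_bounds)) as Eg.
  (* The parameters come from [dn_moment_rec (S n)]: its middle coefficient is written in terms of
     [(n + 1) n], [n + 1] and 1, its last one in terms of [n (n - 1)], [n] and 1. *)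
  refine (PSeries_ode_cosh kc w (- 8 * (1 + kc ^ 2)) (14 * kc ^ 2) (- (1 + kc ^ 2) - w ^ 2) (6 * kc ^ 2) B psi
    dn_moment _ _ _ kc_bounds Hpsi HB _ _ Eg _ _ _ _).
  - pose proof (dn_moment_rec 0) as H. simpl INR in H. lra.
  - intros n. pose proof (dn_moment_rec (S n)) as H. rewrite S_INR in H.
    replace (S n - 1)%nat with n in H by lia. lra.
  - rewrite cos_0, Delta_0. ring.
  - cbv beta. rewrite sin_0. ring.
  - intros x. cbv beta. ring.
  - intros x. cbv beta. pose proof (Delta_sqr kc kc_bounds x) as HD. pose proof (cos_sqr x) as HC.
    ring [HD HC].
Qed.
End Dn.

(** The integrand [dn u] is the derivative of the amplitude, which runs from 0 to [PI / 2]. *)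
Lemma dn_moment_0_mass : dn_moment 0 0 = PI / 2.
Proof.
  unfold dn_moment, ellInt. rewrite (RInt_ext _ (fun _ => 1)).
  - rewrite (RInt_const (V := R_CompleteNormedModule)). unfold scal; simpl; unfold mult; simpl. ring.
  - intros x _. rewrite Rmult_0_l, cos_0. simpl. Rfield. now apply Delta_neq0.
Qed.

(** The case [w = 0] of [dn_moment_PSeries]: there [cosh (w v)] is constantly 1, so the integral
    need not be computed. *)
Lemma resolvent_mass (psi : R) : 0 < psi < PI / 2 ->
  cos psi * Delta kc psi * RInt (fun y => 1 / (1 - Delta k y ^ 2 * sin psi ^ 2)) 0 (PI / 2) = PI / 2.
Proof.
  intros Hpsi.
  assert (Hs : 0 <= sin psi ^ 2 < 1).
  { split; [apply pow2_ge_0|]. assert (0 < cos psi) by (apply cos_gt_0; lra). pose proof (cos_sqr psi). nra. }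
  rewrite <- (PSeries_resolvent (fun _ => 1) (dn_moment 0)); auto.
  - rewrite dn_moment_PSeries; [|now rewrite Rmult_0_l, sin_0|lra].
    rewrite dn_moment_0_mass, Rmult_0_l, cosh_0. ring.
  - intros; apply continuous_const.
  - intros n. apply RInt_ext. intros y _. rewrite pow_add, Rmult_0_l, cos_0. simpl pow. Rfield.
    now apply Delta_neq0.
Qed.

(** The mass of the kernel [cos psi * Delta kc psi / (1 - Delta k y ^ 2 * sin psi ^ 2)]
    is constant and concentrates at [y = 0] as [psi] tends to [PI / 2]. *)
Lemma resolvent_limit (q : R -> R) (b : nat -> R) (C psi : R) :
  (forall y, continuous q y) ->
  (forall n, b n = RInt (fun y => q y * Delta k y ^ (2 * n)) 0 (PI / 2)) ->
  (forall y, 0 <= y <= PI / 2 -> Rabs (q y - 1) <= C * sin y ^ 2) ->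
  0 < psi < PI / 2 ->
  Rabs (cos psi * Delta kc psi * PSeries b (sin psi ^ 2) - PI / 2)
    <= PI / 2 * (C / k ^ 2) * (cos psi / sin psi ^ 2).
Proof.
  intros Cq Hb Hq Hpsi.
  assert (Hc : 0 < cos psi) by (apply cos_gt_0; lra).
  assert (Hs : 0 < sin psi) by (apply sin_gt_0; lra).
  assert (Hx : 0 <= sin psi ^ 2 < 1) by (pose proof (cos_sqr psi); nra).
  rewrite (PSeries_resolvent q b Cq Hb) by auto.
  rewrite <- (resolvent_mass psi Hpsi) at 2.
  rewrite <- Rmult_minus_distr_l.
  set (x := sin psi ^ 2) in *.
  replace (RInt _ 0 (PI / 2) - RInt _ 0 (PI / 2))
    with (RInt (fun y => 1 * (q y / (1 - Delta k y ^ 2 * x)) + -1 * (1 / (1 - Delta k y ^ 2 * x))) 0 (PI / 2)).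
  2: { rewrite RInt_lin.
       - Rring.
       - apply ex_RInt_cont. intros. now apply continuous_resolvent.
       - apply ex_RInt_cont. intros. apply (continuous_resolvent (fun _ => 1)); auto.
         intros; apply continuous_const. }
  pose proof PI_RGT_0. pose proof (Delta_pos kc kc_bounds psi). pose proof (Delta_le1 kc kc_bounds psi).
  assert (HC : 0 <= C).
  { specialize (Hq (PI / 2) ltac:(lra)). rewrite sin_PI2 in Hq. pose proof (Rabs_pos (q (PI / 2) - 1)). lra. }
  assert (Hx0 : 0 < x) by (unfold x; nra).
  assert (Hk2 : 0 < k ^ 2) by nra.
  rewrite Rabs_mult, Rabs_mult, (Rabs_pos_eq (cos psi)), (Rabs_pos_eq (Delta kc psi)) by lra.
  apply Rle_trans with (cos psi * 1 * ((PI / 2 - 0) * (C / (k ^ 2 * x)))).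
  2: { right. field. lra. }
  apply Rmult_le_compat; [nra | apply Rabs_pos | nra |].
  apply abs_RInt_le_const; [lra | |].
  - apply ex_RInt_cont. intros y. apply cont_plus; (apply cont_mult; [apply continuous_const|]).
    + now apply continuous_resolvent.
    + apply (continuous_resolvent (fun _ => 1)); auto. intros; apply continuous_const.
  - intros y Hy. pose proof (resolvent_pos x y Hx) as Hp.
    replace (_ + _) with ((q y - 1) / (1 - Delta k y ^ 2 * x)) by (field; lra).
    unfold Rdiv. rewrite Rabs_mult, (Rabs_pos_eq (/ _)) by (left; now apply Rinv_0_lt_compat).
    specialize (Hq y Hy).
    apply Rle_trans with (C * sin y ^ 2 * / (1 - Delta k y ^ 2 * x)).
    + apply Rmult_le_compat_r; [left; now apply Rinv_0_lt_compat | auto].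
    + apply Rmult_le_reg_r with (1 - Delta k y ^ 2 * x); auto.
      rewrite Rmult_assoc, Rinv_l, Rmult_1_r by lra.
      (* The denominator is [(1 - x) + k^2 x sin(y)^2]. Dropping [1 - x] cancels [sin(y)^2] against
         the numerator and leaves a bound free of [y]. *)
      rewrite (Delta_sqr k Hk y).
      replace (C * / (k ^ 2 * x) * (1 - (1 - k ^ 2 * sin y ^ 2) * x))
        with (C * sin y ^ 2 + C * (1 - x) / (k ^ 2 * x)) by (field; lra).
      assert (0 <= C * (1 - x) / (k ^ 2 * x)); [|lra].
      apply Rdiv_le_0_compat; nra.
Qed.

(** Up to [PI / 3] the cosine is at least 1/2, which gives even [y <= 2 sin y]; beyond,
    [sin y >= 1 / 2] while [y <= PI / 2 <= 2]. *)
Lemma le_4_sin (y : R) : 0 <= y <= PI / 2 -> y <= 4 * sin y.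
Proof.
  intros Hy. pose proof PI_RGT_0. pose proof PI_4.
  destruct (Rle_lt_dec y (PI / 3)) as [H3|H3].
  - destruct (MVT_gen sin 0 y cos) as (c & Hc & E).
    + intros t _. apply is_derive_sin.
    + intros t _. apply continuity_pt_filterlim, continuous_sin.
    + rewrite Rmin_left, Rmax_right in Hc by lra. rewrite sin_0 in E.
      assert (1 / 2 <= cos c); [|nra].
      rewrite <- cos_PI3. apply cos_decr_1; lra.
  - assert (1 / 2 <= sin y); [|lra]. rewrite <- sin_PI6. apply sin_incr_1; lra.
Qed.

Lemma one_minus_cos_le (z : R) : 0 <= 1 - cos z <= z ^ 2 / 2.
Proof.
  pose proof (COS_bound z). split; [lra|].
  assert (E : 1 - cos z = 2 * sin (z / 2) ^ 2).
  { replace z with (2 * (z / 2)) at 1 by field. rewrite cos_2a_sin. ring. }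
  rewrite E. assert (sin (z / 2) ^ 2 <= (z / 2) ^ 2); [|lra].
  rewrite <- !Rsqr_pow2. apply Rsqr_le_abs_1.
  destruct (MVT_gen sin 0 (z / 2) cos) as (c & Hc & E').
  - intros t _. apply is_derive_sin.
  - intros t _. apply continuity_pt_filterlim, continuous_sin.
  - rewrite sin_0, !Rminus_0_r in E'. rewrite E', Rabs_mult.
    pose proof (COS_bound c). assert (Rabs (cos c) <= 1) by (apply Rabs_le; lra).
    pose proof (Rabs_pos (z / 2)). nra.
Qed.

Lemma ellF_le (y : R) : 0 <= y -> 0 <= ellF k y <= y / kc.
Proof.
  intros Hy. pose proof kc_bounds.
  destruct (MVT_gen (ellF k) 0 y (fun t => / Delta k t)) as (c & Hc & E).
  - intros t _. now apply is_derive_ellF.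
  - intros t _. apply continuity_pt_filterlim.
    exact (cont_of_derive _ _ (is_derive_ellF k Hk) t).
  - rewrite ellF_0, !Rminus_0_r in E. rewrite E.
    pose proof (Delta_pos k Hk c). pose proof (Delta_ge k Hk c) as Hge. fold kc in Hge.
    assert (0 < / Delta k c <= / kc).
    { split; [now apply Rinv_0_lt_compat | apply Rinv_le_contravar; lra]. }
    unfold Rdiv. split; nra.
Qed.

(** The quadratic closeness to 1 that [resolvent_limit] asks of its weight. The constant is
    [w^2 (4 / kc)^2 / 2], from [ellF_le] and [le_4_sin]. *)
Lemma cos_ellF_near_1 (w y : R) : 0 <= y <= PI / 2 ->
  Rabs (cos (w * ellF k y) - 1) <= (w ^ 2 * 8 / kc ^ 2) * sin y ^ 2.
Proof.
  intros Hy. pose proof kc_bounds. pose proof (ellF_le y (proj1 Hy)) as HF.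
  pose proof (one_minus_cos_le (w * ellF k y)) as H1. pose proof (le_4_sin y Hy) as H4.
  rewrite Rabs_minus_sym, Rabs_pos_eq by lra. eapply Rle_trans; [apply H1|].
  assert (HF2 : ellF k y ^ 2 <= (4 * sin y / kc) ^ 2).
  { apply pow_incr. split; [lra|]. apply Rle_trans with (y / kc); [lra|].
    apply Rmult_le_compat_r; [left; apply Rinv_0_lt_compat; lra | lra]. }
  replace (w ^ 2 * 8 / kc ^ 2 * sin y ^ 2) with (w ^ 2 * (4 * sin y / kc) ^ 2 / 2) by (field; lra).
  rewrite Rpow_mult_distr. pose proof (pow2_ge_0 w). nra.
Qed.

(** At [psi = PI / 2] the power series in [sin psi ^ 2] reaches the edge of its disk. The limit is
    therefore taken on the closed form [Phi], which is continuous there, with an error of order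
    [cos psi]. *)
Lemma limit_at_PI2 (Phi : R -> R) (l C : R) : continuous Phi (PI / 2) ->
  (forall psi, 0 < psi < PI / 2 -> Rabs (Phi psi - l) <= C * (cos psi / sin psi ^ 2)) ->
  Phi (PI / 2) = l.
Proof.
  intros HP H. pose proof PI_RGT_0.
  set (T := fun psi => C * (cos psi / sin psi ^ 2) - Rabs (Phi psi - l)).
  assert (CT : continuous T (PI / 2)).
  { apply (continuous_minus (V := R_NormedModule) (fun psi => C * (cos psi / sin psi ^ 2))).
    - apply continuous_of_derivable. auto_derive.
      rewrite sin_PI2. lra.
    - apply (continuous_comp (fun psi => Phi psi - l) Rabs); [|apply continuous_Rabs].
      apply (continuous_minus (V := R_NormedModule) Phi (fun _ => l)); auto.
      apply continuous_const. }
  assert (ET : T (PI / 2) = - Rabs (Phi (PI / 2) - l)).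
  { unfold T. rewrite cos_PI2, sin_PI2. field. }
  destruct (Req_dec (Phi (PI / 2)) l) as [|D]; auto. exfalso.
  assert (Hp : 0 < Rabs (Phi (PI / 2) - l)) by (apply Rabs_pos_lt; lra).
  destruct (CT (fun y => y < 0)) as [d Hd].
  { exists (mkposreal _ Hp). intros y Hy.
    apply ball_R in Hy; simpl in Hy. rewrite ET in Hy. lra. }
  set (e := Rmin (d / 2) (PI / 4)).
  assert (He : 0 < e /\ e < d /\ e <= PI / 4).
  { pose proof (cond_pos d). unfold e. split; [apply Rmin_glb_lt; lra | split].
    - eapply Rle_lt_trans; [apply Rmin_l | lra].
    - apply Rmin_r. }
  specialize (H (PI / 2 - e) ltac:(lra)).
  assert (T (PI / 2 - e) < 0); [|unfold T in *; lra].
  apply Hd. apply ball_R. lra.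
Qed.

Lemma continuous_cosh_ellF (kk w x : R) : 0 < kk < 1 -> continuous (fun t => cosh (w * ellF kk t)) x.
Proof. intros H. exact (ellD_continuous _ _ _ (proj1 (ellD2_cosh_ellF kk w H)) x). Qed.

Lemma dn_fourier (w : R) : sin (w * ellF k (PI / 2)) = 0 ->
  ellInt k (fun x => Delta k x * cos (w * ellF k x)) = PI / (2 * cosh (w * ellF kc (PI / 2))).
Proof.
  intros Hw. pose proof kc_bounds as Hkc.
  assert (E : dn_moment w 0 * cosh (w * ellF kc (PI / 2)) = PI / 2).
  { apply (limit_at_PI2 (fun psi => dn_moment w 0 * cosh (w * ellF kc psi)) _
             (PI / 2 * ((w ^ 2 * 8 / kc ^ 2) / k ^ 2))).
    - apply cont_mult; [apply continuous_const | now apply continuous_cosh_ellF].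
    - intros psi Hpsi. rewrite <- dn_moment_PSeries by (auto; lra).
      apply (resolvent_limit (fun y => cos (w * ellF k y))); auto.
      + exact (ellD_continuous _ _ _ (proj1 (ellD2_cos_ellF k Hk w))).
      + intros n. apply RInt_ext. intros y _. rewrite pow_add. simpl pow. Rfield. now apply Delta_neq0.
      + intros y Hy. now apply cos_ellF_near_1. }
  pose proof (cosh_gt0 (w * ellF kc (PI / 2))).
  replace (ellInt k _) with (dn_moment w 0).
  - apply Rmult_eq_reg_r with (cosh (w * ellF kc (PI / 2))); [|lra]. rewrite E. field. lra.
  - apply ellInt_ext. intros x. simpl. ring.
Qed.

(** * Moments of cn *)

Section Cn.
Context (w : R).
Hypothesis Hw : cos (w * ellF k (PI / 2)) = 0.
(** The same expansion for [Re cn(u + i v) = cn(v) cn(u) / (1 - dn(u)^2 sn(v)^2)], the functions of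
    [v] again at modulus [kc]. *)
Definition cn_moment (n : nat) : R :=
  ellInt k (fun x => (cos x * Delta k x ^ (2 * n)) * cos (w * ellF k x)).

Lemma cn_moment_rec (n : nat) :
  - (2 * INR n + 1) * (2 * INR n + 2) * cn_moment (S n)
  + ((2 * INR n + 1) ^ 2 + kc ^ 2 * (2 * INR n) ^ 2) * cn_moment n
  - (2 * INR n) * (2 * INR n - 1) * kc ^ 2 * cn_moment (n - 1) = - w ^ 2 * cn_moment n.
Proof.
  assert (Cc : forall p x, continuous (fun x => cos x * Delta k x ^ p) x).
  { cont. }
  pose proof (moment_rec k Hk _ _ w (ellD2_cos_ellF k Hk w) _ _ _ _ _ _ _ _
    (ellD2_cos_Delta_pow k Hk (2 * n)) (Cc _) (Cc _) (Cc _)) as H.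
  cbv beta in H. rewrite ellF_0, Rmult_0_r, sin_0, cos_PI2, Hw in H.
  specialize (H ltac:(ring) ltac:(ring)).
  unfold cn_moment. rewrite <- H, !plus_INR, !mult_INR, kc_sqr.
  replace (2 * S n)%nat with (2 * n + 2)%nat by lia. simpl (INR 2). simpl (INR 1).
  destruct n as [|n].
  - simpl INR. ring.
  - replace (2 * (S n - 1))%nat with (2 * S n - 2)%nat by lia.
    rewrite minus_INR, mult_INR by lia. simpl (INR 2). simpl (INR 1). ring.
Qed.

Let q := fun y => cos y / Delta k y * cos (w * ellF k y).

Lemma continuous_cn_weight (y : R) : continuous q y.
Proof.
  apply cont_mult.
  - apply cont_mult; [apply continuous_cos | now apply continuous_inv_Delta].
  - exact (ellD_continuous _ _ _ (proj1 (ellD2_cos_ellF k Hk w)) y).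
Qed.

Lemma cn_moment_weight (n : nat) :
  cn_moment n = RInt (fun y => q y * Delta k y ^ (2 * n)) 0 (PI / 2).
Proof. apply RInt_ext. intros y _. unfold q. Rfield. now apply Delta_neq0. Qed.

Lemma cn_moment_PSeries (psi : R) : 0 <= psi < PI / 2 ->
  cos psi * PSeries cn_moment (sin psi ^ 2) = cn_moment 0 * cosh (w * ellF kc psi).
Proof.
  intros Hpsi. destruct (moment_bounded q cn_moment continuous_cn_weight cn_moment_weight) as [B HB].
  refine (PSeries_ode_cosh kc w (- 4 * (1 + kc ^ 2) - 4) (10 * kc ^ 2) (- 1 - w ^ 2) (2 * kc ^ 2) B psi
    cn_moment _ _ _ kc_bounds Hpsi HB _ _ (ellD2_cos kc kc_bounds) _ _ _ _).
  - pose proof (cn_moment_rec 0) as H. simpl INR in H. lra.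
  - intros n. pose proof (cn_moment_rec (S n)) as H. rewrite S_INR in H.
    replace (S n - 1)%nat with n in H by lia. lra.
  - apply cos_0.
  - cbv beta. rewrite sin_0. ring.
  - intros x. cbv beta. ring.
  - intros x. cbv beta. pose proof (Delta_sqr kc kc_bounds x) as HD. ring [HD].
Qed.

Lemma cn_weight_near_1 (y : R) : 0 <= y <= PI / 2 ->
  Rabs (q y - 1) <= ((2 + w ^ 2 * 8 / kc ^ 2) / kc) * sin y ^ 2.
Proof.
  intros Hy. pose proof kc_bounds. pose proof (cos_ellF_near_1 w y Hy) as HF.
  pose proof (Delta_pos k Hk y). pose proof (Delta_le1 k Hk y) as Hd1.
  pose proof (Delta_ge k Hk y) as Hge. fold kc in Hge.
  assert (Hc : 0 <= cos y <= 1) by (split; [apply cos_ge_0; lra | apply COS_bound]).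
  pose proof (cos_sqr y). pose proof (Delta_sqr k Hk y).
  set (s2 := sin y ^ 2) in *. assert (0 <= s2) by apply pow2_ge_0.
  set (F := cos (w * ellF k y)) in *. set (d := Delta k y) in *. set (D := w ^ 2 * 8 / kc ^ 2) in *.
  replace (q y - 1) with ((cos y * F - d) * / d) by (unfold q; fold d F; field; lra).
  rewrite Rabs_mult, (Rabs_pos_eq (/ d)) by (left; now apply Rinv_0_lt_compat).
  replace ((2 + D) / kc * s2) with ((2 + D) * s2 * / kc) by (field; lra).
  apply Rmult_le_compat; [apply Rabs_pos | left; now apply Rinv_0_lt_compat | | apply Rinv_le_contravar; lra].
  assert (1 - cos y <= s2) by nra.
  assert (k ^ 2 * s2 <= 1 * s2) by (apply Rmult_le_compat_r; nra).
  assert (1 - d <= s2) by nra.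
  replace (cos y * F - d) with (cos y * (F - 1) + (cos y - d)) by ring.
  eapply Rle_trans; [apply Rabs_triang|]. rewrite Rabs_mult, (Rabs_pos_eq (cos y)) by lra.
  assert (Rabs (cos y - d) <= s2) by (apply Rabs_le; lra).
  pose proof (Rabs_pos (F - 1)). nra.
Qed.

Lemma cn_fourier :
  ellInt k (fun x => cos x * cos (w * ellF k x)) = PI / (2 * k * cosh (w * ellF kc (PI / 2))).
Proof.
  pose proof kc_bounds as Hkc.
  (* The kernel of [resolvent_limit] has a factor [Delta kc psi] that [Re cn(u + i v)] lacks. Its
     value at [PI / 2] is the source of the [k] in the denominator. *)
  assert (Dk : Delta kc (PI / 2) = k).
  { unfold Delta. rewrite kc_sqr, sin_PI2. replace (1 - (1 - k ^ 2) * 1 ^ 2) with (k ^ 2) by ring.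
    apply sqrt_pow2. lra. }
  assert (E : Delta kc (PI / 2) * (cn_moment 0 * cosh (w * ellF kc (PI / 2))) = PI / 2).
  { apply (limit_at_PI2 (fun psi => Delta kc psi * (cn_moment 0 * cosh (w * ellF kc psi))) _
             (PI / 2 * ((2 + w ^ 2 * 8 / kc ^ 2) / kc / k ^ 2))).
    - apply cont_mult; [now apply continuous_Delta|].
      apply cont_mult; [apply continuous_const | now apply continuous_cosh_ellF].
    - intros psi Hpsi. rewrite <- cn_moment_PSeries by lra.
      replace (Delta kc psi * (cos psi * PSeries cn_moment (sin psi ^ 2)))
        with (cos psi * Delta kc psi * PSeries cn_moment (sin psi ^ 2)) by ring.
      apply (resolvent_limit q); auto using continuous_cn_weight, cn_moment_weight, cn_weight_near_1. }
  rewrite Dk in E. pose proof (cosh_gt0 (w * ellF kc (PI / 2))).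
  transitivity (cn_moment 0).
  - unfold cn_moment. apply ellInt_ext. intros x. simpl pow. ring.
  - set (ch := cosh (w * ellF kc (PI / 2))) in *.
    apply Rmult_eq_reg_r with (k * ch); [|apply Rmult_integral_contrapositive_currified; lra].
    transitivity (k * (cn_moment 0 * ch)); [ring | rewrite E; field; lra].
Qed.
End Cn.
End FourierCoefficients.

(** * Gamma at half-integers *)

Definition gauss (x : R) : R := RInt (fun t => exp (- t ^ 2)) 0 x.

Lemma continuous_exp_sqr (t : R) : continuous (fun t => exp (- t ^ 2)) t.
Proof. apply continuous_of_derivable. auto_derive. auto. Qed.

Lemma is_derive_gauss (x : R) : is_derive gauss x (exp (- x ^ 2)).
Proof. apply (is_derive_primitive (fun t => exp (- t ^ 2))), continuous_exp_sqr. Qed.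

(** The auxiliary integral of the classical evaluation of the Gaussian integral: its derivative is
    opposite to that of [gauss ^ 2], it equals [atan 1] at 0, and it tends to 0 at infinity. *)
Definition gauss_aux (x : R) : R := RInt (fun t => exp (- x ^ 2 * (1 + t ^ 2)) / (1 + t ^ 2)) 0 1.

Lemma one_plus_sqr_neq0 (t : R) : 1 + t ^ 2 <> 0.
Proof. pose proof (pow2_ge_0 t). lra. Qed.

Lemma continuous_gauss_aux (x t : R) : continuous (fun t => exp (- x ^ 2 * (1 + t ^ 2)) / (1 + t ^ 2)) t.
Proof.
  apply continuous_of_derivable. auto_derive.
  apply one_plus_sqr_neq0.
Qed.

Lemma is_derive_gauss_aux (x : R) : is_derive gauss_aux x (- 2 * gauss x * exp (- x ^ 2)).
Proof.
  assert (D : forall u t, is_derive (fun z => exp (- z ^ 2 * (1 + t ^ 2)) / (1 + t ^ 2)) u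
                            (- 2 * u * exp (- u ^ 2 * (1 + t ^ 2)))).
  { intros u t. pose proof (one_plus_sqr_neq0 t). auto_derive; auto.
    replace (- (u * (u * 1)) * (1 + t * (t * 1))) with (- u ^ 2 * (1 + t ^ 2)) by ring. field. simpl in *. lra. }
  assert (DD : forall u t, Derive (fun z : R => exp (- z ^ 2 * (1 + t ^ 2)) / (1 + t ^ 2)) u
                            = - 2 * u * exp (- u ^ 2 * (1 + t ^ 2)))
    by (intros; apply is_derive_unique, D).
  eapply is_derive_eq.
  - apply (is_derive_RInt_param (fun u t => exp (- u ^ 2 * (1 + t ^ 2)) / (1 + t ^ 2)) 0 1 x).
    + apply filter_forall. intros u t _. eexists. apply D.
    + intros t _. apply continuity_2d_pt_ext with (fun u v => - 2 * u * exp (- (u * u) * (1 + v * v))).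
      * intros u v. symmetry. rewrite DD. do 2 f_equal. ring.
      * apply continuity_2d_pt_mult.
        -- apply continuity_2d_pt_mult; [apply continuity_2d_pt_const | apply continuity_2d_pt_id1].
        -- apply (continuity_1d_2d_pt_comp exp).
           ++ apply derivable_continuous_pt, derivable_pt_exp.
           ++ apply continuity_2d_pt_mult.
              ** apply continuity_2d_pt_opp, continuity_2d_pt_mult; apply continuity_2d_pt_id1.
              ** apply continuity_2d_pt_plus; [apply continuity_2d_pt_const|].
                 apply continuity_2d_pt_mult; apply continuity_2d_pt_id2.
    + apply filter_forall. intros u. apply ex_RInt_cont. apply continuous_gauss_aux.
  - rewrite (RInt_ext _ (fun t => - 2 * exp (- x ^ 2) * (x * exp (- (x * t + 0) ^ 2)) + 0 * 0)).
    2: { intros t _. rewrite DD.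
         replace (- x ^ 2 * (1 + t ^ 2)) with (- x ^ 2 + - (x * t + 0) ^ 2) by ring.
         rewrite exp_plus. Rring. }
    rewrite (RInt_lin (fun t => x * exp (- (x * t + 0) ^ 2)) (fun _ => 0)).
    + pose proof (RInt_comp_lin (V := R_CompleteNormedModule) (fun t => exp (- t ^ 2)) x 0 0 1) as H.
      unfold scal in H; simpl in H; unfold mult in H; simpl in H.
      simpl. rewrite H.
      * replace (x * 0 + 0) with 0 by ring. replace (x * 1 + 0) with x by ring.
        unfold gauss. simpl. Rring.
      * apply ex_RInt_cont. apply continuous_exp_sqr.
    + apply ex_RInt_cont. intros t. apply continuous_of_derivable.
      auto_derive. auto.
    + apply ex_RInt_const.
Qed.

Lemma is_derive_atan_inv (x : R) : is_derive atan x (/ (1 + x ^ 2)).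
Proof.
  apply is_derive_Reals, derivable_pt_lim_atan.
Qed.

Lemma gauss_sqr (x : R) : 0 <= x -> gauss x ^ 2 + gauss_aux x = PI / 4.
Proof.
  intros Hx. transitivity (gauss 0 ^ 2 + gauss_aux 0).
  - apply (const_of_derive_0 (fun x => gauss x ^ 2 + gauss_aux x) 0 x); auto.
    intros t _. eapply is_derive_eq.
    + apply (is_derive_plus (fun x => gauss x ^ 2) gauss_aux); [|apply is_derive_gauss_aux].
      apply (is_derive_pow gauss 2). apply is_derive_gauss.
    + unfold plus; simpl. ring.
  - replace (gauss 0) with 0.
    2: { symmetry. apply (RInt_point (V := R_CompleteNormedModule)). }
    assert (H : RInt (fun t => / (1 + t ^ 2)) 0 1 = atan 1 - atan 0).
    { apply RInt_of_derive; [apply is_derive_atan_inv|].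
      intros t. apply continuous_of_derivable. auto_derive. apply one_plus_sqr_neq0. }
    rewrite atan_0, atan_1 in H.
    transitivity (0 ^ 2 + RInt (fun t => / (1 + t ^ 2)) 0 1).
    + f_equal. apply RInt_ext. intros t _.
      replace (- 0 ^ 2 * (1 + t ^ 2)) with 0 by ring. rewrite exp_0. Rfield. apply one_plus_sqr_neq0.
    + simpl in *. rewrite H. Rfield.
Qed.

Lemma gauss_ge0 (x : R) : 0 <= x -> 0 <= gauss x.
Proof.
  intros Hx. apply RInt_ge_0; auto.
  - apply ex_RInt_cont, continuous_exp_sqr.
  - intros; left; apply exp_pos.
Qed.

Lemma gauss_aux_bounds (x : R) : 0 <= gauss_aux x <= exp (- x ^ 2).
Proof.
  split.
  - apply RInt_ge_0; [lra | apply ex_RInt_cont, continuous_gauss_aux |].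
    intros t _. pose proof (pow2_ge_0 t). apply Rdiv_le_0_compat; [left; apply exp_pos | lra].
  - eapply Rle_trans; [apply Rle_abs|].
    rewrite <- (Rmult_1_l (exp _)). replace 1 with (1 - 0) at 1 by ring.
    apply abs_RInt_le_const; [lra | apply ex_RInt_cont, continuous_gauss_aux |].
    intros t _. pose proof (pow2_ge_0 t) as Ht. pose proof (pow2_ge_0 x) as Hx.
    rewrite Rabs_pos_eq by (apply Rdiv_le_0_compat; [left; apply exp_pos | lra]).
    apply Rle_div_l; [lra|].
    assert (exp (- x ^ 2 * (1 + t ^ 2)) <= exp (- x ^ 2)).
    { destruct (Req_dec (- x ^ 2 * (1 + t ^ 2)) (- x ^ 2)) as [->|]; [lra|].
      left. apply exp_increasing. nra. }
    pose proof (exp_pos (- x ^ 2)). nra.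
Qed.

Lemma gauss_lim : filterlim gauss (Rbar_locally p_infty) (locally (sqrt PI / 2)).
Proof.
  pose proof PI_RGT_0.
  assert (H1 : is_lim (fun x => exp (- x ^ 2)) p_infty 0).
  { apply (is_lim_comp exp (fun x => - x ^ 2) p_infty 0 m_infty).
    - apply is_lim_exp_m.
    - replace m_infty with (Rbar_opp p_infty) by reflexivity. apply is_lim_opp.
      apply is_lim_ext with (fun x => x * x); [intros; ring|].
      apply (is_lim_mult (fun x => x) (fun x => x) p_infty p_infty p_infty); try apply is_lim_id.
      simpl; auto.
    - exists 0. intros y _. discriminate. }
  assert (H2 : is_lim gauss_aux p_infty 0).
  { apply (is_lim_le_le_loc (fun _ => 0) (fun x => exp (- x ^ 2))); auto.
    - exists 0. intros; apply gauss_aux_bounds.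
    - apply is_lim_const. }
  assert (H3 : is_lim gauss p_infty (sqrt (PI / 4))).
  { apply (is_lim_ext_loc (fun x => sqrt (PI / 4 - gauss_aux x))).
    - exists 0. intros x Hx. rewrite <- (gauss_sqr x) by lra.
      replace (_ - _) with (gauss x ^ 2) by ring. apply sqrt_pow2, gauss_ge0. lra.
    - apply (filterlim_comp _ _ _ (fun x => PI / 4 - gauss_aux x) sqrt _ (locally (PI / 4))).
      + assert (H4 : is_lim (fun x => PI / 4 - gauss_aux x) p_infty (PI / 4 - 0)).
        { apply (is_lim_minus' (fun _ => PI / 4) gauss_aux p_infty (PI / 4) 0); auto. apply is_lim_const. }
        rewrite Rminus_0_r in H4. exact H4.
      + apply continuous_sqrt. }
  replace (sqrt PI / 2) with (sqrt (PI / 4)); auto.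
  rewrite sqrt_div by lra. f_equal. replace 4 with (2 ^ 2) by ring. apply sqrt_pow2. lra.
Qed.

Lemma Rpower_half (n : nat) (t : R) : 0 < t -> Rpower t (INR n + 1 / 2) = t ^ n * sqrt t.
Proof.
  intros Ht. rewrite Rpower_plus, Rpower_pow by auto.
  replace (1 / 2) with (/ 2) by field. now rewrite Rpower_sqrt.
Qed.

(** An antiderivative of [t^(n - 1/2) exp(-t)] for [t > 0], with limit 0 at 0. The base case is the
    substitution [t = s^2], the recursion an integration by parts. *)
Fixpoint gamma_primitive (n : nat) (t : R) : R :=
  match n with
  | O => 2 * gauss (sqrt t)
  | S n' => (INR n' + 1 / 2) * gamma_primitive n' t - t ^ n' * sqrt t * exp (- t)
  end.

Lemma is_derive_gamma_primitive (n : nat) (t : R) : 0 < t ->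
  is_derive (gamma_primitive n) t (Rpower t (INR n + 1 / 2 - 1) * exp (- t)).
Proof.
  intros Ht. induction n as [|n IH].
  - simpl gamma_primitive. eapply is_derive_eq.
    + apply (is_derive_scal (fun t => gauss (sqrt t)) t 2).
      apply (is_derive_comp gauss sqrt); [apply is_derive_gauss|].
      apply (is_derive_sqrt (fun t => t) t 1); [apply (is_derive_id t) | auto].
    + unfold scal; simpl; unfold mult; simpl.
      replace (sqrt t * (sqrt t * 1)) with t by (rewrite Rmult_1_r, sqrt_sqrt; lra).
      replace (0 + 1 / 2 - 1) with (- / 2) by field. rewrite Rpower_Ropp, Rpower_sqrt by auto.
      field. apply Rgt_not_eq, sqrt_lt_R0, Ht.
  - simpl gamma_primitive.
    assert (D : is_derive (fun x => Rpower x (INR n + 1 / 2)) t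
                  ((INR n + 1 / 2) * Rpower t (INR n + 1 / 2 - 1)))
      by (apply is_derive_Reals, derivable_pt_lim_power; auto).
    assert (D' : is_derive (fun x => x ^ n * sqrt x) t ((INR n + 1 / 2) * Rpower t (INR n + 1 / 2 - 1))).
    { apply (is_derive_ext_loc (fun x => Rpower x (INR n + 1 / 2))); auto.
      exists (mkposreal t Ht). intros y Hy.
      apply ball_R in Hy; simpl in Hy. apply Rpower_half. lra. }
    eapply is_derive_eq.
    + apply (is_derive_minus (fun t => (INR n + 1 / 2) * gamma_primitive n t)
        (fun t => t ^ n * sqrt t * exp (- t))).
      * apply (is_derive_scal (gamma_primitive n) t (INR n + 1 / 2)). apply IH.
      * apply (is_derive_mult (fun t => t ^ n * sqrt t) (fun t => exp (- t))); [apply D' | | intros; apply Rmult_comm].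
        auto_derive; [auto|reflexivity].
    + unfold minus, plus, opp, mult; simpl. change (match n with O => 1 | S _ => INR n + 1 end) with (INR (S n)).
      rewrite S_INR. replace (INR n + 1 + 1 / 2 - 1) with (INR n + 1 / 2) by ring.
      rewrite Rpower_half by auto. ring.
Qed.

Lemma gamma_boundary_0 (n : nat) :
  filterlim (fun t => t ^ n * sqrt t * exp (- t)) (at_right 0) (locally 0).
Proof.
  replace 0 with ((fun t => t ^ n * sqrt t * exp (- t)) 0) at 2 by (cbv beta; rewrite sqrt_0; ring).
  apply (continuous_at_right (fun t => t ^ n * sqrt t * exp (- t))). apply cont_mult; [apply cont_mult|].
  - apply cont_pow, continuous_id.
  - apply continuous_sqrt.
  - apply continuous_of_derivable. auto_derive. auto.
Qed.

(** For [t > 1], [sqrt t <= t] and the Taylor term of order [n + 2] of [exp t] give a majorant that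
    is a constant times [/ t]. *)
Lemma gamma_boundary_infty (n : nat) :
  filterlim (fun t => t ^ n * sqrt t * exp (- t)) (Rbar_locally p_infty) (locally 0).
Proof.
  change (is_lim (fun t => t ^ n * sqrt t * exp (- t)) p_infty 0).
  apply (is_lim_le_le_loc (fun _ => 0) (fun t => INR (fact (n + 2)) * / t)).
  - exists 1. intros t Ht.
    assert (Hp : 0 < t ^ n) by (apply pow_lt; lra).
    pose proof (exp_pos (- t)). pose proof (sqrt_lt_R0 t ltac:(lra)).
    split; [repeat apply Rmult_le_pos; lra|].
    assert (Hs : sqrt t <= t).
    { rewrite <- (sqrt_pow2 t) at 2 by lra. apply sqrt_le_1_alt. nra. }
    assert (He : t ^ (n + 2) / INR (fact (n + 2)) <= exp t).
    { eapply Rle_trans; [|apply (exp_ge_taylor t (n + 2)); lra].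
      replace (n + 2)%nat with (S (n + 1)) by lia. rewrite tech5.
      assert (0 <= sum_f_R0 (fun k => t ^ k / INR (fact k)) (n + 1)); [|lra].
      apply cond_pos_sum. intros. apply Rdiv_le_0_compat; [apply pow_le; lra | apply INR_fact_lt_0]. }
    pose proof (INR_fact_lt_0 (n + 2)) as Hf.
    apply Rle_div_l in He; auto. rewrite pow_add in He.
    rewrite exp_Ropp. pose proof (exp_pos t).
    apply Rmult_le_reg_r with (t * exp t); [nra|].
    replace (t ^ n * sqrt t * / exp t * (t * exp t)) with (t ^ n * (sqrt t * t)) by (field; lra).
    replace (INR (fact (n + 2)) * / t * (t * exp t)) with (exp t * INR (fact (n + 2))) by (field; lra).
    eapply Rle_trans; [|exact He]. apply Rmult_le_compat_l; nra.
  - apply is_lim_const.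
  - replace (Finite 0) with (Rbar_mult (INR (fact (n + 2))) (Rbar_inv p_infty))
      by (simpl; f_equal; ring).
    apply is_lim_scal_l. apply is_lim_inv; [apply is_lim_id | discriminate].
Qed.

Lemma filterlim_Rminus (F : (R -> Prop) -> Prop) (FF : Filter F) (f g : R -> R) (a b : R) :
  filterlim f F (locally a) -> filterlim g F (locally b) ->
  filterlim (fun t => f t - g t) F (locally (a - b)).
Proof.
  intros Hf Hg.
  apply (filterlim_comp_2 (F := F) f (fun t => - g t) Rplus (G := locally a) (H := locally (- b))); auto.
  - apply (filterlim_comp _ _ _ g Ropp _ (locally b)); auto. apply (filterlim_opp (V := R_NormedModule)).
  - apply (filterlim_plus (V := R_NormedModule)).
Qed.

Lemma gamma_primitive_0 (n : nat) : filterlim (gamma_primitive n) (at_right 0) (locally 0).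
Proof.
  induction n as [|n IH].
  - replace 0 with ((fun t => 2 * gauss (sqrt t)) 0) at 2.
    + apply (continuous_at_right (fun t => 2 * gauss (sqrt t))).
      apply cont_mult; [apply continuous_const|].
      apply (continuous_comp sqrt gauss); [apply continuous_sqrt|].
      exact (cont_of_derive _ _ is_derive_gauss _).
    + cbv beta. rewrite sqrt_0. unfold gauss. rewrite (RInt_point (V := R_CompleteNormedModule)).
      unfold zero; simpl. Rring.
  - replace 0 with ((INR n + 1 / 2) * 0 - 0) at 2 by ring.
    apply (filterlim_Rminus (at_right 0) _ (fun t => (INR n + 1 / 2) * gamma_primitive n t)
      (fun t => t ^ n * sqrt t * exp (- t))).
    + apply (filterlim_comp _ _ _ (gamma_primitive n) (fun y => (INR n + 1 / 2) * y) _ (locally 0)); auto.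
      apply (continuous_scal_r (K := R_AbsRing) (V := R_NormedModule) (INR n + 1 / 2) (fun y => y)), continuous_id.
    + apply gamma_boundary_0.
Qed.

Lemma gamma_primitive_infty (n : nat) :
  filterlim (gamma_primitive n) (Rbar_locally p_infty) (locally (pochhammer (1 / 2) n * sqrt PI)).
Proof.
  induction n as [|n IH].
  - simpl pochhammer. replace (1 * sqrt PI) with (2 * (sqrt PI / 2)) by field.
    apply (filterlim_comp _ _ _ (fun t => gauss (sqrt t)) (fun y => 2 * y) _ (locally (sqrt PI / 2))).
    + apply (filterlim_comp _ _ _ sqrt gauss _ (Rbar_locally p_infty)); [|apply gauss_lim].
      apply filterlim_sqrt_p.
    + apply (continuous_scal_r (K := R_AbsRing) (V := R_NormedModule) 2 (fun y => y)), continuous_id.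
  - simpl pochhammer.
    replace (pochhammer (1 / 2) n * (1 / 2 + INR n) * sqrt PI)
      with ((INR n + 1 / 2) * (pochhammer (1 / 2) n * sqrt PI) - 0) by ring.
    apply (filterlim_Rminus (Rbar_locally p_infty) _ (fun t => (INR n + 1 / 2) * gamma_primitive n t)
      (fun t => t ^ n * sqrt t * exp (- t))).
    + apply (filterlim_comp _ _ _ (gamma_primitive n) (fun y => (INR n + 1 / 2) * y) _
        (locally (pochhammer (1 / 2) n * sqrt PI))); auto.
      apply (continuous_scal_r (K := R_AbsRing) (V := R_NormedModule) (INR n + 1 / 2) (fun y => y)), continuous_id.
    + apply gamma_boundary_infty.
Qed.

Lemma Gamma_half (n : nat) : Gamma (INR n + 1 / 2) = pochhammer (1 / 2) n * sqrt PI.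
Proof.
  unfold Gamma. apply (is_RInt_gen_unique (V := R_CompleteNormedModule)).
  assert (Hpos : forall P : R -> Prop, (forall x, 0 < x -> P x) ->
     filter_prod (at_right 0) (Rbar_locally p_infty)
       (fun ab => forall x, Rmin (fst ab) (snd ab) <= x <= Rmax (fst ab) (snd ab) -> P x)).
  { intros P HP. apply (Filter_prod _ _ _ (fun x => 0 < x) (fun x => 0 < x)).
    - apply filter_imp with (2 := at_right_in 0 1 Rlt_0_1). intros; lra.
    - exists 0. auto.
    - intros x y Hx Hy z Hz. simpl in Hz. apply HP.
      apply Rlt_le_trans with (Rmin x y); [now apply Rmin_glb_lt | tauto]. }
  replace (pochhammer (1 / 2) n * sqrt PI) with (pochhammer (1 / 2) n * sqrt PI - 0) by ring.
  apply (is_RInt_gen_ext (V := R_NormedModule) (Derive (gamma_primitive n))).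
  - apply filter_imp with (2 := Hpos (fun x => Derive (gamma_primitive n) x
        = Rpower x (INR n + 1 / 2 - 1) * exp (- x))
        (fun x Hx => is_derive_unique _ _ _ (is_derive_gamma_primitive n x Hx))).
    intros ab H x Hx. apply H. lra.
  - apply is_RInt_gen_Derive.
    + apply Hpos. intros x Hx. eexists. now apply is_derive_gamma_primitive.
    + apply Hpos. intros x Hx.
      apply (continuous_ext_loc _ (fun x => Rpower x (INR n + 1 / 2 - 1) * exp (- x))).
      * exists (mkposreal x Hx). intros y Hy.
        apply ball_R in Hy; simpl in Hy. symmetry.
        apply is_derive_unique, is_derive_gamma_primitive. lra.
      * apply continuous_of_derivable. unfold Rpower. auto_derive. auto.
    + apply gamma_primitive_0.
    + apply gamma_primitive_infty.
Qed.

(** * Hypergeometric functions as elliptic moments *)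

Definition wallis (N : nat) : R := RInt (fun x => sin x ^ (2 * N)) 0 (PI / 2).

Lemma continuous_sin_pow (n : nat) (x : R) : continuous (fun t => sin t ^ n) x.
Proof. apply cont_pow, continuous_sin. Qed.

Lemma wallis_rec (N : nat) : (2 * INR N + 2) * wallis (S N) = (2 * INR N + 1) * wallis N.
Proof.
  assert (H : RInt (fun x => (2 * INR N + 1) * sin x ^ (2 * N) + - (2 * INR N + 2) * sin x ^ (2 * S N)) 0 (PI / 2)
     = (fun x => sin x ^ (2 * N + 1) * cos x) (PI / 2) - (fun x => sin x ^ (2 * N + 1) * cos x) 0).
  { apply (RInt_of_derive (fun x => sin x ^ (2 * N + 1) * cos x)); [|cont].
    intros x. eapply is_derive_eq; [auto_derive; [auto|reflexivity]|].
    change (N + (N + 0))%nat with (2 * N)%nat.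
    replace (Init.Nat.pred (2 * N + 1)) with (2 * N)%nat by lia.
    replace (2 * S N)%nat with (2 * N + 2)%nat by lia.
    rewrite plus_INR, mult_INR, !pow_add. simpl INR. pose proof (cos_sqr x) as HC. ring [HC]. }
  rewrite RInt_lin in H by (apply ex_RInt_cont, continuous_sin_pow).
  cbv beta in H. rewrite cos_PI2, sin_0, (pow_add 0) in H.
  change (RInt (fun t => sin t ^ (2 * N)) 0 (PI / 2)) with (wallis N) in H.
  change (RInt (fun t => sin t ^ (2 * S N)) 0 (PI / 2)) with (wallis (S N)) in H. simpl (0 ^ 1) in H. lra.
Qed.

Lemma wallis_eq (N : nat) : wallis N = PI / 2 * (pochhammer (1 / 2) N / INR (fact N)).
Proof.
  induction N as [|N IH].
  - unfold wallis. rewrite (RInt_ext _ (fun _ => 1)) by (intros; simpl; Rring).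
    rewrite (RInt_const (V := R_CompleteNormedModule)). unfold scal; simpl; unfold mult; simpl. field.
  - pose proof (wallis_rec N) as H. rewrite IH in H. pose proof (pos_INR N).
    pose proof (INR_fact_neq_0 N).
    apply Rmult_eq_reg_l with (2 * INR N + 2); [|lra]. rewrite H.
    simpl pochhammer. rewrite fact_simpl, mult_INR, S_INR. field. split; [auto|lra].
Qed.

Lemma wallis_cos (N : nat) :
  RInt (fun x => sin x ^ (2 * N) * cos x ^ 2) 0 (PI / 2)
  = PI / 4 * (pochhammer (1 / 2) N / INR (fact (S N))).
Proof.
  transitivity (1 * wallis N + - 1 * wallis (S N)).
  - unfold wallis. rewrite <- RInt_lin by (apply ex_RInt_cont, continuous_sin_pow).
    apply RInt_ext. intros x _. rewrite cos_sqr. replace (2 * S N)%nat with (2 * N + 2)%nat by lia.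
    rewrite pow_add. Rring.
  - rewrite !wallis_eq. simpl pochhammer. rewrite fact_simpl, mult_INR, S_INR.
    pose proof (pos_INR N). pose proof (INR_fact_neq_0 N). Rfield. split; [auto|lra].
Qed.

(** The Taylor coefficients of [(1 - z)^(- a)] at 0. *)
Definition binom_coef (a : R) (i : nat) : R := pochhammer a i / INR (fact i).

Lemma binom_coef_S (a : R) (i : nat) :
  INR (S i) * binom_coef a (S i) = (a + INR i) * binom_coef a i.
Proof.
  unfold binom_coef. simpl pochhammer. rewrite fact_simpl, mult_INR, S_INR.
  pose proof (pos_INR i). pose proof (INR_fact_neq_0 i). field. split; [auto|lra].
Qed.

Lemma binom_coef_bound (a : R) (i : nat) : Rabs a <= 1 -> Rabs (binom_coef a i) <= 1.
Proof.
  intros Ha. induction i as [|i IH].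
  - unfold binom_coef. simpl. rewrite Rabs_pos_eq; lra.
  - pose proof (pos_INR i). pose proof (binom_coef_S a i) as E. rewrite S_INR in E.
    apply (f_equal Rabs) in E. rewrite !Rabs_mult, (Rabs_pos_eq (INR i + 1)) in E by lra.
    apply Rmult_le_reg_l with (INR i + 1); [lra|]. rewrite E.
    apply Rmult_le_compat; auto using Rabs_pos.
    eapply Rle_trans; [apply Rabs_triang|]. rewrite (Rabs_pos_eq (INR i)) by lra. lra.
Qed.

(** The recurrence [binom_coef_S] is the equation [(1 - z) y' = a y] read off coefficient by
    coefficient. It identifies the series for [a = 1/2] and [a = -1/2] by a constant product with
    the reciprocal solution. *)
Lemma binom_ode (a z : R) : Rabs a <= 1 -> Rabs z < 1 ->
  is_derive (PSeries (binom_coef a)) z (a * PSeries (binom_coef a) z / (1 - z)).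
Proof.
  intros Ha Hz.
  assert (R0 : Rbar_lt (Rabs z) (CV_radius (binom_coef a))).
  { apply (CV_radius_bounded_coef _ 1); auto. intros; now apply binom_coef_bound. }
  assert (R1 : Rbar_lt (Rabs z) (CV_radius (PS_derive (binom_coef a)))) by now rewrite CV_radius_derive.
  eapply is_derive_eq; [now apply is_derive_PSeries|].
  assert (E : PSeries (PS_derive (binom_coef a)) z
              = a * PSeries (binom_coef a) z + z * PSeries (PS_derive (binom_coef a)) z).
  { rewrite <- PSeries_scal, <- PSeries_incr_1, <- PSeries_plus.
    - apply PSeries_ext. intros n. unfold PS_plus, PS_scal, PS_incr_1.
      change (@eq R (INR (S n) * binom_coef a (S n))
        (a * binom_coef a n + match n with O => 0 | S n' => INR (S n') * binom_coef a (S n') end)).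
      rewrite binom_coef_S. destruct n; simpl INR; ring.
    - apply ex_pseries_scal; [apply Rmult_comm|]. now apply CV_radius_inside.
    - apply (ex_pseries_incr_1 (PS_derive (binom_coef a)) z). now apply CV_radius_inside. }
  apply Rabs_lt_between in Hz. apply Rmult_eq_reg_r with (1 - z); [|lra].
  transitivity (a * PSeries (binom_coef a) z); [lra | field; lra].
Qed.

Lemma binom_half (z : R) : 0 <= z < 1 -> PSeries (binom_coef (1 / 2)) z = / sqrt (1 - z).
Proof.
  intros Hz.
  assert (Hs : forall t, 0 <= t <= z -> 0 < sqrt (1 - t)) by (intros; apply sqrt_lt_R0; lra).
  assert (E : PSeries (binom_coef (1 / 2)) z * sqrt (1 - z) = PSeries (binom_coef (1 / 2)) 0 * sqrt (1 - 0)).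
  { apply (const_of_derive_0 (fun t => PSeries (binom_coef (1 / 2)) t * sqrt (1 - t)) 0 z); [|lra].
    intros t Ht. eapply is_derive_eq.
    - apply (is_derive_mult (PSeries (binom_coef (1 / 2))) (fun t => sqrt (1 - t))).
      + apply binom_ode; [rewrite Rabs_pos_eq; lra | rewrite Rabs_pos_eq; lra].
      + auto_derive; [lra | reflexivity].
      + intros; apply Rmult_comm.
    - unfold plus, mult; simpl. pose proof (Hs t Ht).
      replace (1 + - t) with (1 - t) by ring.
      assert (Q : sqrt (1 - t) ^ 2 = 1 - t) by (apply pow2_sqrt; lra).
      field [Q]. split; lra. }
  rewrite PSeries_0, Rminus_0_r, sqrt_1 in E. unfold binom_coef at 2 in E. simpl in E.
  pose proof (Hs z ltac:(lra)). apply Rmult_eq_reg_r with (sqrt (1 - z)); [|lra]. rewrite E. field. lra.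
Qed.

Lemma binom_neg_half (z : R) : 0 <= z < 1 -> PSeries (binom_coef (- (1 / 2))) z = sqrt (1 - z).
Proof.
  intros Hz.
  assert (Hs : forall t, 0 <= t <= z -> 0 < sqrt (1 - t)) by (intros; apply sqrt_lt_R0; lra).
  assert (E : PSeries (binom_coef (- (1 / 2))) z * / sqrt (1 - z)
              = PSeries (binom_coef (- (1 / 2))) 0 * / sqrt (1 - 0)).
  { apply (const_of_derive_0 (fun t => PSeries (binom_coef (- (1 / 2))) t * / sqrt (1 - t)) 0 z); [|lra].
    intros t Ht. pose proof (Hs t Ht). eapply is_derive_eq.
    - apply (is_derive_mult (PSeries (binom_coef (- (1 / 2)))) (fun t => / sqrt (1 - t))).
      + apply binom_ode; [apply Rabs_le; lra | rewrite Rabs_pos_eq; lra].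
      + auto_derive; [|reflexivity]. split; [lra|]. split; auto.
        replace (1 + - t) with (1 - t) by ring. lra.
      + intros; apply Rmult_comm.
    - unfold plus, mult; simpl.
      replace (1 + - t) with (1 - t) by ring.
      assert (Q : sqrt (1 - t) ^ 2 = 1 - t) by (apply pow2_sqrt; lra).
      field [Q]. repeat split; lra. }
  rewrite PSeries_0, Rminus_0_r, sqrt_1 in E. unfold binom_coef at 2 in E. simpl in E.
  pose proof (Hs z ltac:(lra)). apply Rmult_eq_reg_r with (/ sqrt (1 - z)).
  - rewrite E. field. lra.
  - apply Rinv_neq_0_compat. lra.
Qed.

Lemma pochhammer_add (a : R) (n i : nat) :
  pochhammer a (n + i) = pochhammer a n * pochhammer (a + INR n) i.
Proof.
  induction i as [|i IH].
  - rewrite Nat.add_0_r. simpl. ring.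
  - rewrite Nat.add_succ_r. simpl. rewrite IH, plus_INR. ring.
Qed.

Lemma pochhammer_pos (a : R) (n : nat) : 0 < a -> 0 < pochhammer a n.
Proof.
  intros Ha. induction n; simpl; [lra|]. pose proof (pos_INR n). nra.
Qed.

Lemma fact_add (n i : nat) : INR (fact (n + i)) = INR (fact n) * pochhammer (INR n + 1) i.
Proof.
  induction i as [|i IH].
  - rewrite Nat.add_0_r. simpl. ring.
  - rewrite Nat.add_succ_r, fact_simpl, mult_INR, IH, S_INR, plus_INR. simpl. ring.
Qed.

(** [(1 - k^2 sin(x)^2)^(- a)] is expanded binomially and integrated term by term. The weight [G]
    will be 1 or [cos x ^ 2]; [d] is the shift that it causes in the factorial of the Wallis
    integral, and thereby in the parameter [c]. *)
Lemma hyp2F1_moment (k a c C : R) (N d : nat) (G : R -> R) :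
  0 < k < 1 -> Rabs a <= 1 ->
  (forall x, continuous G x) -> (forall x, Rabs (G x) <= 1) ->
  (forall i, RInt (fun x => sin x ^ (2 * i) * G x) 0 (PI / 2)
             = C * (pochhammer (1 / 2) i / INR (fact (d + i)))) ->
  c = INR (d + N) + 1 ->
  RInt (fun x => sin x ^ (2 * N) * G x * PSeries (binom_coef a) (k ^ 2 * sin x ^ 2)) 0 (PI / 2)
  = C * (pochhammer (1 / 2) N / INR (fact (d + N))) * hyp2F1 (INR N + 1 / 2) a c (k ^ 2).
Proof.
  intros Hk Ha CG HG HV Hc. pose proof PI_RGT_0.
  assert (Hz : forall x, 0 <= k ^ 2 * sin x ^ 2 < 1).
  { intros x. pose proof (Delta_radicand_pos k Hk x). pose proof (pow2_ge_0 (k * sin x)). nra. }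
  assert (Cs : forall i x, continuous (fun x => sin x ^ (2 * i) * G x) x).
  { cont. }
  assert (H1 : is_series
    (fun i => RInt (fun x => binom_coef a i * (k ^ 2) ^ i * (sin x ^ (2 * (N + i)) * G x)) 0 (PI / 2))
    (RInt (fun x => sin x ^ (2 * N) * G x * PSeries (binom_coef a) (k ^ 2 * sin x ^ 2)) 0 (PI / 2))).
  { apply (is_series_RInt _ _ 0 (PI / 2) 1 (k ^ 2)); try lra; [nra | | | |].
    - cont.
    - intros x. apply cont_mult; [apply Cs|].
      apply (continuous_comp (fun x => k ^ 2 * sin x ^ 2) (PSeries (binom_coef a))).
      + cont.
      + apply continuous_PSeries, (CV_radius_bounded_coef _ 1).
        * intros; now apply binom_coef_bound.
        * rewrite Rabs_pos_eq; apply Hz.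
    - intros x _.
      apply is_series_ext with (fun i => sin x ^ (2 * N) * G x * (binom_coef a i * (k ^ 2 * sin x ^ 2) ^ i)).
      + intros i. replace (2 * (N + i))%nat with (2 * N + 2 * i)%nat by lia.
        rewrite Rpow_mult_distr, pow_add, (pow_mult (sin x) 2 i). Rring.
      + apply (is_series_scal_l (K := R_AbsRing) (V := R_NormedModule) (sin x ^ (2 * N) * G x)
          (fun i => binom_coef a i * (k ^ 2 * sin x ^ 2) ^ i) (PSeries (binom_coef a) (k ^ 2 * sin x ^ 2))).
        apply Series_correct, ex_series_Rabs.
        apply (CV_disk_inside (binom_coef a)), (CV_radius_bounded_coef _ 1).
        * intros; now apply binom_coef_bound.
        * rewrite Rabs_pos_eq; apply Hz.
    - intros i x _. rewrite !Rabs_mult, (Rabs_pos_eq ((k ^ 2) ^ i)) by (apply pow_le, pow2_ge_0).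
      pose proof (binom_coef_bound a i Ha). pose proof (HG x).
      assert (Rabs (sin x ^ (2 * (N + i))) <= 1).
      { rewrite <- RPow_abs, <- (pow1 (2 * (N + i))). apply pow_incr. split; [apply Rabs_pos|].
        apply Rabs_le. pose proof (SIN_bound x). lra. }
      pose proof (Rabs_pos (binom_coef a i)). pose proof (Rabs_pos (sin x ^ (2 * (N + i)))).
      pose proof (Rabs_pos (G x)). assert (0 <= (k ^ 2) ^ i) by (apply pow_le, pow2_ge_0).
      rewrite <- (Rmult_1_r ((k ^ 2) ^ i)) at 2. rewrite Rmult_1_l.
      rewrite (Rmult_comm (Rabs (binom_coef a i))), Rmult_assoc.
      apply Rmult_le_compat_l; auto.
      assert (Rabs (sin x ^ (2 * (N + i))) * Rabs (G x) <= 1) by nra. nra. }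
  apply is_series_unique in H1. rewrite <- H1. unfold hyp2F1, PSeries. rewrite <- Series_scal_l.
  apply Series_ext. intros i.
  transitivity (binom_coef a i * (k ^ 2) ^ i * RInt (fun x => sin x ^ (2 * (N + i)) * G x) 0 (PI / 2)).
  - apply (RInt_scal (V := R_CompleteNormedModule) (fun x => sin x ^ (2 * (N + i)) * G x)).
    apply ex_RInt_cont, Cs.
  - rewrite HV. replace (d + (N + i))%nat with (d + N + i)%nat by lia.
    rewrite fact_add, <- Hc, pochhammer_add. unfold binom_coef.
    replace (1 / 2 + INR N) with (INR N + 1 / 2) by ring.
    assert (0 < pochhammer c i) by (apply pochhammer_pos; rewrite Hc; pose proof (pos_INR (d + N)); lra).
    pose proof (INR_fact_neq_0 (d + N)). pose proof (INR_fact_neq_0 i).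
    Rfield. repeat split; auto; lra.
Qed.

Section Moments.
Context (k : R).
Hypothesis Hk : 0 < k < 1.

Definition moment_dn (N : nat) : R := RInt (fun x => sin x ^ (2 * N) * Delta k x) 0 (PI / 2).
Definition moment_cn (N : nat) : R := RInt (fun x => sin x ^ (2 * N) * cos x ^ 2 / Delta k x) 0 (PI / 2).

Lemma modulus_sin_bounds (x : R) : 0 <= k ^ 2 * sin x ^ 2 < 1.
Proof. pose proof (Delta_radicand_pos k Hk x). pose proof (pow2_ge_0 (k * sin x)). nra. Qed.

Lemma moment_dn_hyp2F1 (N : nat) :
  moment_dn N = PI / 2 * (pochhammer (1 / 2) N / INR (fact N))
                * hyp2F1 (INR N + 1 / 2) (- (1 / 2)) (INR N + 1) (k ^ 2).
Proof.
  change (fact N) with (fact (0 + N)).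
  rewrite <- (hyp2F1_moment k (- (1 / 2)) (INR N + 1) (PI / 2) N 0 (fun _ => 1)); auto.
  - apply RInt_ext. intros x _. rewrite binom_neg_half by apply modulus_sin_bounds.
    unfold Delta. Rring.
  - apply Rabs_le; lra.
  - intros; apply continuous_const.
  - intros. rewrite Rabs_R1. lra.
  - intros i. change (0 + i)%nat with i. rewrite <- wallis_eq. apply RInt_ext. intros; Rring.
Qed.

Lemma moment_cn_hyp2F1 (N : nat) :
  moment_cn N = PI / 4 * (pochhammer (1 / 2) N / INR (fact (S N)))
                * hyp2F1 (INR N + 1 / 2) (1 / 2) (INR N + 2) (k ^ 2).
Proof.
  change (fact (S N)) with (fact (1 + N)).
  rewrite <- (hyp2F1_moment k (1 / 2) (INR N + 2) (PI / 4) N 1 (fun x => cos x ^ 2)); auto.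
  - apply RInt_ext. intros x _. rewrite binom_half by apply modulus_sin_bounds. reflexivity.
  - rewrite Rabs_pos_eq; lra.
  - cont.
  - intros. rewrite Rabs_pos_eq by apply pow2_ge_0. rewrite cos_sqr. pose proof (pow2_ge_0 (sin x)). lra.
  - intros i. apply wallis_cos.
  - rewrite plus_INR. simpl. ring.
Qed.

Lemma sqrt_PI_sqr : sqrt PI * sqrt PI = PI.
Proof. apply sqrt_sqrt. left; apply PI_RGT_0. Qed.

Lemma sqrt_PI_pos : 0 < sqrt PI.
Proof. apply sqrt_lt_R0, PI_RGT_0. Qed.

Lemma h_p_moment (n : nat) : h_p k n = 4 * k ^ n / sqrt PI * moment_cn n.
Proof.
  rewrite moment_cn_hyp2F1. unfold h_p. rewrite Gamma_half, Nat.add_1_r.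
  pose proof sqrt_PI_pos. pose proof (INR_fact_neq_0 (S n)).
  replace (PI / 4) with (sqrt PI * sqrt PI / 4) by (now rewrite sqrt_PI_sqr). field. split; [auto | lra].
Qed.

Lemma h_r_moment (n : nat) : h_r k n = 2 * k ^ n / sqrt PI * moment_dn n.
Proof.
  rewrite moment_dn_hyp2F1. unfold h_r. rewrite Gamma_half.
  pose proof sqrt_PI_pos. pose proof (INR_fact_neq_0 n).
  replace (PI / 2) with (sqrt PI * sqrt PI / 2) by (now rewrite sqrt_PI_sqr). field. split; [auto | lra].
Qed.

Lemma h_q_moment (n : nat) : h_q k n = 2 * k ^ n / sqrt PI * moment_dn (S n).
Proof.
  rewrite moment_dn_hyp2F1. unfold h_q.
  replace (INR n + 3 / 2) with (INR (S n) + 1 / 2) by (rewrite S_INR; field).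
  replace (INR n + 2) with (INR (S n) + 1) by (rewrite S_INR; ring).
  rewrite Gamma_half, Nat.add_1_r.
  pose proof sqrt_PI_pos. pose proof (INR_fact_neq_0 (S n)).
  replace (PI / 2) with (sqrt PI * sqrt PI / 2) by (now rewrite sqrt_PI_sqr). field. split; [auto | lra].
Qed.

Lemma h_s_moment (n : nat) : h_s k n = 4 * k ^ n / sqrt PI * moment_cn (S n).
Proof.
  rewrite moment_cn_hyp2F1. unfold h_s.
  replace (INR n + 3 / 2) with (INR (S n) + 1 / 2) by (rewrite S_INR; field).
  replace (INR n + 3) with (INR (S n) + 2) by (rewrite S_INR; ring).
  rewrite Gamma_half. replace (n + 2)%nat with (S (S n)) by lia.
  pose proof sqrt_PI_pos. pose proof (INR_fact_neq_0 (S (S n))).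
  replace (PI / 4) with (sqrt PI * sqrt PI / 4) by (now rewrite sqrt_PI_sqr). field. split; [auto | lra].
Qed.

Lemma is_RInt_moment_cn (N : nat) :
  is_RInt (fun t => t ^ (2 * N) * sqrt ((1 - t ^ 2) / (1 - k ^ 2 * t ^ 2))) 0 1 (moment_cn N).
Proof.
  set (f := fun t => t ^ (2 * N) * sqrt ((1 - t ^ 2) / (1 - k ^ 2 * t ^ 2))).
  assert (Cf : forall t, -1 <= t <= 1 -> continuous f t).
  { intros t Ht. apply cont_mult; [apply cont_pow, continuous_id|].
    apply continuous_sqrt_comp. apply continuous_of_derivable.
    auto_derive. assert (t ^ 2 <= 1) by nra. assert (0 < k ^ 2 < 1) by nra.
    assert (k ^ 2 * t ^ 2 < 1) by nra. simpl in *. lra. }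
  pose proof PI_RGT_0.
  pose proof (RInt_comp (V := R_CompleteNormedModule) f sin cos 0 (PI / 2)) as E.
  rewrite sin_0, sin_PI2 in E.
  assert (Ex : ex_RInt f 0 1).
  { apply (ex_RInt_continuous (V := R_CompleteNormedModule)). intros t Ht.
    rewrite Rmin_left, Rmax_right in Ht by lra. apply Cf. lra. }
  replace (moment_cn N) with (RInt f 0 1); [now apply (RInt_correct (V := R_CompleteNormedModule))|].
  rewrite <- E.
  - apply RInt_ext. intros x Hx. rewrite Rmin_left, Rmax_right in Hx by lra.
    unfold f, scal; simpl; unfold mult; simpl.
    assert (Hc : 0 < cos x) by (apply cos_gt_0; lra).
    change (sin x * (sin x * 1)) with (sin x ^ 2). change (k * (k * 1)) with (k ^ 2).
    rewrite <- cos_sqr, sqrt_div_alt by (pose proof (Delta_radicand_pos k Hk x); lra).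
    rewrite sqrt_pow2 by lra. fold (Delta k x). Rfield. now apply Delta_neq0.
  - intros x _. apply Cf. apply SIN_bound.
  - intros x _. split; [apply is_derive_sin | apply continuous_cos].
Qed.

Lemma is_derive_asin (x : R) : -1 < x < 1 -> is_derive asin x (/ sqrt (1 - x ^ 2)).
Proof.
  intros Hx. apply is_derive_Reals.
  apply (derive_pt_eq_1 asin x _ (derivable_pt_asin x Hx)).
  rewrite derive_pt_asin. rewrite Rsqr_pow2. unfold Rdiv. ring.
Qed.

Lemma asin_at_left_1 : filterlim asin (at_left 1) (locally (PI / 2)).
Proof.
  intros P [e He]. pose proof PI_RGT_0.
  set (d := Rmin (e / 2) (PI / 2)).
  assert (Hd : 0 < d /\ d < e /\ d <= PI / 2).
  { pose proof (cond_pos e). unfold d. split; [apply Rmin_glb_lt; lra | split].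
    - eapply Rle_lt_trans; [apply Rmin_l | lra].
    - apply Rmin_r. }
  assert (Hs : 0 <= sin (PI / 2 - d) < 1).
  { split; [apply sin_ge_0; lra|]. rewrite <- sin_PI2. apply sin_increasing_1; lra. }
  assert (Hp : 0 < 1 - sin (PI / 2 - d)) by lra.
  exists (mkposreal _ Hp). intros y Hy Hy1. apply He.
  unfold ball in Hy |- *; simpl in Hy |- *; unfold AbsRing_ball, abs, minus, plus, opp in Hy |- *; simpl in Hy |- *.
  apply Rabs_lt_between in Hy. apply Rabs_lt_between.
  pose proof (asin_bound y). destruct (Rlt_le_dec (PI / 2 - d) (asin y)) as [|Hle]; [lra|].
  exfalso. assert (sin (asin y) <= sin (PI / 2 - d)) by (apply sin_incr_1; lra).
  rewrite sin_asin in * by lra. lra.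
Qed.

(** The integrand is unbounded at [t = 1], so the substitution [t = sin x] is made on a primitive:
    [M (asin t)] is differentiable for [-1 < t < 1] and has a limit as [t] tends to 1. *)
Lemma is_RInt_gen_moment_dn (N : nat) :
  is_RInt_gen (fun t => t ^ (2 * N) * sqrt ((1 - k ^ 2 * t ^ 2) / (1 - t ^ 2)))
    (at_point 0) (at_left 1) (moment_dn N).
Proof.
  set (m := fun x => sin x ^ (2 * N) * Delta k x).
  assert (Cm : forall x, continuous m x) by (intros; apply continuous_sin_pow_mult; now apply continuous_Delta).
  set (M := fun b => RInt m 0 b).
  assert (DM : forall x, is_derive M x (m x)) by (intros; now apply is_derive_primitive).
  set (f := fun t => t ^ (2 * N) * sqrt ((1 - k ^ 2 * t ^ 2) / (1 - t ^ 2))).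
  set (V := fun t => M (asin t)).
  assert (DV : forall t, -1 < t < 1 -> is_derive V t (f t)).
  { intros t Ht. eapply is_derive_eq.
    - apply (is_derive_comp M asin); [apply DM | now apply is_derive_asin].
    - unfold scal; simpl; unfold mult; simpl. unfold m, f, Delta. rewrite sin_asin by lra.
      change (t * (t * 1)) with (t ^ 2).
      assert (0 < 1 - t ^ 2) by nra.
      rewrite sqrt_div_alt by auto. field. apply Rgt_not_eq, sqrt_lt_R0. auto. }
  assert (Hprod : forall P : R -> Prop, (forall x, -1 < x < 1 -> P x) ->
     filter_prod (at_point 0) (at_left 1)
       (fun ab => forall x, Rmin (fst ab) (snd ab) <= x <= Rmax (fst ab) (snd ab) -> P x)).
  { intros P HP. apply (Filter_prod _ _ _ (fun x => x = 0) (fun x => -1 < x < 1)).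
    - reflexivity.
    - exists (mkposreal 1 Rlt_0_1). intros y Hy Hy1.
      apply ball_R in Hy; simpl in Hy. lra.
    - intros x y -> Hy z Hz. simpl in Hz. apply HP. split.
      + apply Rlt_le_trans with (Rmin 0 y); [apply Rmin_glb_lt; lra | tauto].
      + apply Rle_lt_trans with (Rmax 0 y); [tauto | apply Rmax_lub_lt; lra]. }
  replace (moment_dn N) with (moment_dn N - 0) by ring.
  apply (is_RInt_gen_ext (V := R_NormedModule) (Derive V)).
  - apply filter_imp with (2 := Hprod (fun x => Derive V x = f x)
        (fun x Hx => is_derive_unique _ _ _ (DV x Hx))).
    intros ab H x Hx. apply H. split; apply Rlt_le, Hx.
  - apply is_RInt_gen_Derive.
    + apply Hprod. intros x Hx. eexists. now apply DV.
    + apply Hprod. intros x Hx. apply (continuous_ext_loc _ f).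
      * assert (Hp : 0 < Rmin (x + 1) (1 - x)) by (apply Rmin_glb_lt; lra).
        exists (mkposreal _ Hp). intros y Hy.
        apply ball_R in Hy; simpl in Hy. pose proof (Rmin_l (x + 1) (1 - x)). pose proof (Rmin_r (x + 1) (1 - x)).
        symmetry. apply is_derive_unique, DV. lra.
      * apply cont_mult; [apply cont_pow, continuous_id|].
        apply continuous_sqrt_comp. apply continuous_of_derivable.
        auto_derive. assert (0 < 1 - x ^ 2) by nra. simpl in *. lra.
    + intros P HP. unfold filtermap, at_point. apply locally_singleton.
      replace (V 0) with 0; auto. unfold V, M. rewrite asin_0.
      symmetry. apply (RInt_point (V := R_CompleteNormedModule)).
    + apply (filterlim_comp _ _ _ asin M _ (locally (PI / 2))); [apply asin_at_left_1|].
      exact (cont_of_derive _ _ DM (PI / 2)).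
Qed.
End Moments.

(** * The recurrence of the eigenvectors *)

Lemma monic_rec_S (a b : nat -> R) (x : R) (n : nat) :
  monic_rec a b x (S n) = (x - a n) * monic_rec a b x n
    - b n * match n with O => 0 | S n' => monic_rec a b x n' end.
Proof. reflexivity. Qed.

(** With [p = 2 n + e], the monic recurrence with [b n = (k p (p - 1)) ^ 2]
    becomes symmetric after division by [(-1) ^ n k ^ n p!]. *)
Lemma normalized_rec (k x : R) (e : nat) (a b : nat -> R) (n : nat) :
  k <> 0 -> (e <= 1)%nat ->
  (forall n, b n = (k * INR (2 * n + e) * (INR (2 * n + e) - 1)) ^ 2) ->
  let Psi n := (-1) ^ n / (k ^ n * INR (fact (2 * n + e))) * monic_rec a b x n in
  k * INR (2 * S n + e) * (INR (2 * S n + e) - 1) * Psi (S n)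
  = (a n - x) * Psi n - k * INR (2 * n + e) * (INR (2 * n + e) - 1) * Psi (n - 1)%nat.
Proof.
  intros Hk He Hb Psi. unfold Psi. rewrite monic_rec_S, Hb.
  assert (Hf : INR (fact (2 * S n + e)) = (INR (2 * n + e) + 2) * (INR (2 * n + e) + 1) * INR (fact (2 * n + e))).
  { replace (2 * S n + e)%nat with (S (S (2 * n + e))) by lia.
    rewrite 2!fact_simpl, !mult_INR, !S_INR. ring. }
  assert (Hp : INR (2 * S n + e) = INR (2 * n + e) + 2).
  { replace (2 * S n + e)%nat with (S (S (2 * n + e))) by lia. rewrite !S_INR. ring. }
  rewrite Hf, Hp. pose proof (INR_fact_neq_0 (2 * n + e)). pose proof (pos_INR (2 * n + e)).
  assert (Hkn : k ^ n <> 0) by now apply pow_nonzero.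
  destruct n as [|n].
  (* For [n = 0] the truncated index [n - 1] is 0 again, but its coefficient is zero because
     [e <= 1]. *)
  - simpl Nat.sub. assert (E0 : INR (2 * 0 + e) * (INR (2 * 0 + e) - 1) = 0).
    { destruct e as [|[|e]]; [simpl; ring | simpl; ring | lia]. }
    rewrite !(Rmult_assoc k), E0. simpl pow. simpl monic_rec. field. repeat split; auto; lra.
  - replace (S n - 1)%nat with n by lia.
    assert (Hf' : INR (fact (2 * S n + e)) = INR (2 * S n + e) * (INR (2 * S n + e) - 1) * INR (fact (2 * n + e))).
    { replace (2 * S n + e)%nat with (S (S (2 * n + e))) by lia.
      rewrite 2!fact_simpl, !mult_INR, !S_INR. ring. }
    assert (Hkn' : k ^ n <> 0) by now apply pow_nonzero.
    pose proof (INR_fact_neq_0 (2 * n + e)).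
    assert (HP : 2 <= INR (2 * S n + e)) by (change 2 with (INR 2); apply le_INR; lia).
    rewrite Hf'. set (P := INR (2 * S n + e)) in *. set (M := monic_rec a b x (S n)) in *. simpl pow.
    field. repeat split; auto; lra.
Qed.

Section Instances.
Context (k : R).
Hypothesis Hk : 0 < k < 1.
Let K := ellF k (PI / 2).

Lemma ellF_pos (x : R) : 0 < x -> 0 < ellF k x.
Proof. intros Hx. rewrite <- (ellF_0 k). now apply ellF_increasing. Qed.

Lemma K_pos : 0 < K.
Proof. apply ellF_pos. pose proof PI_RGT_0. lra. Qed.

(** * The four cases at once: [g = sin^e g0], with [e] equal to 0 or 1 and [g0] to [Delta] or
    [cos] *)

Section JacobiFamily.
Context (e : nat) (g0 : R -> R) (Ab : nat -> R) (E1 : nat -> R -> R).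
Hypothesis He : (e <= 1)%nat.
Hypothesis Cg0 : forall x, continuous g0 x.
Hypothesis Hg0_le : forall x, Rabs (g0 x) <= 1.
Hypothesis Hg0_neq0 : forall x, 0 < x < PI / 2 -> g0 x <> 0.
Hypothesis HE : forall p, ellD2 k (fun x => sin x ^ p * g0 x) (E1 p)
  (fun x => INR p * INR (p - 1) * (sin x ^ (p - 2) * g0 x)
            + - Ab p * (sin x ^ p * g0 x)
            + k ^ 2 * INR (p + 1) * INR (p + 2) * (sin x ^ (p + 2) * g0 x)).

Let g := fun x => sin x ^ e * g0 x.
Let al := fun n => k * INR (2 * n + e) * (INR (2 * n + e) - 1).

Context (C0 : R) (h : nat -> R).
Hypothesis HC0 : 0 < C0.
Hypothesis Hh : forall n, h n = C0 * ellInt k (fun x => k ^ n * sin x ^ (2 * n) * (g x * g x)).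

Context (m0 : nat) (w : nat -> R) (f f1 : nat -> R -> R).
Hypothesis Hf : forall m, ellD2 k (f m) (f1 m) (fun x => - w m ^ 2 * f m x).
Hypothesis Hf_abs : forall m x, Rabs (f m x) <= 1.
Hypothesis Hb0 : forall l m, f1 l 0 * f m 0 - f l 0 * f1 m 0 = 0.
Hypothesis Hb1 : forall l m, f1 l (PI / 2) * f m (PI / 2) - f l (PI / 2) * f1 m (PI / 2) = 0.
Hypothesis HB0 : forall m n, E1 (2 * n + e)%nat 0 * f m 0 - (sin 0 ^ (2 * n + e) * g0 0) * f1 m 0 = 0.
Hypothesis HB1 : forall m n, E1 (2 * n + e)%nat (PI / 2) * f m (PI / 2)
  - (sin (PI / 2) ^ (2 * n + e) * g0 (PI / 2)) * f1 m (PI / 2) = 0.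
Hypothesis Hw0 : forall m, 0 <= w m.
Hypothesis Hw : forall m, w m < w (S m).
Hypothesis Hcos : forall m, (m0 <= m)%nat -> exists m' eps, (m0 <= m')%nat /\
  forall x, 2 * cos (PI / K * ellF k x) * f m x = f (S m) x + eps * f m' x.
Hypothesis Hfm0 : forall x, 0 < x < PI / 2 -> f m0 x <> 0.

Lemma w_increasing (l m : nat) : (l < m)%nat -> w l < w m.
Proof.
  induction 1; [apply Hw|]. specialize (Hw m). lra.
Qed.

Lemma w_sqr_inj (l m : nat) : l <> m -> w l ^ 2 <> w m ^ 2.
Proof.
  intros D E. pose proof (Hw0 l). pose proof (Hw0 m).
  destruct (Nat.lt_gt_cases l m) as [[L|L] _]; auto; apply w_increasing in L; nra.
Qed.

Lemma continuous_g (x : R) : continuous g x.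
Proof. now apply continuous_sin_pow_mult. Qed.

Lemma coef_moment (m n : nat) :
  coef k g f m n = k ^ n * ellInt k (fun x => (sin x ^ (2 * n + e) * g0 x) * f m x).
Proof.
  unfold coef. rewrite <- ellInt_scal; auto.
  - apply ellInt_ext. intros x. unfold basis, g. rewrite pow_add. ring.
  - intros x. apply cont_mult; [now apply continuous_sin_pow_mult|].
    exact (ellD_continuous _ _ _ (proj1 (Hf m)) x).
Qed.

(** Multiplying the relation for [p = 2 n + e] by [k ^ n] distributes the powers of [k] so that the
    outer coefficients become the symmetric pair [al n], [al (S n)]. *)
Lemma coef_rec (m n : nat) :
  al n * coef k g f m (n - 1) - Ab (2 * n + e) * coef k g f m n + al (S n) * coef k g f m (S n)
  = - w m ^ 2 * coef k g f m n.
Proof.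
  assert (Cp : forall p x, continuous (fun x => sin x ^ p * g0 x) x)
    by (intros; now apply continuous_sin_pow_mult).
  pose proof (moment_rec k Hk _ _ _ (Hf m) _ _ _ _ _ _ _ _ (HE (2 * n + e))
    (Cp _) (Cp _) (Cp _) (HB1 m n) (HB0 m n)) as H.
  cbv beta in H. rewrite !coef_moment.
  replace (2 * S n + e)%nat with (2 * n + e + 2)%nat by lia.
  set (J := fun p => ellInt k (fun x => (sin x ^ p * g0 x) * f m x)) in *.
  change (ellInt k (fun x => sin x ^ (2 * n + e - 2) * g0 x * f m x)) with (J (2 * n + e - 2)%nat) in H.
  change (ellInt k (fun x => sin x ^ (2 * n + e + 2) * g0 x * f m x)) with (J (2 * n + e + 2)%nat) in *.
  change (ellInt k (fun x => sin x ^ (2 * n + e) * g0 x * f m x)) with (J (2 * n + e)%nat) in *.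
  change (ellInt k (fun x => sin x ^ (2 * (n - 1) + e) * g0 x * f m x)) with (J (2 * (n - 1) + e)%nat).
  unfold al. replace (2 * S n + e)%nat with (2 * n + e + 2)%nat by lia.
  replace (- w m ^ 2 * (k ^ n * J (2 * n + e)%nat)) with (k ^ n * (- w m ^ 2 * J (2 * n + e)%nat)) by ring.
  rewrite <- H. rewrite !(plus_INR (2 * n + e)). simpl (INR 2). simpl (INR 1). simpl pow.
  destruct n as [|n].
  - assert (E0 : INR (2 * 0 + e) * (INR (2 * 0 + e) - 1) = 0).
    { destruct e as [|[|e']]; [simpl; ring | simpl; ring | lia]. }
    assert (E0' : INR (2 * 0 + e) * INR (2 * 0 + e - 1) = 0).
    { destruct e as [|[|e']]; [simpl; ring | simpl; ring | lia]. }
    rewrite !(Rmult_assoc k (INR (2 * 0 + e))), E0, E0'. simpl pow. ring.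
  - replace (2 * (S n - 1) + e)%nat with (2 * S n + e - 2)%nat by lia.
    rewrite (minus_INR (2 * S n + e) 1) by lia. simpl (INR 1).
    replace (S n - 1)%nat with n by lia. simpl pow. ring.
Qed.

Context (L V : nat -> R).
Hypothesis HL : forall m, (m0 <= m)%nat ->
  filterlim (fun x => f m x / g x) (at_right 0) (locally (L m)).
Hypothesis HL0 : forall m, (m0 <= m)%nat -> L m <> 0.
Hypothesis HV : forall m, (m0 <= m)%nat -> ellInt k (fun x => g x * f m x) = V m.
Hypothesis HV0 : forall m, (m0 <= m)%nat -> V m <> 0.
Hypothesis Hnf : forall m, (m0 <= m)%nat -> ellInt k (fun x => f m x * f m x) <> 0.
Context (a b : nat -> R) (nu : nat -> R) (Psi : nat -> nat -> R) (N : nat -> R).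
Hypothesis Ha : forall n, a n = Ab (2 * n + e)%nat.
Hypothesis Hb : forall n, b n = al n ^ 2.
Hypothesis Hnu : forall m, (m0 <= m)%nat -> nu m = C0 * (V m / L m).
Hypothesis Hdecr : forall m, (m0 <= m)%nat -> nu (S m) < nu m.
Hypothesis HPsi : forall m n, (m0 <= m)%nat ->
  Psi m n = (-1) ^ n / (k ^ n * INR (fact (2 * n + e))) * monic_rec a b (w m ^ 2) n.
Hypothesis HN : forall m, (m0 <= m)%nat ->
  N m = ellInt k (fun x => f m x * f m x) / (L m * V m).

Lemma jacobi_family_spectral_data : has_spectral_data (hankel h) m0 nu Psi N.
Proof.
  assert (Hc0 : forall m, (m0 <= m)%nat -> coef k g f m 0 = V m).
  { intros m Hm. rewrite <- HV by auto. apply ellInt_ext. intros x. unfold basis. simpl. ring. }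
  assert (Hgle : forall x, Rabs (g x) <= 1).
  { intros x. unfold g. rewrite Rabs_mult, <- RPow_abs.
    assert (0 <= Rabs (sin x) ^ e <= 1).
    { split; [apply pow_le, Rabs_pos|]. rewrite <- (pow1 e). apply pow_incr.
      split; [apply Rabs_pos | apply Rabs_le, SIN_bound]. }
    specialize (Hg0_le x). pose proof (Rabs_pos (g0 x)). nra. }
  assert (Hgneq : forall x, 0 < x < PI / 2 -> g x <> 0).
  { intros x Hx. unfold g. apply Rmult_integral_contrapositive_currified; auto.
    apply pow_nonzero, Rgt_not_eq, sin_gt_0; lra. }
  apply (family_spectral_data k Hk g continuous_g Hgle Hgneq C0 h HC0 Hh m0 w f f1 Hf Hb0 Hb1
    (fun l m _ _ => w_sqr_inj l m) Hcos Hfm0 Hf_abs al (fun n => Ab (2 * n + e)%nat)) with (L := L); auto.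
  - unfold al. destruct e as [|[|e']]; [simpl; ring | simpl; ring | lia].
  (* With [A = 2 (n + 1) + e], both [A] and [A - 1] are at most [3 (n + 1)], whence the 9. *)
  - intros n. unfold al. rewrite plus_INR, mult_INR, (S_INR n). change (INR 2) with 2. pose proof (pos_INR n).
    assert (0 <= INR e <= 1) by (split; [apply pos_INR | apply (le_INR e 1), He]).
    set (x := INR n) in *. set (y := INR e) in *.
    assert (HA : 0 < 2 * (x + 1) + y <= 3 * (x + 1)) by lra.
    assert (HB : 0 < 2 * (x + 1) + y - 1 <= 3 * (x + 1)) by lra.
    set (A := 2 * (x + 1) + y) in *. rewrite Rmult_assoc.
    assert (0 < A * (A - 1)) by (apply Rmult_lt_0_compat; lra).
    assert (A * (A - 1) <= 3 * (x + 1) * (3 * (x + 1))) by (apply Rmult_le_compat; lra).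
    split; [apply Rmult_lt_0_compat; lra | nra].
  - intros m n _. apply coef_rec.
  - intros m Hm. rewrite Hc0; auto.
  - intros m Hm. rewrite Hc0; auto.
  - intros m Hm. rewrite HPsi by auto.
    destruct e as [|[|e']]; [simpl; field | simpl; field | lia].
  - intros m n Hm. rewrite !HPsi, <- Ha by auto.
    apply (normalized_rec k (w m ^ 2) e a b n); auto. lra.
  - intros m Hm. rewrite Hc0; auto.
Qed.
End JacobiFamily.
End Instances.

(** * Trigonometric functions of the elliptic integral *)

Lemma sin_INR_PI (m : nat) : sin (INR m * PI) = 0.
Proof.
  induction m as [|m IH]; [simpl; rewrite Rmult_0_l; apply sin_0|].
  rewrite S_INR. replace ((INR m + 1) * PI) with (INR m * PI + PI) by ring.
  rewrite neg_sin, IH. ring.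
Qed.

Lemma cos_odd_half_PI (m : nat) : cos ((2 * INR m + 1) * PI / 2) = 0.
Proof.
  induction m as [|m IH].
  - simpl. replace ((2 * 0 + 1) * PI / 2) with (PI / 2) by field. apply cos_PI2.
  - rewrite S_INR. replace ((2 * (INR m + 1) + 1) * PI / 2) with ((2 * INR m + 1) * PI / 2 + PI) by field.
    rewrite neg_cos, IH. ring.
Qed.

Lemma cosh_increasing (x y : R) : 0 <= x < y -> cosh x < cosh y.
Proof.
  intros H. unfold cosh. rewrite !exp_Ropp.
  assert (1 <= exp x) by (pose proof (exp_ineq1_le x); lra).
  assert (exp x < exp y) by (apply exp_increasing; lra).
  set (a := exp x) in *. set (b := exp y) in *.
  assert (0 < (b - a) * (1 - / (a * b))).
  { apply Rmult_lt_0_compat; [lra|].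
    assert (/ (a * b) < 1); [|lra]. rewrite <- Rinv_1. apply Rinv_lt_contravar; nra. }
  replace ((b - a) * (1 - / (a * b))) with (b + / b - (a + / a)) in * by (field; lra). lra.
Qed.

Lemma cosh_exp_quotient (x : R) : exp (- x) / (1 + exp (- x) ^ 2) = / (2 * cosh x).
Proof.
  unfold cosh. rewrite exp_Ropp. pose proof (exp_pos x). field.
  assert (0 < exp x ^ 2) by nra. split; lra.
Qed.

Lemma exp_INR_mult (n : nat) (x : R) : exp x ^ n = exp (INR n * x).
Proof.
  induction n as [|n IH]; [simpl; now rewrite Rmult_0_l, exp_0|].
  rewrite S_INR. simpl. rewrite IH, <- exp_plus. f_equal. ring.
Qed.

Lemma filterlim_difference_quotient (f : R -> R) (l : R) :
  f 0 = 0 -> is_derive f 0 l -> filterlim (fun x => f x / x) (at_right 0) (locally l).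
Proof.
  intros H0 H. apply is_derive_Reals in H. intros P [e He].
  destruct (H e (cond_pos e)) as [d Hd].
  exists d. intros y Hy Hy0. apply He.
  unfold ball in Hy |- *; simpl in Hy |- *; unfold AbsRing_ball, abs, minus, plus, opp in Hy |- *; simpl in Hy |- *.
  rewrite Ropp_0, Rplus_0_r in Hy.
  specialize (Hd y ltac:(lra) Hy). rewrite Rplus_0_l, H0, Rminus_0_r in Hd. exact Hd.
Qed.

Section EllipticIntegrals.
Context (k : R).
Hypothesis Hk : 0 < k < 1.
Let K := ellF k (PI / 2).

Lemma ellInt_const1 : ellInt k (fun _ => 1) = K.
Proof. apply RInt_ext. intros; Rfield. now apply Delta_neq0. Qed.

Lemma continuous_cos_ellF (w x : R) : continuous (fun x => cos (w * ellF k x)) x.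
Proof. exact (ellD_continuous _ _ _ (proj1 (ellD2_cos_ellF k Hk w)) x). Qed.

Lemma continuous_sin_ellF (w x : R) : continuous (fun x => sin (w * ellF k x)) x.
Proof. exact (ellD_continuous _ _ _ (proj1 (ellD2_sin_ellF k Hk w)) x). Qed.

Hint Resolve continuous_cos_ellF continuous_sin_ellF : cont.

Lemma ellInt_cos_sqr (w : R) : w <> 0 -> sin (2 * w * K) = 0 ->
  ellInt k (fun x => cos (w * ellF k x) * cos (w * ellF k x)) = K / 2.
Proof.
  intros Hw HS.
  unfold ellInt.
  rewrite (RInt_of_derive (fun x => / 2 * ellF k x + / (4 * w) * sin (2 * w * ellF k x))).
  - fold K. rewrite HS, ellF_0, !Rmult_0_r, sin_0. Rfield. auto.
  - intros x. eapply is_derive_eq.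
    + apply (is_derive_plus (fun x => / 2 * ellF k x) (fun x => / (4 * w) * sin (2 * w * ellF k x))).
      * apply (is_derive_scal (ellF k) x (/ 2)). now apply is_derive_ellF.
      * apply (is_derive_scal (fun x => sin (2 * w * ellF k x)) x (/ (4 * w))).
        apply (proj1 (ellD2_sin_ellF k Hk (2 * w))).
    + unfold plus; simpl. replace (2 * w * ellF k x) with (2 * (w * ellF k x)) by ring.
      rewrite cos_2a_cos. field. split; auto. now apply Delta_neq0.
  - cont.
Qed.

Lemma ellInt_sin_sqr (w : R) : w <> 0 -> sin (2 * w * K) = 0 ->
  ellInt k (fun x => sin (w * ellF k x) * sin (w * ellF k x)) = K / 2.
Proof.
  intros Hw HS.
  rewrite (ellInt_ext k _ (fun x => 1 * 1 + -1 * (cos (w * ellF k x) * cos (w * ellF k x)))).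
  - rewrite (ellInt_lin k Hk (fun _ => 1)).
    + rewrite ellInt_const1, ellInt_cos_sqr by auto. field.
    + cont.
    + cont.
  - intros x. pose proof (sin2_cos2 (w * ellF k x)) as E. unfold Rsqr in E. lra.
Qed.

Lemma ellInt_by_parts (E E1 f f1 : R -> R) : ellD k E E1 -> ellD k f f1 ->
  (forall x, continuous E1 x) -> (forall x, continuous f1 x) ->
  ellInt k (fun x => E1 x * f x) + ellInt k (fun x => E x * f1 x)
  = E (PI / 2) * f (PI / 2) - E 0 * f 0.
Proof.
  intros HE Hf CE1 Cf1.
  pose proof (ellD_continuous _ _ _ HE) as CE. pose proof (ellD_continuous _ _ _ Hf) as Cf.
  assert (H : RInt (fun x => (1 * (E1 x * f x) + 1 * (E x * f1 x)) / Delta k x) 0 (PI / 2)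
    = (fun x => E x * f x) (PI / 2) - (fun x => E x * f x) 0).
  { apply (RInt_of_derive (fun x => E x * f x)); [|cont].
    intros x. eapply is_derive_eq; [apply (ellD_mult k Hk _ _ _ _ HE Hf)|]. simpl. field.
    now apply Delta_neq0. }
  change (ellInt k (fun x => 1 * (E1 x * f x) + 1 * (E x * f1 x)) = E (PI / 2) * f (PI / 2) - E 0 * f 0) in H.
  rewrite ellInt_lin in H by (auto; cont). lra.
Qed.

Let kc := sqrt (1 - k ^ 2).
Let K' := ellF kc (PI / 2).

Lemma K'_pos : 0 < K'.
Proof.
  pose proof PI_RGT_0. unfold K'. apply ellF_pos; [apply kc_bounds; auto | lra].
Qed.

Lemma nome_exp : nome k = exp (- (PI * K' / K)).
Proof. reflexivity. Qed.

(** Rewrites the nome expressions of the eigenvalues as the reciprocals of [cosh (w K')] that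
    [dn_fourier] and [cn_fourier] produce. *)
Lemma nome_quotient_even (m : nat) :
  nome k ^ m / (1 + nome k ^ (2 * m)) = / (2 * cosh (INR m * PI / K * K')).
Proof.
  rewrite <- cosh_exp_quotient. rewrite nome_exp, !exp_INR_mult, mult_INR.
  change (INR 2) with 2. pose proof (K_pos k Hk). unfold K.
  assert (E : INR m * - (PI * K' / ellF k (PI / 2)) = - (INR m * PI / ellF k (PI / 2) * K')) by (field; lra).
  f_equal; [now rewrite E|]. f_equal. now rewrite Rmult_assoc, E.
Qed.

Lemma nome_quotient_odd (m : nat) :
  Rpower (nome k) (INR m + 1 / 2) / (1 + nome k ^ (2 * m + 1))
  = / (2 * cosh ((2 * INR m + 1) * PI / (2 * K) * K')).
Proof.
  rewrite <- cosh_exp_quotient. unfold Rpower. rewrite nome_exp, ln_exp, !exp_INR_mult, plus_INR, mult_INR.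
  change (INR 2) with 2. change (INR 1) with 1. pose proof (K_pos k Hk). unfold K.
  assert (E : (INR m + 1 / 2) * - (PI * K' / ellF k (PI / 2))
    = - ((2 * INR m + 1) * PI / (2 * ellF k (PI / 2)) * K')) by (field; lra).
  f_equal; [now rewrite E|]. f_equal. f_equal. rewrite <- E. field. lra.
Qed.
End EllipticIntegrals.
Hint Resolve continuous_cos_ellF continuous_sin_ellF : cont.

Section Frequencies.
Context (k : R).
Hypothesis Hk : 0 < k < 1.
Let K := ellF k (PI / 2).
Let kc := sqrt (1 - k ^ 2).
Let K' := ellF kc (PI / 2).

(** On [[0, K]], the cosines of these frequencies satisfy Neumann conditions at both ends (case r)
    and the sines Dirichlet conditions at both ends (case s). *)
Definition freq_even (m : nat) : R := INR m * PI / K.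
(** Mixed conditions: the cosines vanish at [K] and have zero derivative at 0 (case p), the sines
    the other way round (case q). *)
Definition freq_odd (m : nat) : R := (2 * INR m + 1) * PI / (2 * K).

Lemma sin_freq_even (m : nat) : sin (freq_even m * K) = 0.
Proof.
  pose proof (K_pos k Hk) as HK. fold K in HK. unfold freq_even.
  replace (INR m * PI / K * K) with (INR m * PI) by (field; lra). apply sin_INR_PI.
Qed.

Lemma cos_freq_odd (m : nat) : cos (freq_odd m * K) = 0.
Proof.
  pose proof (K_pos k Hk) as HK. fold K in HK. unfold freq_odd.
  replace ((2 * INR m + 1) * PI / (2 * K) * K) with ((2 * INR m + 1) * PI / 2) by (field; lra).
  apply cos_odd_half_PI.
Qed.

Lemma sin_2_freq_even (m : nat) : sin (2 * freq_even m * K) = 0.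
Proof.
  replace (2 * freq_even m * K) with (2 * (freq_even m * K)) by ring.
  rewrite sin_2a, sin_freq_even. ring.
Qed.

Lemma sin_2_freq_odd (m : nat) : sin (2 * freq_odd m * K) = 0.
Proof.
  replace (2 * freq_odd m * K) with (2 * (freq_odd m * K)) by ring.
  rewrite sin_2a, cos_freq_odd. ring.
Qed.

Lemma freq_even_ge0 (m : nat) : 0 <= freq_even m.
Proof.
  pose proof (K_pos k Hk) as HK. fold K in HK. pose proof PI_RGT_0. pose proof (pos_INR m).
  apply Rdiv_le_0_compat; nra.
Qed.

Lemma freq_even_pos (m : nat) : (1 <= m)%nat -> 0 < freq_even m.
Proof.
  intros Hm. pose proof (K_pos k Hk) as HK. fold K in HK. pose proof PI_RGT_0.
  pose proof (le_INR 1 m Hm) as H1. simpl in H1. apply Rdiv_lt_0_compat; nra.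
Qed.

Lemma freq_odd_pos (m : nat) : 0 < freq_odd m.
Proof.
  pose proof (K_pos k Hk) as HK. fold K in HK. pose proof PI_RGT_0. pose proof (pos_INR m).
  apply Rdiv_lt_0_compat; nra.
Qed.

Lemma freq_even_S (m : nat) : freq_even (S m) = freq_even m + PI / K.
Proof. unfold freq_even. rewrite S_INR. field. apply Rgt_not_eq, (K_pos k Hk). Qed.

Lemma freq_odd_S (m : nat) : freq_odd (S m) = freq_odd m + PI / K.
Proof. unfold freq_odd. rewrite S_INR. field. apply Rgt_not_eq, (K_pos k Hk). Qed.

Lemma freq_step_pos : 0 < PI / K.
Proof. apply Rdiv_lt_0_compat; [apply PI_RGT_0 | apply (K_pos k Hk)]. Qed.

Lemma quotient_decr (c x y : R) : 0 < c -> 0 <= x < y -> c * / (2 * cosh (y * K')) < c * / (2 * cosh (x * K')).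
Proof.
  intros Hc H. apply Rmult_lt_compat_l; auto. pose proof (K'_pos k Hk) as HK'. fold kc K' in HK'.
  pose proof (cosh_gt0 (x * K')). assert (cosh (x * K') < cosh (y * K')) by (apply cosh_increasing; nra).
  apply Rinv_lt_contravar; nra.
Qed.

Lemma product_cos_cos (w x : R) :
  2 * cos (PI / K * ellF k x) * cos (w * ellF k x)
  = cos ((w + PI / K) * ellF k x) + cos ((w - PI / K) * ellF k x).
Proof. rewrite Rmult_plus_distr_r, Rmult_minus_distr_r, cos_plus, cos_minus. ring. Qed.

Lemma product_cos_sin (w x : R) :
  2 * cos (PI / K * ellF k x) * sin (w * ellF k x)
  = sin ((w + PI / K) * ellF k x) + sin ((w - PI / K) * ellF k x).
Proof. rewrite Rmult_plus_distr_r, Rmult_minus_distr_r, sin_plus, sin_minus. ring. Qed.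

Lemma ellF_inside (x : R) : 0 < x < PI / 2 -> 0 < ellF k x < K.
Proof. intros Hx. split; [apply ellF_pos; tauto | apply ellF_increasing; tauto]. Qed.

Lemma ellF_fraction (x : R) : 0 < x < PI / 2 -> 0 < PI * (ellF k x / K) < PI.
Proof.
  intros Hx. pose proof (ellF_inside x Hx). pose proof PI_RGT_0.
  assert (0 < ellF k x / K < 1).
  { split; [apply Rdiv_lt_0_compat; lra | apply Rlt_div_l; lra]. }
  nra.
Qed.

Lemma Rabs_cos_le1 (x : R) : Rabs (cos x) <= 1.
Proof. apply Rabs_le, COS_bound. Qed.

Lemma Rabs_sin_le1 (x : R) : Rabs (sin x) <= 1.
Proof. apply Rabs_le, SIN_bound. Qed.

Lemma Rabs_Delta_le1 (x : R) : Rabs (Delta k x) <= 1.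
Proof. rewrite Rabs_pos_eq; [now apply Delta_le1 | left; now apply Delta_pos]. Qed.

Lemma cos_neq0_inside (x : R) : 0 < x < PI / 2 -> cos x <> 0.
Proof. intros Hx. apply Rgt_not_eq, cos_gt_0; lra. Qed.

Lemma even_pow_boundary (n : nat) : INR (2 * n + 0) * 0 ^ (2 * n + 0 - 1) = 0.
Proof.
  destruct n as [|n]; [simpl; ring|].
  replace (2 * S n + 0 - 1)%nat with (S (2 * n)) by lia. simpl. ring.
Qed.

Lemma odd_pow_boundary (n : nat) : 0 ^ (2 * n + 1) = 0.
Proof. rewrite Nat.add_1_r. simpl. ring. Qed.

Lemma ratio_limit_cos (w : R) (g0 : R -> R) : (forall x, continuous g0 x) -> g0 0 = 1 ->
  filterlim (fun x => cos (w * ellF k x) / (sin x ^ 0 * g0 x)) (at_right 0) (locally 1).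
Proof.
  intros C H0.
  assert (A : continuous (fun x => cos (w * ellF k x) / (sin x ^ 0 * g0 x)) 0).
  { apply cont_mult; [now apply continuous_cos_ellF|].
    apply continuous_Rinv_comp; [now apply continuous_sin_pow_mult|].
    rewrite H0. simpl. lra. }
  apply continuous_at_right in A. cbv beta in A.
  rewrite H0, ellF_0, Rmult_0_r, cos_0 in A. simpl in A.
  replace (1 / (1 * 1)) with 1 in A by field. exact A.
Qed.

(** To first order at 0, [ellF k x] and [sin x] both equal [x], so the quotient tends to the
    frequency. *)
Lemma ratio_limit_sin (w : R) (g0 : R -> R) : (forall x, continuous g0 x) -> g0 0 = 1 ->
  filterlim (fun x => sin (w * ellF k x) / (sin x ^ 1 * g0 x)) (at_right 0) (locally w).
Proof.
  intros C H0.
  assert (A : filterlim (fun x => sin (w * ellF k x) / x) (at_right 0) (locally w)).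
  { apply filterlim_difference_quotient.
    - rewrite ellF_0, Rmult_0_r. apply sin_0.
    - eapply is_derive_eq; [apply (proj1 (ellD2_sin_ellF k Hk w))|].
      rewrite ellF_0, Rmult_0_r, cos_0, Delta_0. field. }
  assert (B : filterlim (fun x => sin x / x) (at_right 0) (locally 1)).
  { apply filterlim_difference_quotient; [apply sin_0|]. rewrite <- cos_0. apply is_derive_sin. }
  assert (D : filterlim g0 (at_right 0) (locally 1)) by (rewrite <- H0; now apply continuous_at_right).
  assert (E : filterlim (fun x => sin x / x * g0 x) (at_right 0) (locally (1 * 1))).
  { apply (filterlim_comp_2 (F := at_right 0) (fun x => sin x / x) g0 Rmult (G := locally 1) (H := locally 1)); auto.
    apply (filterlim_mult (K := R_AbsRing)). }
  assert (E' : filterlim (fun x => / (sin x / x * g0 x)) (at_right 0) (locally (/ (1 * 1)))).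
  { apply (filterlim_comp _ _ _ (fun x => sin x / x * g0 x) Rinv _ (locally (1 * 1))); auto.
    apply continuous_Rinv. lra. }
  assert (F : filterlim (fun x => sin (w * ellF k x) / x * / (sin x / x * g0 x)) (at_right 0) (locally (w * / (1 * 1)))).
  { apply (filterlim_comp_2 (F := at_right 0) (fun x => sin (w * ellF k x) / x) (fun x => / (sin x / x * g0 x))
      Rmult (G := locally w) (H := locally (/ (1 * 1)))); auto.
    apply (filterlim_mult (K := R_AbsRing)). }
  replace (w * / (1 * 1)) with w in F by field.
  apply (filterlim_ext_loc (F := at_right 0) (fun x => sin (w * ellF k x) / x * / (sin x / x * g0 x))); auto.
  apply filter_imp with (2 := at_right_in 0 PI PI_RGT_0). intros x Hx.
  assert (sin x <> 0) by (apply Rgt_not_eq, sin_gt_0; lra).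
  (* [g0] may vanish somewhere in [(0, PI)], as [cos] does, so [/ g0 x] is treated as an atom; the
     identity holds at such points too, inversion being total. *)
  unfold Rdiv. rewrite pow_1, !Rinv_mult, Rinv_inv. generalize (/ g0 x). intros y. field. lra.
Qed.

(** As [sn dn] is minus the derivative of [cn], integration by parts reduces the sine coefficient to
    [cn_fourier]. The boundary terms vanish by [cn(K) = 0] and [sin 0 = 0]. *)
Lemma coef0_q (w : R) : cos (w * K) = 0 ->
  ellInt k (fun x => sin x ^ 1 * Delta k x * sin (w * ellF k x)) = w * (PI / (2 * k * cosh (w * K'))).
Proof.
  intros Hw. unfold K', kc. rewrite <- (cn_fourier k Hk w Hw).
  pose proof (ellInt_by_parts k Hk cos (fun x => - sin x * Delta k x) (fun x => sin (w * ellF k x))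
    (fun x => w * cos (w * ellF k x)) (proj1 (ellD2_cos k Hk)) (proj1 (ellD2_sin_ellF k Hk w))) as E.
  cbv beta in E. rewrite cos_PI2, ellF_0, !Rmult_0_r, sin_0 in E.
  rewrite (ellInt_ext k (fun x => - sin x * Delta k x * sin (w * ellF k x))
    (fun x => -1 * (sin x ^ 1 * Delta k x * sin (w * ellF k x)))) in E by (intros; ring).
  rewrite (ellInt_ext k (fun x => cos x * (w * cos (w * ellF k x)))
    (fun x => w * (cos x * cos (w * ellF k x)))) in E by (intros; ring).
  rewrite !ellInt_scal in E; auto.
  - assert (-1 * ellInt k (fun x => sin x ^ 1 * Delta k x * sin (w * ellF k x))
      + w * ellInt k (fun x => cos x * cos (w * ellF k x)) = 0); [|lra].
    rewrite E; [ring | |]; [|cont].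
    intros x. apply (cont_ext (fun x => -1 * (sin x ^ 1 * Delta k x))); [intros; ring | cont].
  - cont.
  - cont.
Qed.

(** As [k^2 sn cn] is minus the derivative of [dn], this reduces to [dn_fourier] and picks up the
    factor [1 / k^2]. At [K] the boundary term vanishes by the choice of [w]. *)
Lemma coef0_s (w : R) : sin (w * K) = 0 ->
  ellInt k (fun x => sin x ^ 1 * cos x * sin (w * ellF k x)) = w / k ^ 2 * (PI / (2 * cosh (w * K'))).
Proof.
  intros Hw. unfold K', kc. rewrite <- (dn_fourier k Hk w Hw).
  pose proof (ellInt_by_parts k Hk (Delta k) (fun x => - k ^ 2 * sin x * cos x) (fun x => sin (w * ellF k x))
    (fun x => w * cos (w * ellF k x)) (proj1 (ellD2_Delta k Hk)) (proj1 (ellD2_sin_ellF k Hk w))) as E.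
  cbv beta in E. fold K in E. rewrite Hw, ellF_0, !Rmult_0_r, sin_0 in E.
  rewrite (ellInt_ext k (fun x => - k ^ 2 * sin x * cos x * sin (w * ellF k x))
    (fun x => - k ^ 2 * (sin x ^ 1 * cos x * sin (w * ellF k x)))) in E by (intros; ring).
  rewrite (ellInt_ext k (fun x => Delta k x * (w * cos (w * ellF k x)))
    (fun x => w * (Delta k x * cos (w * ellF k x)))) in E by (intros; ring).
  rewrite !ellInt_scal in E; auto.
  - assert (E' : - k ^ 2 * ellInt k (fun x => sin x ^ 1 * cos x * sin (w * ellF k x))
      + w * ellInt k (fun x => Delta k x * cos (w * ellF k x)) = 0).
    { rewrite E; [ring | |]; [|cont].
      intros x. apply (cont_ext (fun x => - k ^ 2 * (sin x ^ 1 * cos x))); [intros; ring | cont]. }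
    assert (0 < k ^ 2) by nra.
    apply Rmult_eq_reg_l with (k ^ 2); [|lra].
    transitivity (w * ellInt k (fun x => Delta k x * cos (w * ellF k x))); [lra | field; lra].
  - cont.
  - cont.
Qed.
End Frequencies.

(** * The four spectra *)

Section Spectra.
Context (k : R).
Hypothesis Hk : 0 < k < 1.
Let K := ellK k.
Let q := nome k.

Lemma freq_even_sqr (m : nat) : freq_even k m ^ 2 = PI ^ 2 * INR m ^ 2 / K ^ 2.
Proof. unfold freq_even. change (ellF k (PI / 2)) with K. field. apply Rgt_not_eq, (K_pos k Hk). Qed.

Lemma freq_odd_sqr (m : nat) : freq_odd k m ^ 2 = PI ^ 2 * (2 * INR m + 1) ^ 2 / (4 * K ^ 2).
Proof. unfold freq_odd. change (ellF k (PI / 2)) with K. field. apply Rgt_not_eq, (K_pos k Hk). Qed.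

Lemma freq_even_0 : freq_even k 0 = 0.
Proof. unfold freq_even. simpl INR. unfold Rdiv. ring. Qed.

Lemma freq_even_lt (m : nat) : freq_even k m < freq_even k (S m).
Proof. rewrite freq_even_S by auto. pose proof (freq_step_pos k Hk). lra. Qed.

Lemma freq_odd_lt (m : nat) : freq_odd k m < freq_odd k (S m).
Proof. rewrite freq_odd_S by auto. pose proof (freq_step_pos k Hk). lra. Qed.

Lemma div_sqrt_PI_pos (c : R) : 0 < c -> 0 < c / sqrt PI.
Proof. intros H. apply Rdiv_lt_0_compat; auto using sqrt_PI_pos. Qed.

Lemma half_PI_quotient (c x : R) : c / sqrt PI * (PI / (2 * x)) = c * sqrt PI / (2 * x).
Proof.
  destruct (Req_dec x 0) as [->|Hx].
  - rewrite Rmult_0_r. unfold Rdiv. rewrite Rinv_0. ring.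
  - rewrite <- sqrt_PI_sqr at 2. pose proof sqrt_PI_pos. field. lra.
Qed.

Lemma ellInt_moment_dn (n e : nat) :
  ellInt k (fun x => k ^ n * sin x ^ (2 * n) * ((sin x ^ e * Delta k x) * (sin x ^ e * Delta k x)))
  = k ^ n * moment_dn k (n + e).
Proof.
  rewrite (ellInt_ext k _ (fun x => k ^ n * (sin x ^ (2 * (n + e)) * Delta k x * Delta k x))).
  - rewrite ellInt_scal by (auto; cont). f_equal. apply RInt_ext. intros x _. Rfield. now apply Delta_neq0.
  - intros. replace (2 * (n + e))%nat with (2 * n + e + e)%nat by lia. rewrite !pow_add. ring.
Qed.

Lemma ellInt_moment_cn (n e : nat) :
  ellInt k (fun x => k ^ n * sin x ^ (2 * n) * ((sin x ^ e * cos x) * (sin x ^ e * cos x)))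
  = k ^ n * moment_cn k (n + e).
Proof.
  rewrite (ellInt_ext k _ (fun x => k ^ n * (sin x ^ (2 * (n + e)) * cos x * cos x))).
  - rewrite ellInt_scal by (auto; cont). f_equal. apply RInt_ext. intros x _. Rfield. now apply Delta_neq0.
  - intros. replace (2 * (n + e))%nat with (2 * n + e + e)%nat by lia. rewrite !pow_add. ring.
Qed.

Lemma h_r_ellInt (n : nat) :
  h_r k n = 2 / sqrt PI * ellInt k (fun x => k ^ n * sin x ^ (2 * n)
              * ((sin x ^ 0 * Delta k x) * (sin x ^ 0 * Delta k x))).
Proof.
  rewrite ellInt_moment_dn, h_r_moment, Nat.add_0_r by auto.
  field. apply Rgt_not_eq, sqrt_PI_pos.
Qed.

Lemma h_p_ellInt (n : nat) :
  h_p k n = 4 / sqrt PI * ellInt k (fun x => k ^ n * sin x ^ (2 * n)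
              * ((sin x ^ 0 * cos x) * (sin x ^ 0 * cos x))).
Proof.
  rewrite ellInt_moment_cn, h_p_moment, Nat.add_0_r by auto.
  field. apply Rgt_not_eq, sqrt_PI_pos.
Qed.

Lemma h_q_ellInt (n : nat) :
  h_q k n = 2 / sqrt PI * ellInt k (fun x => k ^ n * sin x ^ (2 * n)
              * ((sin x ^ 1 * Delta k x) * (sin x ^ 1 * Delta k x))).
Proof.
  rewrite ellInt_moment_dn, h_q_moment, Nat.add_1_r by auto.
  field. apply Rgt_not_eq, sqrt_PI_pos.
Qed.

Lemma h_s_ellInt (n : nat) :
  h_s k n = 4 / sqrt PI * ellInt k (fun x => k ^ n * sin x ^ (2 * n)
              * ((sin x ^ 1 * cos x) * (sin x ^ 1 * cos x))).
Proof.
  rewrite ellInt_moment_cn, h_s_moment, Nat.add_1_r by auto.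
  field. apply Rgt_not_eq, sqrt_PI_pos.
Qed.

Lemma spectral_data_r :
  has_spectral_data (hankel (h_r k)) 0
    (fun m => 2 * sqrt PI * (q ^ m / (1 + q ^ (2 * m))))
    (fun m n => (-1) ^ n / (k ^ n * INR (fact (2 * n)))
                * SC_r k n (PI ^ 2 * INR m ^ 2 / K ^ 2))
    (fun m => (if Nat.eqb m 0 then 2 else 1)
              * (K / (2 * PI) * ((1 + q ^ (2 * m)) / q ^ m))).
Proof.
  pose proof (K_pos k Hk) as HK. change (ellF k (PI / 2)) with K in HK. pose proof PI_RGT_0.
  pose proof (K'_pos k Hk) as HK'.
  set (ch := fun m => cosh (freq_even k m * ellF (sqrt (1 - k ^ 2)) (PI / 2))).
  assert (Hch : forall m, 0 < ch m) by (intros; apply cosh_gt0).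
  assert (Hq : forall m, q ^ m / (1 + q ^ (2 * m)) = / (2 * ch m)) by (intros; now apply nome_quotient_even).
  apply (jacobi_family_spectral_data k Hk 0 (Delta k) (fun p => INR p ^ 2 + k ^ 2 * INR (p + 1) ^ 2) _
    ltac:(lia) (continuous_Delta k Hk) (Rabs_Delta_le1 k Hk) (fun x _ => Delta_neq0 k Hk x)
    (ellD2_sin_pow_Delta k Hk) (2 / sqrt PI) (h_r k) ltac:(apply div_sqrt_PI_pos; lra) h_r_ellInt
    0 (freq_even k) _ _ (fun m => ellD2_cos_ellF k Hk (freq_even k m)) (fun m x => Rabs_cos_le1 _))
    with (L := fun _ => 1) (V := fun m => PI / (2 * ch m))
         (a := fun n => (2 * INR n) ^ 2 + k ^ 2 * (2 * INR n + 1) ^ 2)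
         (b := fun n => k ^ 2 * (2 * INR n) ^ 2 * (2 * INR n - 1) ^ 2); cbv beta.
  - intros l m. rewrite ellF_0, !Rmult_0_r, sin_0. ring.
  - intros l m. rewrite !sin_freq_even by auto. ring.
  - intros m n. rewrite ellF_0, !Rmult_0_r, sin_0, even_pow_boundary. ring.
  - intros m n. rewrite !sin_freq_even, cos_PI2 by auto. ring.
  - now apply freq_even_ge0.
  - apply freq_even_lt.
  - intros m _. destruct m as [|m].
    (* Lowering the frequency 0 by [PI / K] gives a negative frequency; the cosine being even, it is
       reflected to the index 1. *)
    + exists 1%nat, 1. split; [lia|]. intros x. rewrite product_cos_cos, freq_even_S by auto.
      rewrite freq_even_0.
      replace ((0 - PI / ellF k (PI / 2)) * ellF k x) with (- ((0 + PI / ellF k (PI / 2)) * ellF k x)) by ring.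
      rewrite cos_neg. ring.
    + exists m, 1. split; [lia|]. intros x. rewrite product_cos_cos, !freq_even_S by auto.
      rewrite Rplus_minus_r. ring.
  - intros x Hx. rewrite freq_even_0, Rmult_0_l, cos_0. lra.
  - intros m _. apply (ratio_limit_cos k Hk); [now apply continuous_Delta | apply Delta_0].
  - intros; lra.
  - intros m _. rewrite (ellInt_ext k _ (fun x => Delta k x * cos (freq_even k m * ellF k x)))
      by (intros; simpl; ring).
    apply dn_fourier; auto. now apply sin_freq_even.
  - intros m _. apply Rgt_not_eq, Rdiv_lt_0_compat; [lra|]. specialize (Hch m). lra.
  - intros m _. destruct m as [|m].
    + rewrite (ellInt_ext k _ (fun _ => 1)).
      * rewrite ellInt_const1 by auto. apply Rgt_not_eq, HK.
      * intros x. rewrite freq_even_0, Rmult_0_l, cos_0. ring.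
    + rewrite ellInt_cos_sqr; auto.
      * change (ellF k (PI / 2)) with K. lra.
      * pose proof (freq_even_pos k Hk (S m) ltac:(lia)). lra.
      * now apply sin_2_freq_even.
  - intros n. rewrite !plus_INR, mult_INR. change (INR 2) with 2. change (INR 1) with 1. change (INR 0) with 0. ring.
  - intros n. rewrite Nat.add_0_r, mult_INR. change (INR 2) with 2. ring.
  - intros m _. rewrite Hq, Rdiv_1_r, half_PI_quotient. field. specialize (Hch m). lra.
  - intros m _. rewrite !Hq. apply quotient_decr; auto; [pose proof sqrt_PI_pos; lra|].
    split; [now apply freq_even_ge0 | apply freq_even_lt].
  - intros m n _. rewrite Nat.add_0_r, freq_even_sqr. reflexivity.
  - intros m _. assert (Hinv : (1 + q ^ (2 * m)) / q ^ m = 2 * ch m).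
    { rewrite <- (Rinv_inv (2 * ch m)), <- Hq. unfold Rdiv. rewrite Rinv_mult, Rinv_inv. ring. }
    rewrite Hinv. specialize (Hch m). destruct m as [|m].
    (* At frequency 0 the squared norm of [f m] is [K] instead of [K / 2], hence the factor 2 for
       [m = 0]. *)
    + rewrite (ellInt_ext k _ (fun _ => 1)).
      * rewrite ellInt_const1 by auto. change (ellF k (PI / 2)) with K. simpl Nat.eqb. cbv iota. field. lra.
      * intros x. rewrite freq_even_0, Rmult_0_l, cos_0. ring.
    + rewrite ellInt_cos_sqr; auto.
      * change (ellF k (PI / 2)) with K. simpl Nat.eqb. cbv iota. field. lra.
      * pose proof (freq_even_pos k Hk (S m) ltac:(lia)). lra.
      * now apply sin_2_freq_even.
Qed.

Lemma freq_odd_0_inside (x : R) : 0 < x < PI / 2 -> 0 < freq_odd k 0 * ellF k x < PI / 2.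
Proof.
  intros Hx. pose proof (ellF_fraction k Hk x Hx) as H.
  replace (freq_odd k 0 * ellF k x) with (PI * (ellF k x / ellF k (PI / 2)) / 2); [lra|].
  unfold freq_odd. simpl INR. field. apply Rgt_not_eq, (K_pos k Hk).
Qed.

Lemma freq_odd_0_minus : freq_odd k 0 - PI / ellF k (PI / 2) = - freq_odd k 0.
Proof. unfold freq_odd. simpl INR. field. apply Rgt_not_eq, (K_pos k Hk). Qed.

Lemma spectral_data_p :
  has_spectral_data (hankel (h_p k)) 0
    (fun m => 4 * sqrt PI / k * (Rpower q (INR m + 1 / 2) / (1 + q ^ (2 * m + 1))))
    (fun m n => (-1) ^ n / (k ^ n * INR (fact (2 * n)))
                * SC_p k n (PI ^ 2 * (2 * INR m + 1) ^ 2 / (4 * K ^ 2)))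
    (fun m => k * K / (2 * PI) * ((1 + q ^ (2 * m + 1)) / Rpower q (INR m + 1 / 2))).
Proof.
  pose proof (K_pos k Hk) as HK. change (ellF k (PI / 2)) with K in HK. pose proof PI_RGT_0.
  set (ch := fun m => cosh (freq_odd k m * ellF (sqrt (1 - k ^ 2)) (PI / 2))).
  assert (Hch : forall m, 0 < ch m) by (intros; apply cosh_gt0).
  assert (Hq : forall m, Rpower q (INR m + 1 / 2) / (1 + q ^ (2 * m + 1)) = / (2 * ch m))
    by (intros; now apply nome_quotient_odd).
  apply (jacobi_family_spectral_data k Hk 0 cos (fun p => INR (p + 1) ^ 2 + k ^ 2 * INR p ^ 2) _
    ltac:(lia) continuous_cos Rabs_cos_le1 cos_neq0_inside
    (ellD2_sin_pow_cos k Hk) (4 / sqrt PI) (h_p k) ltac:(apply div_sqrt_PI_pos; lra) h_p_ellInt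
    0 (freq_odd k) _ _ (fun m => ellD2_cos_ellF k Hk (freq_odd k m)) (fun m x => Rabs_cos_le1 _))
    with (L := fun _ => 1) (V := fun m => PI / (2 * k * ch m))
         (a := fun n => k ^ 2 * (2 * INR n) ^ 2 + (2 * INR n + 1) ^ 2)
         (b := fun n => k ^ 2 * (2 * INR n) ^ 2 * (2 * INR n - 1) ^ 2); cbv beta.
  - intros l m. rewrite ellF_0, !Rmult_0_r, sin_0. ring.
  - intros l m. rewrite !cos_freq_odd by auto. ring.
  - intros m n. rewrite ellF_0, !Rmult_0_r, sin_0, even_pow_boundary. ring.
  - intros m n. rewrite !cos_freq_odd, cos_PI2 by auto. ring.
  - intros m. left. now apply freq_odd_pos.
  - apply freq_odd_lt.
  - intros m _. destruct m as [|m].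
    + exists 0%nat, 1. split; [lia|]. intros x. rewrite product_cos_cos, freq_odd_S, freq_odd_0_minus by auto.
      rewrite Ropp_mult_distr_l_reverse, cos_neg. ring.
    + exists m, 1. split; [lia|]. intros x. rewrite product_cos_cos, !freq_odd_S by auto.
      rewrite Rplus_minus_r. ring.
  - intros x Hx. apply Rgt_not_eq, cos_gt_0; pose proof (freq_odd_0_inside x Hx); lra.
  - intros m _. apply (ratio_limit_cos k Hk); [apply continuous_cos | apply cos_0].
  - intros; lra.
  - intros m _. rewrite (ellInt_ext k _ (fun x => cos x * cos (freq_odd k m * ellF k x)))
      by (intros; simpl; ring).
    apply cn_fourier; auto. now apply cos_freq_odd.
  - intros m _. specialize (Hch m). apply Rgt_not_eq, Rdiv_lt_0_compat; [lra|].
    apply Rmult_lt_0_compat; lra.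
  - intros m _. rewrite ellInt_cos_sqr; auto.
    + change (ellF k (PI / 2)) with K. lra.
    + apply Rgt_not_eq. now apply freq_odd_pos.
    + now apply sin_2_freq_odd.
  - intros n. rewrite !plus_INR, mult_INR. change (INR 2) with 2. change (INR 1) with 1. change (INR 0) with 0. ring.
  - intros n. rewrite Nat.add_0_r, mult_INR. change (INR 2) with 2. ring.
  - intros m _. rewrite Hq, Rdiv_1_r, (Rmult_assoc 2 k), half_PI_quotient. specialize (Hch m). field. lra.
  - intros m _. rewrite !Hq. pose proof sqrt_PI_pos.
    apply quotient_decr; auto; [apply Rdiv_lt_0_compat; lra|].
    split; [left; now apply freq_odd_pos | apply freq_odd_lt].
  - intros m n _. rewrite Nat.add_0_r, freq_odd_sqr. reflexivity.
  - intros m _. assert (Hinv : (1 + q ^ (2 * m + 1)) / Rpower q (INR m + 1 / 2) = 2 * ch m).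
    { rewrite <- (Rinv_inv (2 * ch m)), <- Hq. unfold Rdiv. rewrite Rinv_mult, Rinv_inv. ring. }
    rewrite Hinv. specialize (Hch m).
    rewrite ellInt_cos_sqr; auto.
    + change (ellF k (PI / 2)) with K. field. repeat split; lra.
    + apply Rgt_not_eq. now apply freq_odd_pos.
    + now apply sin_2_freq_odd.
Qed.

Lemma spectral_data_q :
  has_spectral_data (hankel (h_q k)) 0
    (fun m => 2 * sqrt PI / k * (Rpower q (INR m + 1 / 2) / (1 + q ^ (2 * m + 1))))
    (fun m n => (-1) ^ n / (k ^ n * INR (fact (2 * n + 1)))
                * SC_q k n (PI ^ 2 * (2 * INR m + 1) ^ 2 / (4 * K ^ 2)))
    (fun m => 2 * k * K ^ 3 / PI ^ 3
              * ((1 + q ^ (2 * m + 1)) / ((2 * INR m + 1) ^ 2 * Rpower q (INR m + 1 / 2)))).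
Proof.
  pose proof (K_pos k Hk) as HK. change (ellF k (PI / 2)) with K in HK. pose proof PI_RGT_0.
  set (ch := fun m => cosh (freq_odd k m * ellF (sqrt (1 - k ^ 2)) (PI / 2))).
  assert (Hch : forall m, 0 < ch m) by (intros; apply cosh_gt0).
  assert (Hq : forall m, Rpower q (INR m + 1 / 2) / (1 + q ^ (2 * m + 1)) = / (2 * ch m))
    by (intros; now apply nome_quotient_odd).
  assert (Hw : forall m, freq_odd k m <> 0) by (intros; apply Rgt_not_eq; now apply freq_odd_pos).
  apply (jacobi_family_spectral_data k Hk 1 (Delta k) (fun p => INR p ^ 2 + k ^ 2 * INR (p + 1) ^ 2) _
    ltac:(lia) (continuous_Delta k Hk) (Rabs_Delta_le1 k Hk) (fun x _ => Delta_neq0 k Hk x)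
    (ellD2_sin_pow_Delta k Hk) (2 / sqrt PI) (h_q k) ltac:(apply div_sqrt_PI_pos; lra) h_q_ellInt
    0 (freq_odd k) _ _ (fun m => ellD2_sin_ellF k Hk (freq_odd k m)) (fun m x => Rabs_sin_le1 _))
    with (L := freq_odd k) (V := fun m => freq_odd k m * (PI / (2 * k * ch m)))
         (a := fun n => (2 * INR n + 1) ^ 2 + k ^ 2 * (2 * INR n + 2) ^ 2)
         (b := fun n => k ^ 2 * (2 * INR n + 1) ^ 2 * (2 * INR n) ^ 2); cbv beta; auto.
  - intros l m. rewrite ellF_0, !Rmult_0_r, sin_0. ring.
  - intros l m. rewrite !cos_freq_odd by auto. ring.
  - intros m n. rewrite ellF_0, !Rmult_0_r, sin_0, odd_pow_boundary. ring.
  - intros m n. rewrite !cos_freq_odd, cos_PI2 by auto. ring.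
  - intros m. left. now apply freq_odd_pos.
  - apply freq_odd_lt.
  - intros m _. destruct m as [|m].
    (* The lowered frequency is the negative of the lowest one, and the sine is odd, hence the sign
       -1. *)
    + exists 0%nat, (-1). split; [lia|]. intros x. rewrite product_cos_sin, freq_odd_S, freq_odd_0_minus by auto.
      rewrite Ropp_mult_distr_l_reverse, sin_neg. ring.
    + exists m, 1. split; [lia|]. intros x. rewrite product_cos_sin, !freq_odd_S by auto.
      rewrite Rplus_minus_r. ring.
  - intros x Hx. apply Rgt_not_eq, sin_gt_0; pose proof (freq_odd_0_inside x Hx); lra.
  - intros m _. apply (ratio_limit_sin k Hk); [now apply continuous_Delta | apply Delta_0].
  - intros m _. apply coef0_q; auto. now apply cos_freq_odd.
  - intros m _. specialize (Hch m). apply Rgt_not_eq, Rmult_lt_0_compat; [now apply freq_odd_pos|].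
    apply Rdiv_lt_0_compat; [lra|]. apply Rmult_lt_0_compat; lra.
  - intros m _. rewrite ellInt_sin_sqr; auto.
    + change (ellF k (PI / 2)) with K. lra.
    + now apply sin_2_freq_odd.
  - intros n. rewrite !plus_INR, mult_INR. change (INR 2) with 2. change (INR 1) with 1. ring.
  - intros n. rewrite plus_INR, mult_INR. change (INR 2) with 2. change (INR 1) with 1. ring.
  - intros m _. rewrite Hq. replace (freq_odd k m * _ / freq_odd k m) with (PI / (2 * k * ch m))
      by (field; specialize (Hch m); repeat split; auto; lra).
    rewrite (Rmult_assoc 2 k), half_PI_quotient. specialize (Hch m). field. lra.
  - intros m _. rewrite !Hq. pose proof sqrt_PI_pos.
    apply quotient_decr; auto; [apply Rdiv_lt_0_compat; lra|].
    split; [left; now apply freq_odd_pos | apply freq_odd_lt].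
  - intros m n _. rewrite freq_odd_sqr. reflexivity.
  - intros m _. specialize (Hw m). specialize (Hch m). pose proof (pos_INR m).
    assert (Hinv : (1 + q ^ (2 * m + 1)) / ((2 * INR m + 1) ^ 2 * Rpower q (INR m + 1 / 2))
                   = 2 * ch m / (2 * INR m + 1) ^ 2).
    { rewrite <- (Rinv_inv (2 * ch m)), <- Hq. unfold Rdiv. rewrite !Rinv_mult, Rinv_inv. ring. }
    rewrite Hinv. rewrite ellInt_sin_sqr; auto; [|now apply sin_2_freq_odd].
    change (ellF k (PI / 2)) with K.
    (* The limit [L m] and the coefficient [V m] each carry a factor [freq_odd k m]; its square
       accounts for [(2 m + 1)^2] and, with the [K / 2] of the norm of [f m], for [K^3]. *)
    replace (freq_odd k m * (freq_odd k m * (PI / (2 * k * ch m))))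
      with (freq_odd k m ^ 2 * (PI / (2 * k * ch m))) by ring.
    rewrite freq_odd_sqr. field. repeat split; lra.
Qed.

(** The enumeration starts at 1 because the sine of frequency 0 is the zero function. *)
Lemma spectral_data_s :
  has_spectral_data (hankel (h_s k)) 1
    (fun m => 4 * sqrt PI / k ^ 2 * (q ^ m / (1 + q ^ (2 * m))))
    (fun m n => (-1) ^ n / (k ^ n * INR (fact (2 * n + 1)))
                * SC_s k n (PI ^ 2 * INR m ^ 2 / K ^ 2))
    (fun m => k ^ 2 * K ^ 3 / (2 * PI ^ 3) * ((1 + q ^ (2 * m)) / (INR m ^ 2 * q ^ m))).
Proof.
  pose proof (K_pos k Hk) as HK. change (ellF k (PI / 2)) with K in HK. pose proof PI_RGT_0.
  set (ch := fun m => cosh (freq_even k m * ellF (sqrt (1 - k ^ 2)) (PI / 2))).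
  assert (Hch : forall m, 0 < ch m) by (intros; apply cosh_gt0).
  assert (Hq : forall m, q ^ m / (1 + q ^ (2 * m)) = / (2 * ch m)) by (intros; now apply nome_quotient_even).
  assert (Hw : forall m, (1 <= m)%nat -> freq_even k m <> 0)
    by (intros; apply Rgt_not_eq; now apply freq_even_pos).
  assert (Hk2 : 0 < k ^ 2) by (apply pow_lt; lra).
  apply (jacobi_family_spectral_data k Hk 1 cos (fun p => INR (p + 1) ^ 2 + k ^ 2 * INR p ^ 2) _
    ltac:(lia) continuous_cos Rabs_cos_le1 cos_neq0_inside
    (ellD2_sin_pow_cos k Hk) (4 / sqrt PI) (h_s k) ltac:(apply div_sqrt_PI_pos; lra) h_s_ellInt
    1 (freq_even k) _ _ (fun m => ellD2_sin_ellF k Hk (freq_even k m)) (fun m x => Rabs_sin_le1 _))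
    with (L := freq_even k) (V := fun m => freq_even k m / k ^ 2 * (PI / (2 * ch m)))
         (a := fun n => k ^ 2 * (2 * INR n + 1) ^ 2 + (2 * INR n + 2) ^ 2)
         (b := fun n => k ^ 2 * (2 * INR n + 1) ^ 2 * (2 * INR n) ^ 2); cbv beta; auto.
  - intros l m. rewrite ellF_0, !Rmult_0_r, sin_0. ring.
  - intros l m. rewrite !sin_freq_even by auto. ring.
  - intros m n. rewrite ellF_0, !Rmult_0_r, sin_0, odd_pow_boundary. ring.
  - intros m n. rewrite !sin_freq_even, cos_PI2 by auto. ring.
  - now apply freq_even_ge0.
  - apply freq_even_lt.
  - intros m Hm. destruct m as [|[|m]]; [lia | |].
    (* For [m = 1] the lowered frequency is 0 and its sine vanishes; the weight 0 makes the index 1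
       a mere placeholder in the admissible range. *)
    + exists 1%nat, 0. split; [lia|]. intros x. rewrite product_cos_sin, !freq_even_S by auto.
      rewrite freq_even_0, Rplus_minus_r, !Rmult_0_l, sin_0. ring.
    + exists (S m), 1. split; [lia|]. intros x. rewrite product_cos_sin, !freq_even_S by auto.
      rewrite Rplus_minus_r. ring.
  - intros x Hx. pose proof (ellF_fraction k Hk x Hx) as HF.
    replace (freq_even k 1 * ellF k x) with (PI * (ellF k x / ellF k (PI / 2))).
    + apply Rgt_not_eq, sin_gt_0; lra.
    + unfold freq_even. simpl INR. field. apply Rgt_not_eq, (K_pos k Hk).
  - intros m _. apply (ratio_limit_sin k Hk); [apply continuous_cos | apply cos_0].
  - intros m _. apply coef0_s; auto. now apply sin_freq_even.
  - intros m Hm. specialize (Hch m). apply Rgt_not_eq, Rmult_lt_0_compat.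
    + apply Rdiv_lt_0_compat; auto. now apply freq_even_pos.
    + apply Rdiv_lt_0_compat; lra.
  - intros m Hm. rewrite ellInt_sin_sqr; auto.
    + change (ellF k (PI / 2)) with K. lra.
    + now apply sin_2_freq_even.
  - intros n. rewrite !plus_INR, mult_INR. change (INR 2) with 2. change (INR 1) with 1. ring.
  - intros n. rewrite plus_INR, mult_INR. change (INR 2) with 2. change (INR 1) with 1. ring.
  - intros m Hm. rewrite Hq. specialize (Hch m). specialize (Hw m Hm).
    replace (4 / sqrt PI * (freq_even k m / k ^ 2 * (PI / (2 * ch m)) / freq_even k m))
      with (4 / sqrt PI * (PI / (2 * ch m)) / k ^ 2)
      by (pose proof sqrt_PI_pos; field; repeat split; auto; lra).
    rewrite half_PI_quotient. field. repeat split; lra.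
  - intros m _. rewrite !Hq. pose proof sqrt_PI_pos.
    apply quotient_decr; auto; [apply Rdiv_lt_0_compat; lra|].
    split; [now apply freq_even_ge0 | apply freq_even_lt].
  - intros m n _. rewrite freq_even_sqr. reflexivity.
  - intros m Hm. specialize (Hw m Hm). specialize (Hch m).
    pose proof (lt_0_INR m Hm).
    assert (Hinv : (1 + q ^ (2 * m)) / (INR m ^ 2 * q ^ m) = 2 * ch m / INR m ^ 2).
    { rewrite <- (Rinv_inv (2 * ch m)), <- Hq. unfold Rdiv. rewrite !Rinv_mult, Rinv_inv. ring. }
    rewrite Hinv. rewrite ellInt_sin_sqr; auto; [|now apply sin_2_freq_even].
    change (ellF k (PI / 2)) with K.
    replace (freq_even k m * (freq_even k m / k ^ 2 * (PI / (2 * ch m))))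
      with (freq_even k m ^ 2 / k ^ 2 * (PI / (2 * ch m))) by (field; lra).
    rewrite freq_even_sqr. field. repeat split; lra.
Qed.
End Spectra.

Theorem theorem12 (k : R) (hk : 0 < k < 1) :
  let K := ellK k in
  let q := nome k in
  (forall n : nat, exists I : R,
     is_RInt (fun t => t ^ (2 * n) * sqrt ((1 - t ^ 2) / (1 - k ^ 2 * t ^ 2)))
       0 1 I /\
     h_p k n = 4 * k ^ n / sqrt PI * I) /\
  (forall n : nat, exists I : R,
     is_RInt_gen
       (fun t => t ^ (2 * n + 2) * sqrt ((1 - k ^ 2 * t ^ 2) / (1 - t ^ 2)))
       (at_point 0) (at_left 1) I /\
     h_q k n = 2 * k ^ n / sqrt PI * I) /\
  (forall n : nat, exists I : R,
     is_RInt_gen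
       (fun t => t ^ (2 * n) * sqrt ((1 - k ^ 2 * t ^ 2) / (1 - t ^ 2)))
       (at_point 0) (at_left 1) I /\
     h_r k n = 2 * k ^ n / sqrt PI * I) /\
  (forall n : nat, exists I : R,
     is_RInt
       (fun t => t ^ (2 * n + 2) * sqrt ((1 - t ^ 2) / (1 - k ^ 2 * t ^ 2)))
       0 1 I /\
     h_s k n = 4 * k ^ n / sqrt PI * I) /\
  has_spectral_data (hankel (h_p k)) 0
    (fun m => 4 * sqrt PI / k
              * (Rpower q (INR m + 1 / 2) / (1 + q ^ (2 * m + 1))))
    (fun m n => (-1) ^ n / (k ^ n * INR (fact (2 * n)))
                * SC_p k n (PI ^ 2 * (2 * INR m + 1) ^ 2 / (4 * K ^ 2)))
    (fun m => k * K / (2 * PI)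
              * ((1 + q ^ (2 * m + 1)) / Rpower q (INR m + 1 / 2))) /\
  has_spectral_data (hankel (h_q k)) 0
    (fun m => 2 * sqrt PI / k
              * (Rpower q (INR m + 1 / 2) / (1 + q ^ (2 * m + 1))))
    (fun m n => (-1) ^ n / (k ^ n * INR (fact (2 * n + 1)))
                * SC_q k n (PI ^ 2 * (2 * INR m + 1) ^ 2 / (4 * K ^ 2)))
    (fun m => 2 * k * K ^ 3 / PI ^ 3
              * ((1 + q ^ (2 * m + 1))
                 / ((2 * INR m + 1) ^ 2 * Rpower q (INR m + 1 / 2)))) /\
  has_spectral_data (hankel (h_r k)) 0
    (fun m => 2 * sqrt PI * (q ^ m / (1 + q ^ (2 * m))))
    (fun m n => (-1) ^ n / (k ^ n * INR (fact (2 * n)))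
                * SC_r k n (PI ^ 2 * INR m ^ 2 / K ^ 2))
    (* the orthogonality measure has a halved mass at m = 0 *)
    (fun m => (if Nat.eqb m 0 then 2 else 1)
              * (K / (2 * PI) * ((1 + q ^ (2 * m)) / q ^ m))) /\
  has_spectral_data (hankel (h_s k)) 1
    (fun m => 4 * sqrt PI / k ^ 2 * (q ^ m / (1 + q ^ (2 * m))))
    (fun m n => (-1) ^ n / (k ^ n * INR (fact (2 * n + 1)))
                * SC_s k n (PI ^ 2 * INR m ^ 2 / K ^ 2))
    (fun m => k ^ 2 * K ^ 3 / (2 * PI ^ 3)
              * ((1 + q ^ (2 * m)) / (INR m ^ 2 * q ^ m))).
Proof.
  intros K q.
  assert (E : forall n, (2 * n + 2 = 2 * S n)%nat) by (intros; lia).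
  split; [|split; [|split; [|split; [|split; [|split; [|split]]]]]].
  - intros n. exists (moment_cn k n). split; [now apply is_RInt_moment_cn | now apply h_p_moment].
  - intros n. exists (moment_dn k (S n)). rewrite E.
    split; [now apply is_RInt_gen_moment_dn | now apply h_q_moment].
  - intros n. exists (moment_dn k n). split; [now apply is_RInt_gen_moment_dn | now apply h_r_moment].
  - intros n. exists (moment_cn k (S n)). rewrite E.
    split; [now apply is_RInt_moment_cn | now apply h_s_moment].
  - now apply spectral_data_p.
  - now apply spectral_data_q.
  - now apply spectral_data_r.
  - now apply spectral_data_s.
Qed.
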